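(* Let $\{(T_\theta,\varphi):\theta\in\Theta\}$, $\Theta\subseteq\mathbb{R}^p$, be a distributional statistical model and let $\mathcal{O}:\mathcal{S}'(\mathbb{R})\to\mathcal{Y}$ be a measurable observation operator such that the pushforward family $\{P_\theta^{\mathcal{O}}:\theta\in\Theta\}$ is locally asymptotically normal (LAN) at $\theta_0\in\Theta$ with non-singular Fisher information matrix $I_{\mathcal{O}}(\theta_0)$. Then for any regular estimator sequence $\hat\theta_n$ based on i.i.d. observations $Y_1,\dots,Y_n$ from the pushforward model (where $Y_i=\mathcal{O}(T_{X_i})$), there is a probability distribution $M$ on $\mathbb{R}^p$ such that, under $P_{\theta_0}^{\mathcal{O}}$, $$\sqrt n\,(\hat\theta_n-\theta_0)\ \xrightarrow{\ \mathcal{D}\ }\ \mathcal{N}\bigl(0,\,I_{\mathcal{O}}(\theta_0)^{-1}\bigr)*M,$$ where $*$ denotes convolution. In particular, the asymptotic covariance matrix of $\hat\theta_n$ (the covariance matrix of the limit law of $\sqrt n(\hat\theta_n-\theta_0)$) is $\ge I_{\mathcal{O}}(\theta_0)^{-1}$ in the Löwner order.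
   Context: Distributional statistical model: a parametric family $\{P_\theta:\theta\in\Theta\}$ of probability measures, each represented by a pair $(T_\theta,\varphi)$ with $T_\theta\in\mathcal{S}'(\mathbb{R})$ (tempered distribution) and a fixed kernel $\varphi\in\mathcal{S}(\mathbb{R})$ (Schwartz function) not depending on $\theta$, with $\mathrm{E}_{T_\theta,\varphi}[\psi]=\langle T_\theta,\psi\varphi\rangle$ for functions $\psi$ such that $\psi\varphi\in\mathcal{S}(\mathbb{R})$, $\langle T_\theta,\varphi\rangle=1$, and $\langle T_\theta,\psi\varphi\rangle\ge0$ whenever $\psi\ge0$. Observation operator: a measurable map $\mathcal{O}:(\mathcal{S}'(\mathbb{R}),\mathcal{C})\to(\mathcal{Y},\mathcal{B}_{\mathcal{Y}})$ into a measurable space, $\mathcal{C}$ being the cylindrical $\sigma$-algebra generated by the maps $T\mapsto\langle T,f\rangle$, $f\in\mathcal{S}(\mathbb{R})$. The pushforward model is $P_\theta^{\mathcal{O}}=P_\theta\circ\mathcal{O}^{-1}$ on $\mathcal{Y}$, i.e. the law of $Y=\mathcal{O}(T_X)$, where $X\sim P_\theta$ and $T_X$ is the $\mathcal{S}'(\mathbb{R})$-valued object associated with $X$. LAN at $\theta_0$ with Fisher information $I_{\mathcal{O}}(\theta_0)$: for each $h\in\mathbb{R}^p$, $$\log\frac{dP_{\theta_0+h/\sqrt n}^{\mathcal{O},\otimes n}}{dP_{\theta_0}^{\mathcal{O},\otimes n}}=h^\top\Delta_n(\theta_0)-\tfrac12h^\top I_{\mathcal{O}}(\theta_0)h+o_{P_{\theta_0}}(1),$$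 where $\Delta_n(\theta_0)$ converges in distribution to $\mathcal{N}(0,I_{\mathcal{O}}(\theta_0))$ under $P_{\theta_0}^{\mathcal{O},\otimes n}$. Regular estimator sequence (at $\theta_0$): for every $h\in\mathbb{R}^p$, $\sqrt n(\hat\theta_n-\theta_0-h/\sqrt n)$ converges in distribution under $P_{\theta_0+h/\sqrt n}^{\mathcal{O},\otimes n}$ to a limit law that does not depend on $h$. *)

(* Defs.v *)
From HB Require Import structures.
From mathcomp Require Import all_boot all_order all_algebra.
From mathcomp Require Import all_classical all_reals all_analysis.
From mathcomp Require Import measurable_realfun.
Set Implicit Arguments.
Unset Strict Implicit.
Unset Printing Implicit Defensive.
Import Order.TTheory GRing.Theory Num.Theory.
Import numFieldNormedType.Exports.
Local Open Scope classical_set_scope.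
Local Open Scope ring_scope.

Definition is_schwartz (R : realType) (f : R -> R^o) : Prop :=
  (forall k x, derivable (derive1n k f) x 1) /\
  (forall j k, exists C : R, forall x, `|x ^+ j * derive1n k f x| <= C).

Definition schwartz_pred (R : realType) : {pred R -> R^o} :=
  fun f => `[< is_schwartz f >].

Record schwartz (R : realType) : Type := Schwartz {
  schwartz_fun :> R -> R^o;
  _ : schwartz_fun \in @schwartz_pred R }.

Section schwartz_lmodule.
Variable R : realType.

Lemma derive1nD_schwartz (f g : R -> R^o) :
  (forall k x, derivable (derive1n k f) x 1) ->
  (forall k x, derivable (derive1n k g) x 1) ->
  forall k, derive1n k (f + g) = derive1n k f + derive1n k g.
Proof.
move=> df dg; elim=> [|k IH] //.
rewrite derive1nS IH !derive1nS; apply/funext => x.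
by rewrite derive1E deriveD// -!derive1E.
Qed.

Lemma derive1nZ_schwartz (c : R) (f : R -> R^o) :
  (forall k x, derivable (derive1n k f) x 1) ->
  forall k, derive1n k (c *: f) = c *: derive1n k f.
Proof.
move=> df; elim=> [|k IH] //.
rewrite derive1nS IH !derive1nS; apply/funext => x.
by rewrite derive1E deriveZ// -!derive1E.
Qed.

Lemma derive1n0_schwartz k : derive1n k (0 : R -> R^o) = 0.
Proof.
elim: k => [|k IH] //; rewrite derive1nS IH; apply/funext => x.
by rewrite derive1E derive_cst.
Qed.

Lemma schwartz_submod_closed : submod_closed (@schwartz_pred R).
Proof.
split.
  apply/asboolP; split => [k x|j k].
    by rewrite derive1n0_schwartz; exact: derivable_cst.
  by exists 0 => x; rewrite derive1n0_schwartz mulr0 normr0.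
move=> c f g /asboolP[df bf] /asboolP[dg bg].
have dcf k x : derivable (derive1n k (c *: f)) x 1.
  by rewrite derive1nZ_schwartz//; apply: derivableZ.
apply/asboolP; split => [k x|j k].
  by rewrite derive1nD_schwartz//; apply: derivableD.
have [C Cf] := bf j k; have [D Dg] := bg j k.
exists (`|c| * C + D) => x.
rewrite derive1nD_schwartz// derive1nZ_schwartz// [X in x ^+ j * X]/=.
rewrite mulrDr (le_trans (ler_normD _ _))// lerD//.
by rewrite mulrCA normrM ler_wpM2l.
Qed.

HB.instance Definition _ :=
  GRing.isSubmodClosed.Build R (R -> R^o) (@schwartz_pred R)
    schwartz_submod_closed.
HB.instance Definition _ := [isSub for @schwartz_fun R].
HB.instance Definition _ := [Choice of schwartz R by <:].
HB.instance Definition _ := [SubChoice_isSubLmodule of schwartz R by <:].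

(* The usual Frechet topology: the coarsest one that makes each map
   f |-> x ^ j f^(k) continuous for uniform convergence, i.e. the one defined
   by the seminorms sup_x |x ^ j f^(k)(x)|. *)
Definition schwartz_seminorm_map (f : schwartz R) :
  prod_topology (fun _ : nat * nat => {uniform R -> R}) :=
  fun jk x => x ^+ jk.1 * derive1n jk.2 f x.

HB.instance Definition _ :=
  Uniform.copy (schwartz R) (initial_topology schwartz_seminorm_map).

End schwartz_lmodule.

Record tempered (R : realType) : Type := Tempered {
  tempered_fun :> {scalar schwartz R};
  _ : continuous (tempered_fun : schwartz R -> R) }.

Section tempered_measurable.
Variable R : realType.

Lemma null_tempered_continuous :
  continuous ((\0 : {scalar schwartz R}) : schwartz R -> R).
Proof. exact: (@cst_continuous (schwartz R) R 0). Qed.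

HB.instance Definition _ := gen_eqMixin (tempered R).
HB.instance Definition _ := gen_choiceMixin (tempered R).
HB.instance Definition _ :=
  isPointed.Build (tempered R) (Tempered null_tempered_continuous).

Definition cylinders : set (set (tempered R)) :=
  [set A | exists (f : schwartz R) (B : set R),
     measurable B /\ A = [set T : tempered R | B (T f)]].

HB.instance Definition _ :=
  Measurable.copy (tempered R) (g_sigma_algebraType cylinders).

End tempered_measurable.

Definition measure_mx_display : measure_display -> measure_display.
Proof. exact. Qed.

Section measurable_mx.
Context {d} {T : measurableType d}.
Variables m n : nat.

(* Product sigma-algebra; over the reals it is the Borel sigma-algebra. *)
Definition mx_cylinders : set (set 'M[T]_(m, n)) :=
  [set A | exists i j (B : set T),
     measurable B /\ A = [set M : 'M[T]_(m, n) | B (M i j)]].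

Let mx_setC A : <<s mx_cylinders >> A -> <<s mx_cylinders >> (~` A).
Proof. exact: sigma_algebraC. Qed.

HB.instance Definition _ := @isMeasurable.Build (measure_mx_display d)
  'M[T]_(m, n) <<s mx_cylinders >> (@sigma_algebra0 _ setT mx_cylinders)
  mx_setC (@sigma_algebra_bigcup _ setT mx_cylinders).

Lemma measurable_mxcoord i j :
  measurable_fun setT (fun M : 'M[T]_(m, n) => M i j).
Proof.
move=> _ B mB; rewrite setTI; apply: sub_sigma_algebra.
by exists i, j, B.
Qed.

Lemma measurable_mxP d' (S : measurableType d') (f : S -> 'M[T]_(m, n)) :
  (forall i j, measurable_fun setT (fun x => f x i j)) -> measurable_fun setT f.
Proof.
move=> mf; apply: (@measurability _ _ _ _ setT f mx_cylinders) => //.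
move=> _ [_ [i [j [B [mB ->]]]] <-].
by have := mf i j measurableT B mB.
Qed.

End measurable_mx.

Definition vdot (R : realType) (p : nat) (u v : 'cV[R]_p) : R :=
  (u^T *m v) 0 0.

Definition positive_semidefinite (R : realType) (p : nat) (S : 'M[R]_p) : Prop :=
  S^T = S /\ forall u : 'cV[R]_p, 0 <= vdot u (S *m u).

Definition loewner_le (R : realType) (p : nat) (S1 S2 : 'M[R]_p) : Prop :=
  positive_semidefinite (S2 - S1).

Section iid.
Context d (T : measurableType d) (R : realType) (P : probability T R).

Definition cons_pair n (xt : T * n.-tuple T) : n.+1.-tuple T :=
  [tuple of xt.1 :: xt.2].

Lemma measurable_cons_pair n : measurable_fun setT (@cons_pair n).
Proof. exact: measurable_cons. Qed.

HB.instance Definition _ n :=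
  isMeasurableFun.Build _ _ _ _ (@cons_pair n) (@measurable_cons_pair n).

Fixpoint iid n : probability (n.-tuple T) R :=
  match n with
  | 0 => dirac [tuple]
  | n'.+1 => distribution (P \x iid n')%E (@cons_pair n')
  end.

Lemma iidE n (A : 'I_n -> set T) : (forall i, measurable (A i)) ->
  iid n [set t | forall i, A i (tnth t i)] = (\prod_(i < n) P (A i))%E.
Proof.
elim: n A => [|n IH] A mA /=.
  by rewrite big_ord0 diracE mem_set// => -[].
rewrite /distribution /pushforward big_ord_recl -IH//.
rewrite -product_measure1E//; last first.
  rewrite (_ : [set _ | _] = \bigcap_(i in [set: 'I_n])
    ((fun t : n.-tuple T => tnth t i) @^-1` A (lift ord0 i))).
    apply: fin_bigcap_measurable => // i _.
    by rewrite -[X in measurable X]setTI; apply: measurable_tnth.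
  by apply/seteqP; split=> [t tA i _|t tA i]; exact: tA.
congr ((_ \x _)%E _); apply/seteqP; split => -[x t] /=.
  by move=> h; split=> [|i]; [have := h ord0|have := h (lift ord0 i); rewrite tnthS].
by move=> [h0 h] i; have [j ->|->] := unliftP ord0 i; rewrite ?tnthS.
Qed.

End iid.

Section gaussian.
Variables (R : realType) (p : nat).

Definition affine_std (m : 'cV[R]_p) (A : 'M[R]_p)
  (z : p.-tuple (measurableTypeR R)) : 'cV[R]_p := m + A *m (\col_i tnth z i).

Lemma measurable_affine_std m A : measurable_fun setT (affine_std m A).
Proof.
apply: measurable_mxP => i j.
rewrite (_ : (fun _ => _) = fun z : p.-tuple (measurableTypeR R) =>
    m i j + \sum_(k < p) A i k * (tnth z k : R)); last first.
  apply/funext => z; rewrite !mxE; congr (_ + _).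
  by apply: eq_bigr => k _; rewrite mxE.
apply: measurable_funD => //; apply: measurable_sum => k.
apply: measurable_funM => //.
exact: (@measurable_tnth _ (measurableTypeR R) p k).
Qed.

HB.instance Definition _ m A := isMeasurableFun.Build _ _ _ _
  (affine_std m A) (measurable_affine_std m A).

(* The law of m + A Z, with A A^T = S and Z a vector of p independent standard
   normal variables; it does not depend on the choice of the root A, which
   exists whenever S is positive semidefinite. *)
Definition gaussian (m : 'cV[R]_p) (S : 'M[R]_p) : probability 'cV[R]_p R :=
  distribution (iid (normal_prob 0 1) p)
    (affine_std m (xget 0 [set A : 'M[R]_p | A *m A^T = S])).

Definition add_pair (xy : 'cV[R]_p * 'cV[R]_p) : 'cV[R]_p := xy.1 + xy.2.

Lemma measurable_add_pair : measurable_fun setT add_pair.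
Proof.
apply: measurable_mxP => i j.
rewrite (_ : (fun _ => _) = fun xy : 'cV[R]_p * 'cV[R]_p => xy.1 i j + xy.2 i j).
  by apply: measurable_funD;
    apply: (measurableT_comp (@measurable_mxcoord _ _ _ _ i j)).
by apply/funext => xy; rewrite mxE.
Qed.

HB.instance Definition _ :=
  isMeasurableFun.Build _ _ _ _ add_pair measurable_add_pair.

Definition convolution (mu nu : probability 'cV[R]_p R) : probability 'cV[R]_p R :=
  distribution (mu \x nu)%E add_pair.

Definition finite_second_moments (mu : probability 'cV[R]_p R) : Prop :=
  forall i, mu.-integrable setT (fun x : 'cV[R]_p => ((x i 0) ^+ 2)%:E).

Definition covariance_mx (mu : probability 'cV[R]_p R) : 'M[R]_p :=
  \matrix_(i, j) fine (covariance mu (fun x : 'cV[R]_p => x i 0)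
                                     (fun x : 'cV[R]_p => x j 0)).

End gaussian.

(* Convergence in distribution of the random vectors X n, each on its own
   probability space, to the law L. *)
Definition cvg_in_distribution (R : realType) (p : nat) (d : measure_display)
    (Om : nat -> measurableType d) (P : forall n, probability (Om n) R)
    (X : forall n, Om n -> 'cV[R]_p) (L : probability 'cV[R]_p R) : Prop :=
  forall f : 'cV[R]_p -> R, continuous f ->
    (exists C : R, forall x, `|f x| <= C) ->
    ('E_(P n)[f \o X n] @[n --> \oo] --> 'E_L[f])%E.

(* L is the density, with respect to Q, of the part of P that is absolutely
   continuous with respect to Q (Lebesgue decomposition). *)
Definition likelihood_ratio d (T : measurableType d) (R : realType)
    (P Q : probability T R) (L : T -> \bar R) : Prop :=
  [/\ measurable_fun setT L, (forall x, 0 <= L x)%E &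
    exists N : set T, [/\ measurable N, Q N = 0%E &
      forall A, measurable A ->
        P A = (\int[Q]_(x in A) L x + P (A `&` N))%E]].

Section local_asymptotics.
Context (R : realType) (p : nat) d (Y : measurableType d).
Variable theta0 : 'cV[R]_p.
Implicit Types (Theta : set 'cV[R]_p) (Q : 'cV[R]_p -> probability Y R).

Definition local_param (h : 'cV[R]_p) (n : nat) : 'cV[R]_p :=
  theta0 + (Num.sqrt n%:R)^-1 *: h.

(* Local parameters need only lie in Theta for n large. *)
Definition LAN Theta Q (FI : 'M[R]_p) : Prop :=
  positive_semidefinite FI /\
  exists Delta : forall n, {mfun n.-tuple Y >-> 'cV[R]_p},
    cvg_in_distribution (fun n => iid (Q theta0) n) (fun n => Delta n)
      (gaussian 0 FI) /\
    forall h,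
      (\forall n \near \oo, Theta (local_param h n)) /\
      exists Lr : forall n, n.-tuple Y -> \bar R,
        (forall n, likelihood_ratio (iid (Q (local_param h n)) n)
                     (iid (Q theta0) n) (Lr n)) /\
        forall eps : R, 0 < eps ->
          iid (Q theta0) n [set y | (eps%:E <=
              `|lne (Lr n y)
                - (vdot h (Delta n y) - 2^-1 * vdot h (FI *m h))%:E|)%E]
            @[n --> \oo] --> 0%E.

Definition regular_estimator Q
    (est : forall n, {mfun n.-tuple Y >-> 'cV[R]_p}) : Prop :=
  exists L : probability 'cV[R]_p R, forall h,
    cvg_in_distribution (fun n => iid (Q (local_param h n)) n)
      (fun n y => Num.sqrt n%:R *: (est n y - local_param h n)) L.

End local_asymptotics.

(* The products psi phi are required to be Schwartz functions; in the last
   clause the equality with a real number includes integrability of psi. *)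
Definition represented_by (R : realType) (P : probability R R)
    (T : tempered R) (phi : schwartz R) : Prop :=
  [/\ T phi = 1,
      (forall (psi : R -> R) (f : schwartz R),
         (forall x, f x = psi x * phi x) -> (forall x, 0 <= psi x) -> 0 <= T f) &
      (forall (psi : R -> R) (f : schwartz R), measurable_fun setT psi ->
         (forall x, f x = psi x * phi x) -> ('E_P[psi] = (T f)%:E)%E)].

Definition distributional_model (R : realType) (p : nat) (Theta : set 'cV[R]_p)
    (P : 'cV[R]_p -> probability R R)
    (T : 'cV[R]_p -> tempered R) (phi : schwartz R) : Prop :=
  forall theta, Theta theta -> represented_by (P theta) (T theta) phi.

(* The law of O(T_X) for X distributed according to P, where TX : x |-> T_x. *)
Definition observation_law (R : realType) d (Y : measurableType d)
    (P : probability R R)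
    (TX : {mfun R >-> tempered R})
    (O : {mfun tempered R >-> Y}) : probability Y R :=
  distribution (distribution P TX) O.

(* Main.v *)
(* Let S_n = sqrt n (est_n - theta0), with limit law L. Along a free ultrafilter
   the pair (S_n, Delta_n) has a joint limit law J whose second marginal is
   N(0, I); this is Prohorov's theorem, obtained here by taking standard parts
   under a Loeb measure. LAN and regularity at h give
     E_J[f(S - h) exp(h.Delta - h.I h / 2)] <= E_L[f],
   with equality since both sides have total mass one. Write I^-1 = B B^T, put
   h = - tau B v and average over a standard normal v: the posterior of v is
   normal, so that L = N(0, s^2 I^-1) * M_s for some law M_s, where
   s = tau / sqrt(1 + tau^2). The M_s are tight, and a limit point of them as
   s -> 1 is the required M. No characteristic functions are involved. *)
Require Import Defs.
From HB Require Import structures.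
From mathcomp Require Import all_boot all_order all_algebra.
From mathcomp Require Import all_classical all_reals all_analysis.
From mathcomp Require Import measurable_realfun.
From mathcomp Require Import ring lra.
Set Implicit Arguments.
Unset Strict Implicit.
Unset Printing Implicit Defensive.
Import Order.TTheory GRing.Theory Num.Theory.
Import numFieldNormedType.Exports.
Local Open Scope classical_set_scope.
Local Open Scope ring_scope.

(** * Loeb measures *)

(** Convergence in law is known for S_n and Delta_n separately, so their joint law need not
    converge. A fixed free ultrafilter replaces the extraction of subsequences, and it leaves no
    trace: what is compared in the end is L, the limit of the whole sequence. The exponential in the
    change of measure is unbounded, and the shifted law may have a part singular to the law at
    theta0; truncating the one and dropping the other both lose mass in the same direction, hence an
    inequality. That no mass is lost in the limit comes from the Gaussian moment generating function
    of Delta under J. A flat prior on h would give s = 1 at once but has infinite mass; the proper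
    normal prior of scale tau is the reason for s < 1 and for the last passage to the limit.
    Subtracting the posterior mean of h turns S into S - s^2 I^-1 Delta, whose law, reweighted by
    the averaged likelihood, is M_s. Test functions are Lipschitz with values in [0, 1]: they
    determine a law, are stable under f -> 1 - f, and control f(y + s g) - f(y + g) uniformly in
    y. *)

Lemma ultra_fmap (S V : Type) (f : S -> V) (U : set_system S) :
  UltraFilter U -> UltraFilter (f @ U).
Proof.
move=> UU; split; first exact: fmap_proper_filter.
move=> G GF sub; apply/seteqP; split => // A GA.
have [//|UnA] := in_ultra_setVsetC (f @^-1` A) UU.
suff : G (A `&` ~` A) by rewrite setICr => /(@filter_not_empty _ G).
by apply: filterI => //; exact: (sub (~` A)).
Qed.

(** Compactness of [-C, C]: an ultrafilter on a compact set converges. This is the source of all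
    standard parts below. *)
Lemma ultra_cvg (R : realType) (S : Type) (U : set_system S) (x : S -> R) (C : R) :
  UltraFilter U -> (\forall n \near U, `|x n| <= C) -> cvg (x @ U).
Proof.
move=> UU xC; have := segment_compact (a := - C) (b := C).
rewrite compact_ultra => /(_ _ (ultra_fmap x UU)) [].
  by rewrite /fmap/=; apply: filterS xC => n; rewrite /= in_itv/= ler_norml.
by move=> l [_ xl]; apply/cvg_ex; exists l.
Qed.

Lemma ultra_nonempty (S : Type) (U : set_system S) (A : set S) :
  UltraFilter U -> U A -> A !=set0.
Proof.
move=> UU UA; apply/set0P/eqP => A0.
by apply: (@filter_not_empty _ U _); rewrite -A0.
Qed.

Lemma ultra_dicho (S : Type) (U : set_system S) (A : set S) :
  UltraFilter U -> ~ U A -> U (~` A).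
Proof. by move=> UU nA; have [|] := in_ultra_setVsetC A UU. Qed.

Definition free_ultra : set_system nat :=
  sval (cid (ultraFilterLemma eventually_filter)).

#[global] Instance free_ultra_filter : UltraFilter free_ultra.
Proof. by rewrite /free_ultra; case: cid => ? []. Qed.

Lemma free_ultra_eventually : \oo `<=` free_ultra.
Proof. by rewrite /free_ultra; case: cid => ? []. Qed.

Local Notation U := free_ultra.
Local Notation UU := free_ultra_filter.

(** Representatives of the points of the ultrapower of [T]. No quotient is taken, since membership
    in an internal set depends on the sequence only up to a set of the ultrafilter. *)
Definition hyper (T : Type) := nat -> T.

Definition loeb_display : measure_display -> measure_display.
Proof. exact. Qed.

Section internal.
Context d (T : measurableType d).
Local Notation H := (hyper T).

Definition internal (a : nat -> set T) : set H := [set w | U [set n | a n (w n)]].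

Lemma internalI a b : internal a `&` internal b = internal (fun n => a n `&` b n).
Proof.
apply/seteqP; split => w /=; rewrite /internal/=; first by case=> ? ?; exact: filterI.
by move=> h; split; apply: filterS h => n [].
Qed.

Lemma internalC a : ~` internal a = internal (fun n => ~` a n).
Proof.
apply/seteqP; split => w /=; rewrite /internal/=; first exact: ultra_dicho.
move=> h h'.
by have [n []] : ([set n | (~` a n) (w n)] `&` [set n | a n (w n)]) !=set0
  by apply: ultra_nonempty; exact: filterI.
Qed.

Lemma internalU a b : internal a `|` internal b = internal (fun n => a n `|` b n).
Proof.
rewrite -[LHS]setCK setCU !internalC internalI internalC; congr internal.
by apply/funext => n; rewrite setCI !setCK.
Qed.

Lemma internal0 : internal (fun=> set0) = set0.
Proof. by apply/seteqP; split => w // h; have [] := ultra_nonempty UU h. Qed.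

(** If the inclusion failed on a set of indices in the ultrafilter, choosing a point of [a n]
    outside [b n] at each such index would give a sequence in [internal a] but not in
    [internal b]. *)
Lemma internal_sub a b : internal a `<=` internal b ->
  \forall n \near U, a n `<=` b n.
Proof.
move=> ab; have [//|nU] := in_ultra_setVsetC [set n | a n `<=` b n] UU.
have cex n : exists x, ~ (a n `<=` b n) -> a n x /\ ~ b n x.
  have [h|] := pselect (a n `<=` b n); first by exists point.
  move=> /existsNP[x /not_implyP h].
  by exists x.
pose w n := projT1 (cid (cex n)).
have wa : internal a w.
  apply: filterS nU => n /=; rewrite /w; case: cid => x /= h /h[]//.
have [n []] : ([set n | b n (w n)] `&` ~` [set n | a n `<=` b n]) !=set0.
  by apply: ultra_nonempty; apply: filterI => //; exact: ab.
by rewrite /= /w; case: cid => x /= h bx /h[].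
Qed.

(** What makes the content of an internal set independent of the sequence that represents it. *)
Lemma internal_inj a b : internal a = internal b -> \forall n \near U, a n = b n.
Proof.
move=> ab; have h1 : internal a `<=` internal b by rewrite ab.
have h2 : internal b `<=` internal a by rewrite ab.
move: (internal_sub h1) (internal_sub h2) => {}h1 {}h2.
by apply: filterS2 h1 h2 => n ? ?; apply/seteqP.
Qed.

Definition internals : set (set H) :=
  [set A | exists2 a, (forall n, measurable (a n)) & A = internal a].

HB.instance Definition _ := gen_eqMixin H.
HB.instance Definition _ := gen_choiceMixin H.
HB.instance Definition _ := isPointed.Build H (fun=> point).

Let internals0 : internals set0.
Proof. by exists (fun=> set0) => //; rewrite internal0. Qed.
Let internalsU : setU_closed internals.
Proof.
move=> _ _ [a ma ->] [b mb ->]; exists (fun n => a n `|` b n).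
  by move=> n; exact: measurableU.
by rewrite internalU.
Qed.
Let internalsC : setC_closed internals.
Proof.
move=> _ [a ma ->]; exists (fun n => ~` a n); last by rewrite internalC.
by move=> n; exact: measurableC.
Qed.

HB.instance Definition _ := @isAlgebraOfSets.Build (loeb_display d) H
  internals internals0 internalsU internalsC.

(** A diagonal choice: [w n] meets as many of the first n conditions as can be met together at index
    n. Condition j is then met as soon as n > j and the first j + 1 conditions are compatible at n,
    which holds on a set of the ultrafilter. *)
Lemma internal_saturated (a : nat -> nat -> set T) : (forall k, internal (a k) !=set0) ->
  (forall k, internal (a k.+1) `<=` internal (a k)) ->
  \bigcap_k internal (a k) !=set0.
Proof.
move=> a0 adec.
have dec i j : (i <= j)%N -> internal (a j) `<=` internal (a i).
  elim: j => [|j IH]; first by rewrite leqn0 => /eqP ->.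
  by rewrite leq_eqVlt => /predU1P[->//|/IH]; exact: subset_trans.
pose P n k := `[< exists x, forall j, (j < k)%N -> a j n x >].
have P0 n : exists k, P n k && (k <= n)%N.
  by exists 0%N; rewrite andbT; apply/asboolP; exists point.
have Pb n k : P n k && (k <= n)%N -> (k <= n)%N by case/andP.
have wex n : exists x, forall j, (j < ex_maxn (P0 n) (Pb n))%N -> a j n x.
  by case: ex_maxnP => k /andP[/asboolP].
pose w n := projT1 (cid (wex n)).
exists w => j _.
have [v vj] := a0 j.
have Pj : \forall n \near U, forall i, (i < j.+1)%N -> a i n (v n).
  have : forall i, (i <= j)%N -> U [set n | a i n (v n)].
    by move=> i ij; exact: (dec _ _ ij _ vj).
  elim: (j) => [|k IH] h.
    by apply: filterS (h 0%N _) => // n ? [].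
  have hk : \forall n \near U, forall i, (i < k.+1)%N -> a i n (v n).
    by apply: IH => i ik; apply: h; rewrite (leq_trans ik).
  apply: filterS2 hk (h k.+1 (leqnn _)) => n h1 h2 i.
  by rewrite ltnS leq_eqVlt => /predU1P[->|/h1].
have Uj : U [set n | (j < n)%N] by apply: free_ultra_eventually; exists j.+1.
rewrite /internal/=; apply: filterS2 Pj Uj => n /= h1 h2.
rewrite /w; case: cid => x /=; apply.
case: ex_maxnP => k _ /(_ j.+1); apply.
by rewrite h2 andbT; apply/asboolP; exists (v n).
Qed.

(* By saturation, a countable disjoint union is internal only if it is finite:
   a finitely additive content on internal sets is thus countably additive. *)
Lemma trivIset_internals_finite (F : nat -> set H) :
  (forall k, internals (F k)) -> trivIset setT F -> internals (\bigcup_k F k) ->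
  exists N, forall k, (N <= k)%N -> F k = set0.
Proof.
move=> mF tF mUF.
(* The remainders of the union decrease and have empty intersection. If infinitely many [F k] were
   nonempty, each remainder would be a nonempty internal set, against saturation. *)
pose G k := \bigcup_k F k `\` \big[setU/set0]_(j < k) F j.
have mG k : internals (G k).
  apply: (@measurableD _ H) => //; apply: (@bigsetU_measurable _ H) => i _; exact: mF.
have /choice[a aP] : forall k, exists a, (forall n, measurable (a n)) /\ G k = internal a.
  by move=> k; have [a ma Ga] := mG k; exists a.
apply: contrapT => /forallNP h.
have G0 k : G k !=set0.
  have /existsNP[j /not_implyP[kj /eqP/set0P[w Fw]]] := h k.
  exists w; split; first by exists j.
  rewrite -bigcup_mkord => -[i /= ik Fiw].
  have ji : j = i by apply: tF => //; exists w.
  by move: kj; rewrite ji leqNgt ik.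
have := @internal_saturated a.
case.
- by move=> k; rewrite -(aP k).2.
- move=> k; rewrite -!(aP _).2 /G => w [? nF]; split => //.
  by apply: contra_not nF => Fw; rewrite big_ord_recr/=; left.
move=> w wG; have [[k _ Fk] _] : G 0%N w by rewrite (aP 0%N).2; exact: wG.
have [_] : G k.+1 w by rewrite (aP k.+1).2; exact: wG.
by apply; rewrite big_ord_recr/=; right.
Qed.

End internal.

Section loeb.
Context d (T : measurableType d) (R : realType) (P : nat -> probability T R).
Local Notation H := (hyper T).

(** The representing sequence is picked by choice, harmlessly by [internal_inj]; 0 is a placeholder
    off the internal sets. *)
Definition loeb_content (A : set H) : \bar R :=
  if pselect (internals A) is left h
  then (lim (fine (P n (s2val (cid2 h) n)) @[n --> U]))%:E else 0%E.

Lemma cvg_loeb (a : nat -> set T) : (forall n, measurable (a n)) ->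
  cvg (fine (P n (a n)) @[n --> U]).
Proof.
move=> ma; apply: (@ultra_cvg _ _ _ _ 1); apply: filterE => n.
rewrite ger0_norm ?fine_ge0// -lee_fin fineK ?fin_num_measure//.
exact: probability_le1.
Qed.

Lemma loeb_contentE (a : nat -> set T) : (forall n, measurable (a n)) ->
  loeb_content (internal a) = (lim (fine (P n (a n)) @[n --> U]))%:E.
Proof.
move=> ma; rewrite /loeb_content; case: pselect => [h|[]]; last by exists a.
case: cid2 => b mb /= /internal_inj ab; congr EFin; congr lim.
by apply/seteqP; split => A /=; apply: filterS2 ab => n /= ->.
Qed.

Let loeb_ge0 A : (0 <= loeb_content A)%E.
Proof.
rewrite /loeb_content; case: pselect => // h; case: cid2 => a ma /= _.
by rewrite lee_fin; apply: limr_ge; [exact: cvg_loeb|apply: filterE => n; exact: fine_ge0].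
Qed.

Let loeb_additive2 : semi_additive2 loeb_content.
Proof.
move=> A B [a ma ->] [b mb ->] _ AB0.
have mab n : measurable (a n `|` b n) by exact: measurableU.
rewrite internalU !loeb_contentE// -EFinD; congr EFin.
rewrite -limD; [|exact: cvg_loeb|exact: cvg_loeb].
have : \forall n \near U, a n `&` b n = set0.
  by apply: (@internal_inj _ _ _ (fun=> set0)); rewrite -internalI AB0 internal0.
move=> ab; congr lim; apply/seteqP; split => A0 /=; apply: filterS2 ab => n /= ab.
  by rewrite measureU// fineD// fin_num_measure.
by rewrite measureU// fineD// fin_num_measure.
Qed.

Let loeb0 : loeb_content set0 = 0%E.
Proof.
rewrite -internal0 loeb_contentE//; congr EFin.
under eq_fun do rewrite measure0.
exact: lim_cst.
Qed.

Let loeb_semi_additive : measure_function.semi_additive loeb_content.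
Proof. by apply/(additive2P loeb0); rewrite -semi_additive2E. Qed.

Let loeb_semi_sigma_additive : semi_sigma_additive loeb_content.
Proof.
move=> F mF tF mUF.
have [N N0] := trivIset_internals_finite mF tF mUF.
apply: cvg_near_cst; exists N => // n /= Nn.
have FE : \bigcup_k F k = \big[setU/set0]_(k < n) F k.
  rewrite -bigcup_mkord; apply/seteqP; split => [w [k _ Fk]|w [k /= _ Fk]]; last by exists k.
  exists k => //=; rewrite ltnNge; apply/negP => nk.
  by move: Fk; rewrite N0// (leq_trans Nn).
by rewrite FE loeb_semi_additive// -?FE// big_mkord.
Qed.

HB.instance Definition _ := isMeasure.Build _ _ _ loeb_content
  loeb0 loeb_ge0 loeb_semi_sigma_additive.

Definition loeb : set (g_sigma_algebraType (@measurable _ H)) -> \bar R :=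
  measure_extension loeb_content.

HB.instance Definition _ := Measure.on loeb.

Lemma loeb_internal (a : nat -> set T) : (forall n, measurable (a n)) ->
  loeb (internal a) = (lim (fine (P n (a n)) @[n --> U]))%:E.
Proof.
move=> ma; rewrite -loeb_contentE// /loeb /measure_extension.
by rewrite measurable_mu_extE//; exists a.
Qed.

Let loeb_setT : loeb setT = 1%E.
Proof.
rewrite -setC0 -(@internal0 _ T) internalC loeb_internal; last first.
  by move=> n; exact: measurableC.
congr EFin; under eq_fun do rewrite setC0 probability_setT.
exact: lim_cst.
Qed.

HB.instance Definition _ := Measure_isProbability.Build _ _ _ loeb loeb_setT.

End loeb.

(** The sum is the floor of y, written as a count. With y = K g, it places g within 1 / K of a
    combination of indicators of level sets. *)
Lemma sum_nat_le_bounds (R : realType) (K : nat) (y : R) :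
  0 <= y -> y <= K%:R ->
  \sum_(j < K) (j.+1%:R <= y)%R%:R <= y <= \sum_(j < K) (j.+1%:R <= y)%R%:R + 1.
Proof.
elim: K y => [|K IH] y y0 yK.
  by rewrite big_ord0 add0r y0 (le_trans yK).
rewrite big_ord_recr/=; have [yK'|Ky] := leP y K%:R.
  rewrite (_ : (K.+1%:R <= y) = false) ?addr0 ?IH//.
  by apply/negbTE; rewrite -ltNge (le_lt_trans yK')// ltr_nat.
rewrite (eq_bigr (fun=> 1)); last first.
  by move=> j _; rewrite (le_trans _ (ltW Ky))// ler_nat.
rewrite sumr_const card_ord; have [Ky'|yK'] := leP K.+1%:R y.
  by rewrite -natr1 in yK Ky' *; rewrite Ky' (le_trans yK)// lerDl.
by rewrite addr0 (ltW Ky)/= natr1.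
Qed.

Section probability_integral.
Context d (T : measurableType d) (R : realType) (Q : probability T R).

Lemma prob_integral_cst (c : \bar R) : (\int[Q]_x (cst c x) = c)%E.
Proof. by rewrite integral_cst//= probability_setT mule1. Qed.

Lemma prob_integral_bound (f : T -> R) (C : R) : measurable_fun setT f ->
  (forall x, 0 <= f x <= C) -> (0 <= \int[Q]_x (f x)%:E <= C%:E)%E.
Proof.
move=> mf f01; apply/andP; split.
  by apply: integral_ge0 => x _; rewrite lee_fin; case/andP: (f01 x).
rewrite -[leRHS]prob_integral_cst.
apply: ge0_le_integral => //.
- by move=> x _; rewrite lee_fin; case/andP: (f01 x).
- exact/measurable_EFinP.
- by move=> x _; rewrite lee_fin; case/andP: (f01 x).
Qed.

Lemma prob_integral_fin_num (f : T -> R) (C : R) : measurable_fun setT f ->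
  (forall x, 0 <= f x <= C) -> (\int[Q]_x (f x)%:E)%E \is a fin_num.
Proof.
move=> mf /(prob_integral_bound mf)/andP[f0 fC].
by rewrite ge0_fin_numE// (le_lt_trans fC)// ltry.
Qed.

(** Stated for an arbitrary probability so that the same step coefficients serve for each [P n] and
    for the Loeb measure. *)
Lemma prob_integral_step (f : T -> R) (K : nat) (B : 'I_K -> set T) (C k : R) :
  measurable_fun setT f -> (forall x, 0 <= f x <= C) -> 0 <= k ->
  (forall j, measurable (B j)) ->
  (forall x, \sum_(j < K) k * \1_(B j) x <= f x <= \sum_(j < K) k * \1_(B j) x + k) ->
  \sum_(j < K) k * fine (Q (B j)) <= fine (\int[Q]_x (f x)%:E)%E <=
  \sum_(j < K) k * fine (Q (B j)) + k.
Proof.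
move=> mf f0C k0 mB H.
have SE : (\int[Q]_x (\sum_(j < K) k * \1_(B j) x)%:E =
    (\sum_(j < K) k * fine (Q (B j)))%:E)%E.
  under eq_integral do rewrite -sumEFin.
  rewrite ge0_integral_sum//; last 2 first.
  - move=> j; apply/measurable_EFinP; apply: measurable_funM => //.
  - by move=> j x _; rewrite lee_fin mulr_ge0.
  rewrite -sumEFin; apply: eq_bigr => j _.
  under eq_integral do rewrite EFinM.
  rewrite ge0_integralZl_EFin//; last exact/measurable_EFinP.
  by rewrite integral_indic// setIT EFinM fineK// fin_num_measure.
have mS : measurable_fun setT (fun x => \sum_(j < K) k * \1_(B j) x).
  by apply: measurable_sum => j; exact: measurable_funM.
have S0 x : 0 <= \sum_(j < K) k * \1_(B j) x by apply: sumr_ge0 => j _; rewrite mulr_ge0.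
rewrite -!lee_fin EFinD fineK ?(prob_integral_fin_num mf f0C)// -SE.
apply/andP; split.
  apply: ge0_le_integral => //; try exact/measurable_EFinP.
    by move=> x _; rewrite lee_fin.
  by move=> x _; rewrite lee_fin; case/andP: (H x).
rewrite -[X in (_ <= _ + X)%E]prob_integral_cst.
rewrite -ge0_integralD//; last 2 first.
- by move=> x _; rewrite lee_fin.
- exact/measurable_EFinP.
apply: ge0_le_integral => //.
- by move=> x _; rewrite lee_fin; case/andP: (f0C x).
- exact/measurable_EFinP.
- by apply/measurable_EFinP; exact: measurable_funD.
- by move=> x _; rewrite lee_fin; case/andP: (H x).
Qed.

End probability_integral.

(** * Standard parts of bounded functions and their Loeb integrals *)

Section standard_part.
Context d (T : measurableType d) (R : realType) (P : nat -> probability T R).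
Local Notation H := (hyper T).
Local Notation HM := (g_sigma_algebraType (@measurable _ H)).
Variable g : T -> R.
Hypothesis mg : measurable_fun setT g.
Hypothesis g01 : forall x, 0 <= g x <= 1.

Definition ultra_value (w : HM) : R := lim (g (w n) @[n --> U]).

Lemma cvg_ultra_value w : g (w n) @[n --> U] --> ultra_value w.
Proof.
apply: (@ultra_cvg _ _ _ _ 1); apply: filterE => n.
by rewrite ger0_norm; case/andP: (g01 (w n)).
Qed.

Lemma ultra_value01 w : 0 <= ultra_value w <= 1.
Proof.
apply/andP; split.
  by apply: limr_ge; [exact: cvg_ultra_value|apply: filterE => n; case/andP: (g01 (w n))].
by apply: limr_le; [exact: cvg_ultra_value|apply: filterE => n; case/andP: (g01 (w n))].
Qed.

Let A (K : nat) (j : 'I_K) : set T := [set x | j.+1%:R <= K%:R * g x].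

Let mA K j : measurable (@A K j).
Proof.
rewrite (_ : A _ = (fun x => j.+1%:R <= K%:R * g x) @^-1` [set true]) //.
rewrite -[X in measurable X]setTI; apply: measurable_fun_ler => //.
exact: measurable_funM.
Qed.

Let mIA K j : measurable (internal (fun=> @A K j) : set HM).
Proof. by apply: sub_sigma_algebra; exists (fun=> @A K j). Qed.

Let A_step K x : (0 < K)%N ->
  \sum_(j < K) K%:R^-1 * \1_(A j) x <= g x <= \sum_(j < K) K%:R^-1 * \1_(A j) x + K%:R^-1.
Proof.
move=> K0; have K0' : 0 < K%:R :> R by rewrite ltr0n.
have /andP[g0 g1] := g01 x.
have := @sum_nat_le_bounds R K (K%:R * g x).
rewrite mulr_ge0// ler_piMr// => /(_ isT isT) h.
rewrite -mulr_sumr -{3}(mulr1 K%:R^-1) -mulrDr ler_pdivrMl// ler_pdivlMl//.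
rewrite (eq_bigr (fun j : 'I_K => ((j.+1%:R <= K%:R * g x)%R)%:R)) // => j _.
rewrite indicE; have [h'|h'] := boolP (j.+1%:R <= K%:R * g x); first by rewrite mem_set.
by rewrite memNset//; exact/negP.
Qed.

(** The ultrafilter contains either the indices with [w n] in the level set or their complement, so
    the indicators are constant on a set of the ultrafilter. *)
Let indic_cvg K (j : 'I_K) w :
  (\1_(A j) (w n) : R) @[n --> U] --> (\1_(internal (fun=> A j)) w : R).
Proof.
have [iw|niw] := pselect (internal (fun=> A j) w).
  rewrite indicE mem_set//; apply: cvg_near_cst.
  by apply: filterS iw => n /= An; rewrite indicE mem_set.
rewrite indicE memNset//; apply: cvg_near_cst.
by apply: filterS (ultra_dicho UU niw) => n /= An; rewrite indicE memNset.
Qed.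

Let ultra_step K w : (0 < K)%N ->
  \sum_(j < K) K%:R^-1 * \1_(internal (fun=> A j)) w <= ultra_value w
   <= \sum_(j < K) K%:R^-1 * \1_(internal (fun=> A j)) w + K%:R^-1.
Proof.
move=> K0.
have h : \sum_(j < K) K%:R^-1 * (\1_(A j) (w n) : R) @[n --> U] -->
    (\sum_(j < K) K%:R^-1 * \1_(internal (fun=> A j)) w : R).
  apply: (@cvg_big _ _ +%R 0 _ _ _ _ _ (fun j n => K%:R^-1 * (\1_(A j) (w n) : R))).
    exact: add_continuous.
  by move=> j _; apply: cvgM; [exact: cvg_cst|exact: indic_cvg].
apply/andP; split.
  apply: (ler_cvg_to h (@cvg_ultra_value w)); apply: filterE => n.
  by case/andP: (A_step (w n) K0).
apply: (ler_cvg_to (@cvg_ultra_value w)).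
  by apply: cvgD; [exact: h|exact: cvg_cst].
apply: filterE => n.
by case/andP: (A_step (w n) K0).
Qed.

(** A limit along an ultrafilter of measurable functions may fail to be measurable. Here it is a
    uniform limit of step functions on internal sets, with error at most 1 / K. *)
Lemma measurable_ultra_value : measurable_fun setT ultra_value.
Proof.
apply: (@measurable_fun_cvg _ HM R setT
  (fun K (w : HM) => \sum_(j < K.+1) K.+1%:R^-1 * \1_(internal (fun=> A j) : set HM) w)).
  by move=> K; apply: measurable_sum => j; apply: measurable_funM.
move=> w _; apply/cvgrPdist_le => e e0.
near=> K.
have /andP[h1 h2] := @ultra_step K.+1 w isT.
rewrite ger0_norm ?subr_ge0// lerBlDl (le_trans h2)// lerD2l.
by apply/ltW; near: K; exact: near_infty_natSinv_lt (PosNum e0).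
Unshelve. all: by end_near. Qed.

(** For each K, the limit of the integrals and the Loeb integral both lie between the same step sum
    and that sum plus 1 / K, because the Loeb measure of an internal level set is the limit of its
    probabilities. *)
Lemma integral_ultra_value :
  fine (\int[P n]_x (g x)%:E)%E @[n --> U] -->
  fine (\int[loeb P]_w (ultra_value w)%:E)%E.
Proof.
have cI : cvg (fine (\int[P n]_x (g x)%:E)%E @[n --> U]).
  apply: (@ultra_cvg _ _ _ _ 1); apply: filterE => n.
  have := prob_integral_bound (P n) mg g01.
  rewrite -[X in (0 <= X <= _)%E]fineK ?(prob_integral_fin_num _ mg g01)//.
  by rewrite !lee_fin => /andP[? ?]; rewrite ger0_norm.
rewrite (_ : fine _ = lim (fine (\int[P n]_x (g x)%:E)%E @[n --> U]))//.
apply/eqP; rewrite -subr_eq0 -normr_le0; apply/ler_addgt0Pl => e e0.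
rewrite addr0; near \oo%classic => K.
apply: (@le_trans _ _ K.+1%:R^-1); last first.
  by apply/ltW; near: K; exact: near_infty_natSinv_lt (PosNum e0).
have k0 : 0 <= K.+1%:R^-1 :> R by [].
have /andP[h1 h2] := prob_integral_step (loeb P) measurable_ultra_value
  ultra_value01 k0 (@mIA K.+1)
  (fun w => @ultra_step K.+1 w isT).
have hA : \sum_(j < K.+1) K.+1%:R^-1 * fine (P n (A j)) @[n --> U] -->
    (\sum_(j < K.+1) K.+1%:R^-1 * fine (loeb P (internal (fun=> A j))) : R).
  apply: (@cvg_big _ _ +%R 0 _ _ _ _ _ (fun j n => K.+1%:R^-1 * fine (P n (A j)))).
    exact: add_continuous.
  move=> j _; apply: cvgM; first exact: cvg_cst.
  rewrite loeb_internal//; exact: cvg_loeb.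
have hn n := prob_integral_step (P n) mg g01 k0
  (@mA K.+1) (fun w => @A_step K.+1 w isT).
have h3 : \sum_(j < K.+1) K.+1%:R^-1 * fine (loeb P (internal (fun=> A j))) <=
   lim (fine (\int[P n]_x (g x)%:E)%E @[n --> U]).
  by apply: (ler_cvg_to hA cI); apply: filterE => n; case/andP: (hn n).
have h4 : lim (fine (\int[P n]_x (g x)%:E)%E @[n --> U]) <=
  \sum_(j < K.+1) K.+1%:R^-1 * fine (loeb P (internal (fun=> A j))) + K.+1%:R^-1.
  apply: (ler_cvg_to cI).
    by apply: cvgD; [exact: hA|exact: cvg_cst].
  by apply: filterE => n; case/andP: (hn n).
rewrite ler_distl; apply/andP; split.
  by rewrite lerBlDr (le_trans h4)// lerD2r.
by rewrite (le_trans h2)// lerD2r.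
Unshelve. all: by end_near. Qed.

End standard_part.

(** * Prohorov's theorem *)

Lemma cvg_mx (S : Type) (F : set_system S) (T : topologicalType) m n
    (f : S -> 'M[T]_(m, n)) (M : 'M[T]_(m, n)) : Filter F ->
  (forall i j, f x i j @[x --> F] --> M i j) -> f @ F --> M.
Proof.
move=> FF fM A [P MP PA].
have : \forall x \near F, forall ij : 'I_m * 'I_n, P ij.1 ij.2 (f x ij.1 ij.2).
  by apply: filter_forall => -[i j]; apply: fM; exact: MP.
by apply: filterS => x Px; apply: PA => i j; exact: (Px (i, j)).
Qed.

Lemma continuous_mx (S : topologicalType) (T : topologicalType) m n
    (f : S -> 'M[T]_(m, n)) :
  (forall i j, continuous (fun x => f x i j)) -> continuous f.
Proof. by move=> cf x; apply: cvg_mx => i j; exact: cf. Qed.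

Section matrix_borel.
Context (R : realType) (m n : nat).
Local Notation M := 'M[R]_(m, n).

Let box (b : {ffun 'I_m * 'I_n -> rat * rat}) : set M :=
  [set x | forall i j, x i j \in `](ratr (b (i, j)).1 : R), (ratr (b (i, j)).2 : R)[].

Let measurable_box b : measurable (box b).
Proof.
rewrite (_ : box b = \bigcap_(ij in [set: 'I_m * 'I_n])
   ((fun x : M => x ij.1 ij.2) @^-1` [set` `](ratr (b ij).1 : R), (ratr (b ij).2 : R)[])).
  apply: fin_bigcap_measurable => // -[i j] _ /=.
  rewrite -[X in measurable X]setTI; apply: measurable_mxcoord => //.
by apply/seteqP; split => [x bx [i j] _|x bx i j]; [exact: bx|exact: (bx (i, j) I)].
Qed.

(** The boxes with rational endpoints contained in an open set cover it, and there are countably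
    many of them. *)
Lemma open_measurable_mx (O : set M) : open O -> measurable O.
Proof.
move=> oO.
have -> : O = \bigcup_(b in [set b | box b `<=` O]) box b.
  apply/seteqP; split => [x Ox|x [b /= bO]]; last exact: bO.
  have [P xP PO] : nbhs x O by exact: open_nbhs_nbhs.
  have qr (ij : 'I_m * 'I_n) : exists b : rat * rat,
      (ratr b.1 < x ij.1 ij.2 < ratr b.2) /\
      (forall y, ratr b.1 < y < ratr b.2 -> P ij.1 ij.2 y).
    have /nbhs_ballP[e /= e0 eP] := xP ij.1 ij.2.
    have xe : x ij.1 ij.2 - e < x ij.1 ij.2 by rewrite ltrBlDr ltrDl.
    have ex : x ij.1 ij.2 < x ij.1 ij.2 + e by rewrite ltrDl.
    have [q] := rat_in_itvoo xe; have [r] := rat_in_itvoo ex.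
    rewrite !in_itv/= => /andP[r1 r2] /andP[q1 q2]; exists (q, r) => /=; split.
      by rewrite q2 r1.
    move=> y /andP[y1 y2]; apply: eP.
    by rewrite /ball/= ltr_distl; apply/andP; split; lra.
  have [b bP] := choice qr.
  exists [ffun ij => b ij] => [/=|i j]; last by rewrite ffunE in_itv; exact: (bP (i, j)).1.
  move=> y by_; apply: PO => i j; apply: (bP (i, j)).2.
  by have := by_ i j; rewrite ffunE in_itv.
rewrite bigcup_mkcond; apply: countable_bigcupT_measurable => // b.
by case: ifPn.
Qed.

Lemma continuous_measurable_mx (f : M -> R) : continuous f -> measurable_fun setT f.
Proof.
move=> cf; apply: (measurability _ (RGenOpens.measurableE R)).
move=> _ [_ [a [b ->] <-]]; rewrite setTI; apply: open_measurable_mx.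
by apply: open_comp => // x _; exact: cf.
Qed.

End matrix_borel.

Lemma lipschitz_mx_continuous (R : realType) m n (f : 'M[R]_(m, n) -> R) (K : R) :
  (forall x y, `|f x - f y| <= K * `|x - y|) -> continuous f.
Proof.
have nb (z : 'M[R]_(m, n)) (r : R) : 0 < r -> nbhs z [set y | `|z - y| < r].
  by move=> r0; apply/(@nbhs_normP _ 'M[R]_(m, n)); exists r.
move=> lf x; have xF : Filter (nbhs x) by exact: nbhs_filter.
apply/cvgrPdist_le => e e0.
have h := nb x ((`|K| + 1)^-1 * e) _.
apply: filterS (h _) => [y /= /ltW xy|]; last by rewrite mulr_gt0// invr_gt0 ltr_wpDl.
rewrite (le_trans (lf x y))// (@le_trans _ _ ((`|K| + 1) * `|x - y|))//.
  by rewrite ler_wpM2r// (le_trans (ler_norm _))// lerDl.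
by rewrite -ler_pdivlMl ?ltr_wpDl.
Qed.

(** * Lipschitz functions determine a probability law *)

Section lipschitz_determining.
Context (R : realType) (m n : nat).
Local Notation M := 'M[R]_(m, n).

Definition lipschitz_fun (f : M -> R) := exists K : R, forall x y, `|f x - f y| <= K * `|x - y|.

Let ramp (k : nat) (g : M -> R) x := Num.min 1 (Num.max 0 (k%:R * g x)).

Let coz : set (set M) := [set A | exists2 g, lipschitz_fun g & A = [set x | 0 < g x]].

Lemma lipschitz_measurable f : lipschitz_fun f -> measurable_fun setT f.
Proof. by case=> K /lipschitz_mx_continuous; exact: continuous_measurable_mx. Qed.

Lemma lipschitz_min f g : lipschitz_fun f -> lipschitz_fun g ->
  lipschitz_fun (fun x => Num.min (f x) (g x)).
Proof.
move=> [K Kf] [L Lg]; exists (`|K| + `|L|) => x y.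
have h1 : `|f x - f y| <= (`|K| + `|L|) * `|x - y|.
  by rewrite (le_trans (Kf x y))// ler_wpM2r// (le_trans (ler_norm _))// lerDl.
have h2 : `|g x - g y| <= (`|K| + `|L|) * `|x - y|.
  by rewrite (le_trans (Lg x y))// ler_wpM2r// (le_trans (ler_norm _))// lerDr.
move: h1 h2; rewrite !ler_distl => /andP[h1 h2] /andP[h3 h4].
rewrite /Num.min; do 2 case: ltP => ?; apply/andP; split; lra.
Qed.

Let clip_le (a b : R) : a <= b ->
  Num.min 1 (Num.max 0 a) <= Num.min 1 (Num.max 0 b) <= Num.min 1 (Num.max 0 a) + (b - a).
Proof.
move=> ab; rewrite /Num.min /Num.max; case: (ltP 0 a) => ?; case: (ltP 0 b) => ?;
  do ?case: ltP => ?; apply/andP; split; lra.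
Qed.

Lemma lipschitz_clip (c d : R) g : lipschitz_fun g ->
  lipschitz_fun (fun x => Num.min 1 (Num.max 0 (c * g x + d))).
Proof.
move=> [K Kg]; exists (`|c| * K) => x y.
apply: (@le_trans _ _ `|c * g x - c * g y|); last first.
  by rewrite -mulrBr normrM -mulrA ler_wpM2l.
have [h|/ltW h] := lerP (c * g x) (c * g y).
  have /clip_le/andP[h1 h2] : c * g x + d <= c * g y + d by rewrite lerD2r.
  by rewrite ler_distl; apply/andP; split; lra.
have /clip_le/andP[h1 h2] : c * g y + d <= c * g x + d by rewrite lerD2r.
by rewrite ler_distl; apply/andP; split; lra.
Qed.

Lemma lipschitz_coord i j : lipschitz_fun (fun x : M => x i j).
Proof.
exists 1 => x y; rewrite mul1r.
have -> : x i j - y i j = (x - y) i j by rewrite !mxE.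
rewrite [leRHS]mx_normrE; exact: (le_bigmax _ (fun ij => `|(x - y) ij.1 ij.2|) (i, j)).
Qed.

Let measurable_coz g : lipschitz_fun g -> measurable [set x | 0 < g x].
Proof.
move=> /lipschitz_measurable mg; rewrite -[X in measurable X]setTI.
by apply: (mg measurableT [set r | 0 < r]); apply: open_measurable; exact: open_gt.
Qed.

(** The ramps min(1, max(0, k g)) increase to the indicator of the set where g is positive, so
    monotone convergence applies. *)
Let coz_ramp (P : probability M R) g : lipschitz_fun g ->
  (\int[P]_x (ramp k g x)%:E)%E @[k --> \oo] --> P [set x | 0 < g x].
Proof.
move=> lg.
have mr k : measurable_fun setT (ramp k g).
  apply: lipschitz_measurable; have := @lipschitz_clip k%:R 0 g lg.
  by rewrite /ramp; under eq_fun do rewrite addr0.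
have -> : P [set x | 0 < g x] = (\int[P]_x limn (fun k => (ramp k g x)%:E))%E.
  have mA := measurable_coz lg.
  rewrite -[X in P X]setIT -integral_indic//; apply: eq_integral => x _; apply/esym/cvg_lim => //.
  have [g0|g0] := ltP 0 (g x).
    rewrite indicE mem_set//; apply: cvg_near_cst.
    near=> k; congr EFin; rewrite /ramp max_r ?mulr_ge0 ?(ltW g0)// min_l//.
    by rewrite -ler_pdivrMr// mul1r; near: k; exact: nbhs_infty_ger.
  rewrite indicE memNset//=; last by apply/negP; rewrite -leNgt.
  apply: cvg_near_cst; near=> k.
  by rewrite /ramp max_l ?min_r// mulr_ge0_le0.
apply: cvg_monotone_convergence => //.
- by move=> k; exact/measurable_EFinP.
- by move=> k x _; rewrite lee_fin /ramp le_min ler01 le_max lexx.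
- move=> x _ k l kl; rewrite lee_fin /ramp.
  have [g0|g0] := lerP (g x) 0.
    by rewrite !max_l// mulr_ge0_le0.
  by rewrite le_min ge_min lexx/= !max_r ?mulr_ge0 ?(ltW g0)// ge_min ler_wpM2r ?orbT ?ler_nat// ltW.
Unshelve. all: by end_near. Qed.

(** The sets where a Lipschitz function is positive form a pi-system, minima giving intersections.
    The two laws agree on it by [coz_ramp]. *)
Lemma lipschitz_measure_eq (P Q : probability M R) :
  (forall f : M -> R, lipschitz_fun f -> (forall x, 0 <= f x <= 1) ->
     (\int[P]_x (f x)%:E = \int[Q]_x (f x)%:E)%E) ->
  forall A, measurable A -> P A = Q A.
Proof.
move=> PQ A mA.
apply: (g_sigma_algebra_measure_unique coz _ (fun=> setT)) => //.
- by move=> _ [g lg ->]; exact: measurable_coz.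
- move=> _; exists (fun=> 1); last by apply/seteqP; split => x //= _; exact: ltr01.
  by exists 0 => x y; rewrite subrr normr0 mul0r.
- by rewrite bigcup_const.
- move=> _ _ [g lg ->] [h lh ->]; exists (fun x => Num.min (g x) (h x)); first exact: lipschitz_min.
  by apply/seteqP; split => x /=; rewrite lt_min => /andP.
- move=> _ [g lg ->].
  have E k : (\int[P]_x (ramp k g x)%:E = \int[Q]_x (ramp k g x)%:E)%E.
    apply: PQ => [|x]; last by rewrite /ramp le_min ler01 le_max lexx/= ge_min lexx.
    by have := @lipschitz_clip k%:R 0 g lg; rewrite /ramp; under eq_fun do rewrite addr0.
  have := @coz_ramp P g lg; under eq_fun do rewrite E.
  by move=> h1; exact: (cvg_unique _ h1 (@coz_ramp Q g lg)).
- by move=> _; apply: (@le_lt_trans _ _ 1%E); [exact: probability_le1|exact: ltry].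
(* The pi-system generates the product sigma-algebra: a coordinate minus a constant is Lipschitz, so
   the half-spaces on which a coordinate exceeds a belong to it. *)
move: A mA; apply: smallest_sub; first exact: smallest_sigma_algebra.
move=> _ [i [j [B [mB ->]]]].
have : measurable_fun setT (fun x : g_sigma_algebraType coz => (x : M) i j).
  apply: (measurability _ (RGenOInfty.measurableE R)).
  move=> _ [_ [a ->] <-]; rewrite setTI; apply: sub_sigma_algebra.
  exists (fun x => x i j - a).
    have [K Kl] := lipschitz_coord i j; exists K => x y.
    by rewrite (_ : _ - a - _ = x i j - y i j) ?Kl//; ring.
  by apply/seteqP; split => x /=; rewrite in_itv/= andbT subr_gt0.
by move=> /(_ measurableT _ mB); rewrite setTI.
Qed.

End lipschitz_determining.

Section logistic.
Context (R : realType).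
Implicit Types x y : R.

Definition logistic x : R := (1 + expR (- x))^-1.
Definition logit y : R := ln y - ln (1 - y).

Lemma logistic_gt0 x : 0 < logistic x.
Proof. by rewrite invr_gt0 addr_gt0// expR_gt0. Qed.

Lemma onem_logistic x : 1 - logistic x = expR (- x) * logistic x.
Proof.
rewrite /logistic -[X in X - _](@divff _ (1 + expR (- x))) ?gt_eqF ?addr_gt0 ?expR_gt0//.
by rewrite -{2}(mul1r (_^-1)) -mulrBl addrAC subrr add0r.
Qed.

Lemma logistic_lt1 x : logistic x < 1.
Proof. by rewrite -subr_gt0 onem_logistic mulr_gt0 ?expR_gt0 ?logistic_gt0. Qed.

Lemma logisticK : cancel logistic logit.
Proof.
move=> x; rewrite /logit onem_logistic lnM ?posrE ?expR_gt0 ?logistic_gt0// expRK.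
by rewrite opprD opprK addrCA subrr addr0.
Qed.

Lemma logistic_le x y : x <= y -> logistic x <= logistic y.
Proof.
move=> xy; rewrite lef_pV2 ?posrE ?addr_gt0 ?expR_gt0//.
by rewrite lerD2l ler_expR lerN2.
Qed.

Lemma continuous_logistic : continuous logistic.
Proof.
move=> x; apply: cvgV; first by rewrite gt_eqF// addr_gt0 ?expR_gt0.
apply: cvgD; first exact: cvg_cst.
apply: (@continuous_comp _ _ _ (-%R) expR); last exact: continuous_expR.
exact: continuousN.
Qed.

Lemma continuous_logit y : 0 < y < 1 -> {for y, continuous logit}.
Proof.
move=> /andP[y0 y1]; apply: cvgB; first exact: continuous_ln.
apply: (@continuous_comp _ _ _ (fun y => 1 - y) (@ln R)); last first.
  by apply: continuous_ln; rewrite subr_gt0.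
by apply: cvgB; [exact: cvg_cst|exact: cvg_id].
Qed.

Lemma measurable_logit : measurable_fun setT logit.
Proof.
apply: measurable_funB; first exact: measurable_ln.
by apply: measurableT_comp; [exact: measurable_ln|exact: measurable_funB].
Qed.

End logistic.

Section prohorov.
Context (R : realType) (m : nat) (P : nat -> probability 'cV[R]_m R).
Hypothesis tightP : forall i (e : R), 0 < e -> exists C : R,
  \forall n \near \oo, (P n [set x | (C < `|x i ord0|)%R] <= e%:E)%E.

Local Notation H := (g_sigma_algebraType (@measurable _ (hyper 'cV[R]_m))).

(* The logistic map compresses R into ]0, 1[: a coordinate has no finite standard
   part exactly when this ultralimit is 0 or 1, which tightness makes negligible. *)
Let y i : H -> R := ultra_value (fun x : 'cV[R]_m => logistic (x i ord0)).

Let mlog i : measurable_fun setT (fun x : 'cV[R]_m => logistic (x i ord0)).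
Proof.
apply: measurableT_comp; last exact: measurable_mxcoord.
by apply: continuous_measurable_fun; exact: continuous_logistic.
Qed.

Let log01 i (x : 'cV[R]_m) : 0 <= logistic (x i ord0) <= 1.
Proof. by rewrite !ltW ?logistic_gt0 ?logistic_lt1. Qed.

(** The standard part, coordinate by coordinate. If a coordinate is infinite, [logit] is evaluated
    at 0 or 1 and the value is arbitrary; this occurs on a null set only. *)
Let st (w : H) : 'cV[R]_m := \col_i logit (y i w).

Let mst : measurable_fun setT st.
Proof.
apply: measurable_mxP => i j; rewrite /st.
under eq_fun do rewrite mxE.
apply: measurableT_comp; first exact: measurable_logit.
exact: measurable_ultra_value.
Qed.

HB.instance Definition _ := isMeasurableFun.Build _ _ _ _ st mst.

Let bad i := [set w : H | ~ (0 < y i w < 1)].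

(** If [w n] has its coordinate in [-C, C] for a set of indices in the ultrafilter, the limit stays
    between logistic(-C) and logistic(C), away from 0 and 1. So a bad point lies in the internal
    tail set, of Loeb measure at most e by tightness. *)
Let bad_negligible i : (loeb P).-negligible (bad i).
Proof.
have mb : measurable (bad i).
  have my : measurable_fun setT (y i) by exact: measurable_ultra_value.
  rewrite (_ : bad i = ~` (y i @^-1` `]0, 1[%classic)).
    by apply: measurableC; rewrite -[X in measurable X]setTI; exact: my.
  by apply/seteqP; split => w /=; rewrite in_itv/=.
exists (bad i); split => //.
apply/eqP; rewrite eq_le measure_ge0 andbT; apply/lee_addgt0Pr => e e0.
rewrite add0e; have [C HC] := tightP i e0.
pose a (n : nat) : set 'cV[R]_m := [set x | (C < `|x i ord0|)%R].
have ma n : measurable (a n).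
  rewrite (_ : a n = (fun x : 'cV[R]_m => C < `|x i ord0|) @^-1` [set true])//.
  rewrite -[X in measurable X]setTI; apply: measurable_fun_ltr => //.
  by apply: measurableT_comp => //; exact: measurable_mxcoord.
apply: (@le_trans _ _ (loeb P (internal a))).
  apply: le_measure; rewrite ?inE//; first by apply: sub_sigma_algebra; exists a.
  move=> w; apply: contra_notP => /(ultra_dicho _) Ua.
  have cy := @cvg_ultra_value _ _ _ _ (log01 i) w.
  apply/andP; split.
    apply: (@lt_le_trans _ _ (logistic (- C))); first exact: logistic_gt0.
    apply: (limr_ge cy); apply: filterS Ua => n /= /negP; rewrite -leNgt ler_norml => /andP[h _].
    exact: logistic_le.
  apply: (@le_lt_trans _ _ (logistic C)); last exact: logistic_lt1.
  apply: (limr_le cy); apply: filterS Ua => n /= /negP; rewrite -leNgt ler_norml => /andP[_ h].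
  exact: logistic_le.
rewrite loeb_internal// lee_fin; apply: limr_le; first exact: cvg_loeb.
apply: free_ultra_eventually; apply: filterS HC => n.
by rewrite -lee_fin fineK ?fin_num_measure.
Qed.

(** M is the image of the Loeb measure under the standard part. At almost every w the sequence [w n]
    tends to [st w] along the ultrafilter, so f at [st w] is the standard part of f at w, and
    [integral_ultra_value] gives the limit. *)
Theorem prohorov : exists M : probability 'cV[R]_m R,
  forall f : 'cV[R]_m -> R, continuous f -> (forall x, 0 <= f x <= 1) ->
  fine (\int[P n]_x (f x)%:E)%E @[n --> U] --> fine (\int[M]_x (f x)%:E)%E.
Proof.
exists (distribution (loeb P) st) => f cf f01.
have mf := continuous_measurable_mx cf.
rewrite ge0_integral_distribution; last 2 first.
- exact/measurable_EFinP.
- by move=> x; rewrite lee_fin; case/andP: (f01 x).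
have -> : (\int[loeb P]_w ((EFin \o f) \o st) w = \int[loeb P]_w (ultra_value f w)%:E)%E.
  apply: ge0_ae_eq_integral => //.
  - by apply/measurable_EFinP; exact: measurableT_comp.
  - by apply/measurable_EFinP; exact: measurable_ultra_value.
  - by move=> w _; rewrite lee_fin; case/andP: (f01 (st w)).
  - by move=> w _; rewrite lee_fin; case/andP: (@ultra_value01 _ _ _ _ f01 w).
  have : \forall w \ae loeb P, forall i, 0 < y i w < 1.
    by apply: filter_forall => i; exact: bad_negligible.
  apply: filterS => w yw _ /=; congr EFin.
  have wst : w n @[n --> U] --> st w.
    apply: cvg_mx => i j; rewrite (ord1 j) mxE.
    have -> : (fun n => w n i ord0) = @logit R \o (fun n => logistic (w n i ord0)).
      by apply/funext => n /=; rewrite logisticK.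
    apply: (cvg_comp _ _ (@cvg_ultra_value _ _ _ _ (log01 i) w)).
    exact: continuous_logit.
  have : f (w n) @[n --> U] --> f (st w) by apply: (cvg_comp _ _ wst); exact: cf.
  by move=> h; apply/esym/cvg_lim.
exact: integral_ultra_value.
Qed.

End prohorov.

(** * Densities and normal integrals *)

Section density.
Local Open Scope ereal_scope.
Context d (T : measurableType d) (R : realType) (mu : {measure set T -> \bar R}).
Variable g : T -> \bar R.
Hypotheses (mg : measurable_fun setT g) (g0 : forall x, 0 <= g x).

Let nu (A : set T) : \bar R := \int[mu]_(x in A) g x.

Lemma density_measure : exists m : {measure set T -> \bar R},
  forall A, m A = \int[mu]_(x in A) g x.
Proof.
have nu0 : nu set0 = 0 by rewrite /nu integral_set0.
have nu_ge0 A : 0 <= nu A by apply: integral_ge0 => x _; exact: g0.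
have nuS : semi_sigma_additive nu.
  move=> F mF tF mUF; rewrite /nu ge0_integral_bigcup//; last exact: measurable_funTS.
  by apply: is_cvg_ereal_nneg_natsum_cond => n _ _; exact: nu_ge0.
by exists (HB.pack_for {measure set T -> \bar R} nu (isMeasure.Build _ _ _ nu nu0 nu_ge0 nuS)).
Qed.

Variable m : {measure set T -> \bar R}.
Hypothesis mE : forall A, measurable A -> m A = \int[mu]_(x in A) g x.

Import HBNNSimple.

Let density_nnsfun (h : {nnsfun T >-> R}) :
  \int[m]_x (h x)%:E = \int[mu]_x ((h x)%:E * g x).
Proof.
under [LHS]eq_integral do rewrite fimfunE -fsumEFin//.
rewrite [LHS]ge0_integral_fsum//; last 2 first.
- by move=> r; exact/measurable_EFinP/measurableT_comp.
- by move=> r x _; rewrite EFinM nnfun_muleindic_ge0.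
under [RHS]eq_integral.
  move=> x _; rewrite fimfunE -fsumEFin// muleC ge0_mule_fsumr; last first.
    by move=> r; rewrite EFinM nnfun_muleindic_ge0.
  over.
rewrite [RHS]ge0_integral_fsum//; last 2 first.
- move=> r; apply: emeasurable_funM => //.
  by exact/measurable_EFinP/measurableT_comp.
- by move=> r x _; rewrite mule_ge0// EFinM nnfun_muleindic_ge0.
apply: eq_fsbigr => r rh; rewrite (integralZl_indic_nnsfun _ measurableT)//= integral_indic// setIT mE//.
have r0 : (0 <= r)%R.
  by move: rh; rewrite inE /= => -[x _ <-].
rewrite [in LHS]integral_mkcond epatch_indic -ge0_integralZl_EFin//; last 2 first.
- by move=> x _; rewrite mule_ge0// lee_fin.
- by apply: emeasurable_funM => //; apply/measurable_EFinP.
by apply: eq_integral => x _; rewrite EFinM muleCA.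
Qed.

Lemma ge0_integral_density (f : T -> \bar R) : measurable_fun setT f ->
  (forall x, 0 <= f x) -> \int[m]_x f x = \int[mu]_x (f x * g x).
Proof.
move=> mf f0; pose h := nnsfun_approx measurableT mf.
have hf x : (h n x)%:E @[n --> \oo] --> f x by apply: cvg_nnsfun_approx.
have nd : nondecreasing_seq (h : (T -> R)^nat) by exact: nd_nnsfun_approx.
transitivity (limn (fun n => \int[m]_x (h n x)%:E)).
  rewrite -monotone_convergence//=.
  - by apply: eq_integral => x _; apply/esym/cvg_lim => //; exact: hf.
  - by move=> n; exact/measurable_EFinP.
  - by move=> n x _; rewrite lee_fin.
  - by move=> x _ n k nk; rewrite lee_fin; exact/lefP/nd.
under eq_fun do rewrite density_nnsfun.
rewrite -monotone_convergence//=.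
- apply: eq_integral => x _; apply/cvg_lim => //.
  (* The density may be infinite at x, so a vanishing factor makes the limit of the products an
     undetermined form. If f x = 0, all approximants vanish at x as well. *)
  have [fx0|fx0] := eqVneq (f x) 0.
    have hn0 n : h n x = 0%R.
      suff : (h n x)%:E <= 0 by rewrite lee_fin => hn; apply/eqP; rewrite eq_le hn fun_ge0.
      rewrite -fx0.
      rewrite -(cvg_lim _ (hf x))//; apply: lime_ge; first by apply/cvg_ex; exists (f x); exact: hf.
      by exists n => // k nk; rewrite /= lee_fin; exact/lefP/nd.
    by rewrite fx0; under eq_fun do rewrite hn0; rewrite mul0e; exact: cvg_cst.
  have [gx0|gx0] := eqVneq (g x) 0.
    by rewrite gx0 mule0; under eq_fun do rewrite mule0; exact: cvg_cst.
  apply: cvgeM => //; last exact: cvg_cst.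
  by apply: neq0_mule_def; rewrite mule_eq0 negb_or fx0.
- move=> n; apply: emeasurable_funM => //; exact/measurable_EFinP.
- by move=> n x _; rewrite mule_ge0// lee_fin.
- by move=> x _ n k nk; rewrite lee_wpmul2r// lee_fin; exact/lefP/nd.
Qed.

End density.

(* Only one inequality between the measures is needed for the one-sided
   change of measure behind Le Cam's third lemma. *)
Lemma ge0_le_integral_density d (T : measurableType d) (R : realType)
  (mu m : {measure set T -> \bar R}) (g : T -> \bar R) :
  measurable_fun setT g -> (forall x, 0 <= g x)%E ->
  (forall A, measurable A -> \int[mu]_(x in A) g x <= m A)%E ->
  forall f : T -> \bar R, measurable_fun setT f -> (forall x, 0 <= f x)%E ->
  (\int[mu]_x (f x * g x) <= \int[m]_x f x)%E.
Proof.
move=> mg g0 gm f mf f0; have [nu nuE] := density_measure mu mg g0.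
rewrite -(ge0_integral_density mg g0 (fun A _ => nuE A))//.
by apply: ge0_le_measure_integral => // A mA; rewrite nuE gm.
Qed.

(** By uniqueness of Lebesgue measure: r times its image under x -> r x + b gives each half-open
    interval its length. *)
Lemma ge0_integral_lebesgue_affine (R : realType) (r b : R) (G : R -> \bar R) :
  0 < r -> measurable_fun setT G -> (forall x, 0 <= G x)%E ->
  (\int[lebesgue_measure]_x G x =
   r%:E * \int[lebesgue_measure]_x G (r * x + b)%R)%E.
Proof.
move=> r0 mG G0.
pose aff x : R := r * x + b.
have maff : measurable_fun [set: measurableTypeR R] (aff : _ -> measurableTypeR R).
  by apply: measurable_funD => //; exact: measurable_funM.
pose r' : {nonneg R} := NngNum (ltW r0).
pose push : {measure set (measurableTypeR R) -> \bar R} :=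
  measure_function_pushforward__canonical__measure_function_Measure lebesgue_measure maff.
pose nu := mscale r' push.
have E : forall A, measurable A -> lebesgue_measure A = nu A.
  apply: lebesgue_measure_unique => _ [[x y] _ <-] /=.
  rewrite /nu /mscale /= /pushforward.
  have -> : aff @^-1` `]x, y] = `](x - b) / r, (y - b) / r]%classic.
    apply/seteqP; split => z /=; rewrite !in_itv/= /aff => /andP[h1 h2]; apply/andP; split.
    - by rewrite ltr_pdivrMr// ltrBlDr mulrC.
    - by rewrite ler_pdivlMr// lerBrDr mulrC.
    - by rewrite -ltrBlDr mulrC -ltr_pdivrMr.
    - by rewrite -lerBrDr mulrC -ler_pdivlMr.
  rewrite !lebesgue_measure_itv/= !lte_fin ltr_pM2r ?invr_gt0// ltrD2r.
  case: ifPn => _; last by rewrite mule0.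
  rewrite -!EFinB -EFinM; congr EFin; field; exact: lt0r_neq0.
rewrite (eq_measure_integral nu) => [|A mA _]; last exact: E.
rewrite ge0_integral_mscale//= ge0_integral_pushforward//.
Qed.

Section normal_change.
Context (R : realType).
Local Notation N := (@normal_prob R 0 1).

Lemma ge0_integral_normal_prob (m s : R) (f : R -> \bar R) :
  measurable_fun setT f -> (forall x, 0 <= f x)%E ->
  (\int[normal_prob m s]_x f x =
   \int[lebesgue_measure]_x (f x * (normal_pdf m s x)%:E))%E.
Proof.
move=> mf f0; apply: ge0_integral_density => //.
- by apply/measurable_EFinP; exact: measurable_normal_pdf.
- by move=> x; rewrite lee_fin normal_pdf_ge0.
Qed.

(* The factor multiplying G is the density of the normal distribution of mean b
   and standard deviation r with respect to the standard normal one. *)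
Lemma ge0_integral_normal_change (r b : R) (G : R -> \bar R) : 0 < r ->
  measurable_fun setT G -> (forall x, 0 <= G x)%E ->
  (\int[N]_x (G x * (r^-1 * expR (2^-1 * (x ^+ 2 - ((x - b) / r) ^+ 2)))%:E) =
   \int[N]_x G (r * x + b)%R)%E.
Proof.
move=> r0 mG G0.
have mlin : measurable_fun setT (fun x : R => r * x + b).
  by apply: measurable_funD => //; exact: measurable_funM.
have mk : measurable_fun setT
    (fun x : R => (r^-1 * expR (2^-1 * (x ^+ 2 - ((x - b) / r) ^+ 2)))).
  apply: measurable_funM => //; apply: measurableT_comp => //.
  apply: measurable_funM => //; apply: measurable_funB; apply: measurable_funX => //.
  by apply: measurable_funM => //; exact: measurable_funB.
have mGk : measurable_fun setT
    (fun x => G x * (r^-1 * expR (2^-1 * (x ^+ 2 - ((x - b) / r) ^+ 2)))%:E)%E.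
  by apply: emeasurable_funM => //; exact/measurable_EFinP.
have k0 x : (0 <= G x * (r^-1 * expR (2^-1 * (x ^+ 2 - ((x - b) / r) ^+ 2)))%:E)%E.
  by rewrite mule_ge0// lee_fin mulr_ge0 ?invr_ge0 ?(ltW r0) ?expR_ge0.
have mpdf : measurable_fun setT (fun x : R => (normal_pdf 0 1 x)%:E).
  by apply/measurable_EFinP; exact: measurable_normal_pdf.
have pdf0 x : (0 <= (normal_pdf 0 1 x : R)%:E)%E by rewrite lee_fin normal_pdf_ge0.
rewrite !ge0_integral_normal_prob//; last exact: measurableT_comp.
rewrite (@ge0_integral_lebesgue_affine _ r b)//; last 2 first.
- exact: emeasurable_funM.
- by move=> x; rewrite mule_ge0.
rewrite -ge0_integralZl_EFin ?(ltW r0)//; last 2 first.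
- by move=> x _; rewrite mule_ge0.
- exact: (measurableT_comp (emeasurable_funM mGk mpdf) mlin).
apply: eq_integral => x _ /=.
rewrite -muleA (muleCA r%:E); congr (_ * _)%E; rewrite -!EFinM; congr EFin.
rewrite !normal_pdfE ?oner_eq0// /normal_fun.
rewrite addrK (mulrC r x) mulfK ?gt_eqF//.
rewrite !mulrA divff ?gt_eqF// mul1r [LHS]mulrAC -expRD [LHS]mulrC; congr (_ * expR _).
rewrite !subr0 expr1n; by field.
Qed.

(** The integrand is the density of the unit normal law of mean b relative to the standard one: the
    case r = 1, G = 1 of the change of variables. *)
Lemma integral_normal_expR (b : R) :
  (\int[N]_x (expR (b * x - 2^-1 * b ^+ 2))%:E = 1)%E.
Proof.
have := @ge0_integral_normal_change 1 b (fun=> 1%E) ltr01.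
have -> : (\int[N]_x (fun=> 1) (1 * x + b)%R = 1)%E.
  by rewrite integral_cst// mul1e; exact: probability_setT.
move=> <- //.
apply: eq_integral => x _; rewrite mul1e invr1 mul1r mulr1; congr EFin; congr expR.
by field.
Qed.

End normal_change.

Section iid_integral.
Context d (T : measurableType d) (R : realType) (P : probability T R).
Local Open Scope ereal_scope.

Lemma ge0_integral_iid0 (G : 0.-tuple T -> \bar R) :
  measurable_fun setT G -> (forall t, 0 <= G t) ->
  \int[iid P 0]_t G t = G [tuple].
Proof. by move=> mG G0; rewrite integral_dirac// diracE mem_set// mul1e. Qed.

Lemma ge0_integral_iidS n (G : n.+1.-tuple T -> \bar R) :
  measurable_fun setT G -> (forall t, 0 <= G t) ->
  \int[iid P n.+1]_t G t = \int[P]_x \int[iid P n]_u G (cons_pair (x, u)).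
Proof.
move=> mG G0; rewrite ge0_integral_distribution// fubini_tonelli1//.
  by apply: (measurableT_comp mG); exact: measurable_cons_pair.
by move=> xu; exact: G0.
Qed.

Lemma measurable_tuple_map n (c : 'I_n -> T -> T) :
  (forall i, measurable_fun setT (c i)) ->
  measurable_fun setT (fun t : n.-tuple T => [tuple c i (tnth t i) | i < n]).
Proof.
move=> mc; apply/measurable_fun_tnthP => i.
rewrite (_ : _ \o _ = c i \o (fun t : n.-tuple T => tnth t i)).
  by apply: measurableT_comp => //; exact: measurable_tnth.
by apply/funext => t /=; rewrite tnth_mktuple.
Qed.

Lemma measurable_tuple_prod n (k : 'I_n -> T -> R) :
  (forall i, measurable_fun setT (k i)) ->
  measurable_fun setT (fun t : n.-tuple T => (\prod_(i < n) k i (tnth t i))%R).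
Proof.
move=> mk; apply: measurable_prod => i _.
by apply: (measurableT_comp (mk i)); exact: measurable_tnth.
Qed.

(** Tonelli splits off coordinate 0: the induction hypothesis treats the inner integral, the
    one-dimensional rule [kc] the outer one. The factors depend on the coordinate because the
    posterior mean does. *)
Lemma ge0_integral_iid_change n (k : 'I_n -> T -> R) (c : 'I_n -> T -> T)
    (G : n.-tuple T -> \bar R) :
  (forall i, measurable_fun setT (k i)) -> (forall i x, 0 <= k i x)%R ->
  (forall i, measurable_fun setT (c i)) ->
  (forall i (F : T -> \bar R), measurable_fun setT F -> (forall x, 0 <= F x) ->
     \int[P]_x (F x * (k i x)%:E) = \int[P]_x F (c i x)) ->
  measurable_fun setT G -> (forall t, 0 <= G t) ->
  \int[iid P n]_t (G t * (\prod_(i < n) k i (tnth t i))%:E) =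
  \int[iid P n]_t G [tuple c i (tnth t i) | i < n].
Proof.
elim: n k c G => [|n IH] k c G mk k0 mc kc mG G0.
  rewrite !ge0_integral_iid0//.
  - rewrite big_ord0 mule1; congr G; exact/esym/tuple0.
  - by apply: (measurableT_comp mG); exact: measurable_tuple_map.
  - apply: emeasurable_funM => //; apply/measurable_EFinP; exact: measurable_tuple_prod.
  - by move=> t; rewrite mule_ge0// lee_fin prodr_ge0.
have mG1 : measurable_fun setT (fun xu => G (cons_pair xu)).
  by apply: (measurableT_comp mG); exact: measurable_cons_pair.
have mGx x : measurable_fun setT (fun u => G (cons_pair (x, u))).
  exact: (@measurable_fun_pair2 _ _ _ _ _ _ (fun xu => G (cons_pair xu))).
pose c' i := c (lift ord0 i).
have mc' : measurable_fun setT (fun t : n.-tuple T => [tuple c' i (tnth t i) | i < n]).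
  by apply: measurable_tuple_map => i; exact: mc.
pose F x := \int[iid P n]_u G (cons_pair (x, [tuple c' i (tnth u i) | i < n])).
have mF : measurable_fun setT F.
  apply: (@measurable_fun_fubini_tonelli_F _ _ _ _ _ _
    (fun xu => G (cons_pair (xu.1, [tuple c' i (tnth xu.2 i) | i < n])))) => //.
  apply: (measurableT_comp mG1); apply: measurable_fun_pair => /=; first exact: measurable_fst.
  apply: (@measurableT_comp _ _ _ _ _ _ (fun t : n.-tuple T => [tuple c' i (tnth t i) | i < n]) _ snd) => //.
have F0 x : 0 <= F x by apply: integral_ge0.
rewrite !ge0_integral_iidS//; last 3 first.
- by apply: (measurableT_comp mG); exact: measurable_tuple_map.
- apply: emeasurable_funM => //; apply/measurable_EFinP; exact: measurable_tuple_prod.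
- by move=> t; rewrite mule_ge0// lee_fin prodr_ge0.
transitivity (\int[P]_x (F x * (k ord0 x)%:E)).
  apply: eq_integral => x _.
  transitivity (\int[iid P n]_u ((k ord0 x)%:E *
     (G (cons_pair (x, u)) * (\prod_(i < n) k (lift ord0 i) (tnth u i))%:E))).
    apply: eq_integral => u _; rewrite big_ord_recl/= EFinM muleCA.
    congr (_ * (_ * _%:E)); apply: eq_bigr => i _; congr k.
    by rewrite tnthS.
  rewrite ge0_integralZl_EFin//; last 2 first.
  - by move=> u _; rewrite mule_ge0// lee_fin prodr_ge0.
  - by apply: emeasurable_funM => //; apply/measurable_EFinP; apply: (@measurable_tuple_prod _ (fun i => k (lift ord0 i))).
  rewrite muleC; congr (_ * _); rewrite (IH (fun i => k (lift ord0 i)) c' (fun u => G (cons_pair (x, u))))//.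
    by move=> i; exact: mc.
  by move=> i; exact: kc.
rewrite kc//; apply: eq_integral => x _; apply: eq_integral => u _.
congr G; apply: eq_from_tnth => i; rewrite tnth_mktuple.
have [j ->|->] := unliftP ord0 i; last by rewrite /= !tnth0.
by rewrite /= !tnthS tnth_mktuple.
Qed.

End iid_integral.

(** * Lower bounds for second moments of normal laws *)

Section normal_second_moment.
Context (R : realType).
Local Notation N := (@normal_prob R 0 1).

Lemma ge0_integral_normalN (G : R -> \bar R) :
  measurable_fun setT G -> (forall x, 0 <= G x)%E ->
  (\int[N]_x G (- x)%R = \int[N]_x G x)%E.
Proof.
move=> mG G0.
have mpdf : measurable_fun setT (fun x : R => (normal_pdf 0 1 x)%:E).
  by apply/measurable_EFinP; exact: measurable_normal_pdf.
have pdf0 x : (0 <= (normal_pdf 0 1 x : R)%:E)%E by rewrite lee_fin normal_pdf_ge0.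
have mo : measurable_fun setT (-%R : R -> R) by exact: oppr_measurable.
rewrite !ge0_integral_normal_prob//; last exact: (measurableT_comp mG mo).
have mH : measurable_fun setT (fun x => G x * (normal_pdf 0 1 x)%:E)%E by exact: emeasurable_funM.
have mopp : measurable_fun [set: measurableTypeR R] (-%R : _ -> measurableTypeR R).
  exact: mo.
rewrite [RHS](eq_measure_integral
  (measure_function_pushforward__canonical__measure_function_Measure lebesgue_measure mopp)); last first.
  by move=> A mA _; exact/esym/lebesgue_measureN.
rewrite (ge0_integral_pushforward mopp); last 3 first.
- exact: measurableT.
- exact: mH.
- by move=> x _; rewrite mule_ge0.
rewrite preimage_setT; apply: eq_integral => x _ /=; congr (_ * _%:E)%E.
by rewrite !normal_pdfE ?oner_eq0// /normal_fun !subr0 sqrrN.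
Qed.

Lemma sqr_le_expRD (x : R) : x ^+ 2 <= 4 * (expR x + expR (- x)).
Proof.
have h (y : R) : 0 <= y -> y ^+ 2 <= 4 * expR y.
  move=> y0; have -> : expR y = expR (y / 2) ^+ 2.
    by rewrite expr2 -expRD; congr expR; field.
  have -> : 4 * expR (y / 2) ^+ 2 = (2 * expR (y / 2)) ^+ 2 by ring.
  rewrite ler_sqr ?nnegrE ?mulr_ge0 ?expR_ge0//.
  have := expR_ge1Dx (y / 2); lra.
have [x0|/ltW x0] := leP 0 x.
  by rewrite (le_trans (h _ x0))// ler_wpM2l// lerDl expR_ge0.
by rewrite -sqrrN (le_trans (h _ _)) ?oppr_ge0// ler_wpM2l// lerDr expR_ge0.
Qed.

(** With y = 2 z and z >= 0, the left side is the square of e^z - e^-z, and e^-2z >= 1 - 2 z bounds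
    this difference by 2 z e^z. The case y < 0 follows by symmetry. *)
Lemma expR_second_difference (y : R) : expR y + expR (- y) - 2 <= y ^+ 2 * expR `|y|.
Proof.
have h (z : R) : 0 <= z -> expR (2 * z) + expR (- (2 * z)) - 2 <= (2 * z) ^+ 2 * expR (2 * z).
  move=> z0.
  have e1 : expR (2 * z) = expR z ^+ 2 by rewrite expr2 -expRD; congr expR; ring.
  have e2 : expR (- (2 * z)) = (expR z)^-1 ^+ 2 by rewrite expr2 -expRN -expRD; congr expR; ring.
  have ez : 0 < expR z by exact: expR_gt0.
  have d0 : 0 <= expR z - (expR z)^-1.
    by rewrite subr_ge0 -expRN ler_expR; lra.
  have d1 : expR z - (expR z)^-1 <= 2 * z * expR z.
    have := expR_ge1Dx (- (2 * z)); rewrite e2 => h.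
    have : expR z * (1 - 2 * z) <= (expR z)^-1.
      have -> : (expR z)^-1 = expR z * (expR z)^-1 ^+ 2 by field; exact: lt0r_neq0.
      by rewrite ler_wpM2l// ltW.
    lra.
  have -> : expR (2 * z) + expR (- (2 * z)) - 2 = (expR z - (expR z)^-1) ^+ 2.
    rewrite e1 e2; field; exact: lt0r_neq0.
  rewrite e1 (_ : (2 * z) ^+ 2 * expR z ^+ 2 = (2 * z * expR z) ^+ 2); last by ring.
  by rewrite ler_sqr ?nnegrE// (le_trans d0).
have [y0|/ltW y0] := leP 0 y.
  have := h (y / 2); rewrite mulrCA divff// mulr1 ger0_norm//; apply; lra.
have := h (- y / 2); rewrite mulrCA divff// mulr1 opprK ler0_norm// sqrrN [expR (- y) + _]addrC.
by apply; lra.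
Qed.

Let mexp (a : R) : measurable_fun setT (fun x : R => expR (a * x)).
Proof. by apply: measurableT_comp => //; exact: measurable_funM. Qed.

Lemma integral_normal_expRM (s : R) :
  (\int[N]_x (expR (s * x))%:E = (expR (2^-1 * s ^+ 2))%:E)%E.
Proof.
have := integral_normal_expR s.
under eq_integral do rewrite expRD expRN EFinM.
rewrite ge0_integralZr//; last by apply/measurable_EFinP; exact: mexp.
have e0 := expR_gt0 (2^-1 * s ^+ 2).
move=> /(congr1 (fun z => z * (expR (2^-1 * s ^+ 2))%:E)%E).
by rewrite mul1e -muleA -EFinM mulVf ?gt_eqF// mule1.
Qed.

(* The second difference of s |-> E[exp(s X)] = exp(s^2 / 2) at 0 is at least s^2. *)
Lemma integral_normal_sqr_ge1 : (1 <= \int[N]_x ((x : R) ^+ 2)%:E)%E.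
Proof.
(* With s = 1 / (n + 1), the second difference of the exponential at s x is at most s^2 times
   [f n x]. Dividing by s^2 leaves a lower bound 1 for each integral, which passes to the limit
   x^2. *)
pose f (n : nat) (x : R) : R := x ^+ 2 * expR (`|x| / n.+1%:R).
have mf n : measurable_fun setT (f n).
  apply: measurable_funM; first exact: measurable_funX.
  apply: measurableT_comp => //; apply: measurable_funM => //.
have f0 n x : 0 <= f n x by rewrite mulr_ge0 ?sqr_ge0 ?expR_ge0.
have f1 n : (1 <= \int[N]_x (f n x)%:E)%E.
  pose s : R := n.+1%:R^-1; have s0 : 0 < s by rewrite invr_gt0.
  have : (\int[N]_x (expR (s * x) + expR (- s * x))%:E <=
      2%:E + (s ^+ 2)%:E * \int[N]_x (f n x)%:E)%E.
    rewrite -ge0_integralZl_EFin ?sqr_ge0//; last 2 first.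
    - by move=> x _; rewrite lee_fin mulr_ge0 ?sqr_ge0 ?expR_ge0.
    - by apply/measurable_EFinP; exact: mf.
    have -> : 2%:E = (\int[N]_x (cst 2%:E x))%E.
      by rewrite prob_integral_cst.
    rewrite -ge0_integralD//; last 2 first.
    - by move=> x _; rewrite mule_ge0// lee_fin ?sqr_ge0.
    - by apply: emeasurable_funM => //; apply/measurable_EFinP; (exact: mf || exact: mexp).
    apply: ge0_le_integral => //.
    - by apply/measurable_EFinP; apply: measurable_funD; exact: mexp.
    - by apply: emeasurable_funD => //; apply: emeasurable_funM => //; apply/measurable_EFinP; (exact: mf || exact: mexp).
    - move=> x _; rewrite -EFinM -EFinD lee_fin /f.
      have := expR_second_difference (s * x); rewrite mulNr -lerBlDl => /le_trans; apply.
      by rewrite exprMn normrM (gtr0_norm s0) -mulrA (mulrC s).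
    by move=> x _; rewrite lee_fin.
  have -> : (\int[N]_x (expR (s * x) + expR (- s * x))%:E =
      \int[N]_x (expR (s * x))%:E + \int[N]_x (expR (- s * x))%:E)%E.
    by rewrite -ge0_integralD//; apply/measurable_EFinP; exact: mexp.
  rewrite !integral_normal_expRM sqrrN -EFinD => h.
  have : (2%:E + (s ^+ 2)%:E <= 2%:E + (s ^+ 2)%:E * \int[N]_x (f n x)%:E)%E.
    apply: le_trans h; rewrite -EFinD lee_fin.
    have := expR_ge1Dx (2^-1 * s ^+ 2); lra.
  rewrite leeD2lE// -[X in (X <= _)%E]mule1 lee_pmul2l// ?lte_fin ?exprn_gt0//.
(* The dominating function 4 (e^x + e^-x)^2, expanded: x^2 is at most 4 (e^x + e^-x), and e^(|x| /
   (n + 1)) at most e^x + e^-x. *)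
pose g (x : R) : R := 4 * (expR (2 * x) + expR (- 2 * x) + 2).
have fg n x : f n x <= g x.
  have := sqr_le_expRD x; have ex := expR_gt0 x; have ex' := expR_gt0 (- x).
  have xe : expR (`|x| / n.+1%:R) <= expR x + expR (- x).
    apply: (@le_trans _ _ (expR `|x|)).
      by rewrite ler_expR ler_piMr// invf_le1// ler1n.
    have [x0|/ltW x0] := leP 0 x; first by rewrite ger0_norm// lerDl expR_ge0.
    by rewrite ler0_norm// lerDr expR_ge0.
  move=> h; rewrite /f.
  apply: (@le_trans _ _ (4 * (expR x + expR (- x)) * (expR x + expR (- x)))).
    by apply: ler_pM; rewrite ?sqr_ge0 ?expR_ge0.
  have e1 : expR (2 * x) = expR x ^+ 2 by rewrite expr2 -expRD; congr expR; ring.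
  rewrite /g mulNr !expRN e1.
  rewrite le_eqVlt; apply/orP; left; apply/eqP; field; exact: lt0r_neq0.
have ie (a : R) : N.-integrable setT (fun x => (expR (a * x))%:E).
  apply/integrableP; split; first by apply/measurable_EFinP; (exact: mf || exact: mexp).
  under eq_integral do rewrite gee0_abs ?lee_fin ?expR_ge0//.
  by rewrite integral_normal_expRM ltry.
have ig : N.-integrable setT (fun x => (g x)%:E).
  rewrite /g; under eq_fun do rewrite EFinM !EFinD.
  apply: integrableZl => //; apply: integrableD => //; first exact: integrableD.
  exact: finite_measure_integrable_cst.
have cv : (\int[N]_x (f n x)%:E)%E @[n --> \oo] --> (\int[N]_x ((x : R) ^+ 2)%:E)%E.
  have [] := @dominated_convergence _ _ _ N setT measurableT (fun n x => (f n x)%:E)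
    (fun x => ((x : R) ^+ 2)%:E) (fun x => (g x)%:E).
  - by move=> n; apply/measurable_EFinP; (exact: mf || exact: mexp).
  - by apply/measurable_EFinP; exact: measurable_funX.
  - apply: aeW => x _; apply/cvg_EFin; first exact: nearW.
    rewrite /comp/= -[X in _ --> X]mulr1 -expR0 -[X in expR X](mulr0 `|x|).
    apply: cvgM; first exact: cvg_cst.
    apply: (cvg_comp _ _ (_ : `|x| / n.+1%:R @[n --> \oo] --> _)); last exact: continuous_expR.
    by apply: cvgM; [exact: cvg_cst|exact: cvg_harmonic].
  - exact: ig.
  - by apply: aeW => x n _; rewrite gee0_abs ?lee_fin ?fg ?f0.
  by [].
have := cvg_lim _ cv; move=> <- //; apply: lime_ge; first by apply/cvg_ex; eexists; exact: cv.
exact: nearW.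
Qed.

(** Adding the integral to its image under x -> -x cancels the cross term: twice the integral is
    that of 2 b^2 x^2 + 2 c^2. All integrands stay nonnegative, and the value may a priori be
    infinite. *)
Lemma integral_normal_affine_sqr_ge (b c : R) :
  ((b ^+ 2 + c ^+ 2)%:E <= \int[N]_x ((b * x + c) ^+ 2)%:E)%E.
Proof.
have maff (a : R) : measurable_fun setT (fun x : R => ((a * x + c) ^+ 2)%:E).
  by apply/measurable_EFinP; apply: measurable_funX; apply: measurable_funD => //; exact: measurable_funM.
set V := (\int[N]_x ((b * x + c) ^+ 2)%:E)%E.
have V' : V = (\int[N]_x ((- b * x + c) ^+ 2)%:E)%E.
  rewrite /V -(@ge0_integral_normalN (fun x => ((b * x + c) ^+ 2)%:E))//.
    by apply: eq_integral => x _; rewrite mulrN mulNr.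
  by move=> x; rewrite lee_fin sqr_ge0.
have c0 (z : R) : 0 <= 2 * z ^+ 2 by rewrite mulr_ge0// sqr_ge0.
have : (V + V = (2 * b ^+ 2)%:E * \int[N]_x ((x : R) ^+ 2)%:E + (2 * c ^+ 2)%:E)%E.
  rewrite {2}V' -ge0_integralD//; try first [exact: maff | by move=> x _; rewrite lee_fin sqr_ge0].
  rewrite -ge0_integralZl_EFin//; try first
    [by move=> x _; rewrite lee_fin sqr_ge0 | by apply/measurable_EFinP; exact: measurable_funX].
  have -> : (2 * c ^+ 2)%:E = (\int[N]_x (cst (2 * c ^+ 2)%:E x))%E.
    by rewrite prob_integral_cst.
  rewrite -ge0_integralD//; try first
    [by move=> x _; rewrite mule_ge0// lee_fin ?c0 ?sqr_ge0 | by move=> x _; rewrite lee_fin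
    | by apply: emeasurable_funM => //; apply/measurable_EFinP; exact: measurable_funX].
  by apply: eq_integral => x _; rewrite /= -EFinM -!EFinD; congr EFin; ring.
move=> VE.
have h : ((2 * b ^+ 2)%:E + (2 * c ^+ 2)%:E <= V + V)%E.
  rewrite VE leeD2r// -[X in (X <= _)%E]mule1 lee_wpmul2l ?lee_fin//.
  exact: integral_normal_sqr_ge1.
move: h; case: V {V' VE} => [v| |]; rewrite ?leey//=.
  by rewrite -!EFinD !lee_fin; lra.
Qed.

End normal_second_moment.

Lemma vdotE (R : realType) p (u v : 'cV[R]_p) : vdot u v = \sum_i u i 0 * v i 0.
Proof. by rewrite /vdot mxE; apply: eq_bigr => i _; rewrite mxE. Qed.

Section standard_gaussian_vector.
Context (R : realType) (p : nat).
Local Notation N := (@normal_prob R 0 1).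
Local Notation Np := (iid (@normal_prob R 0 1) p).

Definition tuple_col (t : p.-tuple (measurableTypeR R)) : 'cV[R]_p := \col_i tnth t i.

Lemma measurable_tuple_col : measurable_fun setT tuple_col.
Proof.
apply: measurable_mxP => i j.
rewrite (_ : (fun _ => _) = fun t : p.-tuple (measurableTypeR R) => tnth t i : R).
  exact: (@measurable_tnth _ (measurableTypeR R) p i).
by apply/funext => t; rewrite mxE.
Qed.

Lemma tuple_col_map (c : 'I_p -> R -> R) t :
  tuple_col [tuple c i (tnth t i) | i < p] = \col_i c i (tnth t i).
Proof. by apply/matrixP => i j; rewrite !mxE tnth_mktuple. Qed.

Lemma ge0_integral_gaussian (m : 'cV[R]_p) (S : 'M[R]_p) (f : 'cV[R]_p -> \bar R) :
  measurable_fun setT f -> (forall x, 0 <= f x)%E ->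
  (\int[gaussian m S]_x f x =
   \int[Np]_z f (m + xget 0%R [set A : 'M[R]_p | A *m A^T = S] *m tuple_col z)%R)%E.
Proof. by move=> mf f0; rewrite ge0_integral_distribution. Qed.

(* The exponential factor is the likelihood of a Gaussian shift experiment under
   the shift - tau v; the right-hand side is its posterior, which is normal. *)
Lemma ge0_integral_gaussian_posterior (tau r : R) (Z : 'cV[R]_p) (G : 'cV[R]_p -> \bar R) :
  0 < r -> r ^+ 2 * (1 + tau ^+ 2) = 1 ->
  measurable_fun setT G -> (forall x, 0 <= G x)%E ->
  (\int[Np]_v (G (tuple_col v) * (expR (- tau * vdot (tuple_col v) Z
      - 2^-1 * tau ^+ 2 * vdot (tuple_col v) (tuple_col v)))%:E) =
   (r ^+ p * expR (2^-1 * (tau * r) ^+ 2 * vdot Z Z))%:E *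
   \int[Np]_w G (r *: tuple_col w - (tau * r ^+ 2) *: Z)%R)%E.
Proof.
move=> r0 rtau mG G0.
pose b i := - (tau * r ^+ 2 * Z i 0).
pose k (i : 'I_p) (x : R) := r^-1 * expR (2^-1 * (x ^+ 2 - ((x - b i) / r) ^+ 2)).
pose c (i : 'I_p) (x : R) := r * x + b i.
have mc i : measurable_fun setT (c i).
  by apply: measurable_funD => //; exact: measurable_funM.
have mk i : measurable_fun setT (k i).
  apply: measurable_funM => //; apply: measurableT_comp => //.
  apply: measurable_funM => //; apply: measurable_funB; apply: measurable_funX => //.
  by apply: measurable_funM => //; exact: measurable_funB.
have k0 i x : 0 <= k i x by rewrite mulr_ge0 ?invr_ge0 ?(ltW r0) ?expR_ge0.
have mGc : measurable_fun setT (fun v => G (tuple_col v)).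
  exact: (measurableT_comp mG measurable_tuple_col).
have H : forall i (F : R -> \bar R), measurable_fun setT F -> (forall x, 0 <= F x)%E ->
     (\int[N]_x (F x * (k i x)%:E) = \int[N]_x F (c i x))%E.
  by move=> i F mF F0; exact: ge0_integral_normal_change.
have := @ge0_integral_iid_change _ (measurableTypeR R) R N p k c _ mk k0 mc H mGc (fun t => G0 _).
have -> : (\int[Np]_w G (tuple_col [tuple c i (tnth w i) | i < p]) =
    \int[Np]_w G (r *: tuple_col w - (tau * r ^+ 2) *: Z)%R)%E.
  apply: eq_integral => w _; congr G; rewrite tuple_col_map.
  by apply/matrixP => i j; rewrite !mxE (ord1 j).
move=> <-; rewrite -ge0_integralZl_EFin; last 4 first.
- by [].
- by move=> v _; rewrite mule_ge0// lee_fin prodr_ge0.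
- by apply: emeasurable_funM => //; apply/measurable_EFinP; exact: measurable_tuple_prod.
- by rewrite mulr_ge0 ?expR_ge0 ?exprn_ge0 ?(ltW r0).
apply: eq_integral => v _; rewrite muleCA; congr (_ * _)%E; rewrite -EFinM; congr EFin.
rewrite /k big_split/= prodr_const card_ord mulrACA -mulrA.
rewrite -exprMn divff ?gt_eqF// expr1n mul1r -expR_sum -expRD; congr expR.
rewrite !vdotE !mulr_sumr -sumrB -big_split/=; apply: eq_bigr => i _.
rewrite !mxE /b.
(* Eliminating tau^2 reduces the completion of the square in each coordinate to a rational
   identity. *)
have rE : tau ^+ 2 = r ^- 2 - 1.
  apply: (addrI 1); rewrite [RHS]addrC subrK; apply: (mulfI (_ : r ^+ 2 != 0)).
    by rewrite expf_neq0// gt_eqF.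
  by rewrite rtau mulfV// expf_neq0// gt_eqF.
by rewrite rE; field; exact: lt0r_neq0.
Qed.

Lemma integral_gaussian_expR (a : 'cV[R]_p) :
  (\int[Np]_v (expR (vdot a (tuple_col v) - 2^-1 * vdot a a))%:E = 1)%E.
Proof.
pose k (i : 'I_p) (x : R) := 1^-1 * expR (2^-1 * (x ^+ 2 - ((x - a i 0) / 1) ^+ 2)).
have mk i : measurable_fun setT (k i).
  apply: measurable_funM => //; apply: measurableT_comp => //.
  apply: measurable_funM => //; apply: measurable_funB; apply: measurable_funX => //.
  by apply: measurable_funM => //; exact: measurable_funB.
have E1 : (\int[Np]_t (fun=> 1) [tuple (1 * tnth t i + a i 0)%R | i < p] = 1)%E.
  by rewrite integral_cst// mul1e; exact: probability_setT.
rewrite -[RHS]E1 -(@ge0_integral_iid_change _ (measurableTypeR R) R N p k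
  (fun i x => 1 * x + a i 0) (fun=> 1%E) mk)//.
- apply: eq_integral => v _; rewrite mul1e; congr EFin.
  rewrite /k big_split/= invr1 prodr_const card_ord expr1n mul1r -expR_sum; congr expR.
  rewrite !vdotE !mulr_sumr -sumrB; apply: eq_bigr => i _; rewrite !mxE mulr1.
  by field.
- by move=> i x; rewrite mulr_ge0 ?expR_ge0// invr_ge0.
- by move=> i; apply: measurable_funD => //; exact: measurable_funM.
- by move=> i F mF F0; exact: ge0_integral_normal_change.
Qed.

End standard_gaussian_vector.

(** Induction on the dimension: coordinate 0 is integrated first, the rest of the linear form being
    part of the constant, so that it contributes the square of its coefficient. *)
Lemma integral_gaussian_affine_sqr_ge (R : realType) p (b : 'cV[R]_p) (c : R) :
  ((vdot b b + c ^+ 2)%:E <=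
   \int[iid (@normal_prob R 0 1) p]_z ((vdot b (tuple_col z) + c) ^+ 2)%:E)%E.
Proof.
have mq q (u : 'cV[R]_q) (a : R) :
    measurable_fun setT (fun z => ((vdot u (tuple_col z) + a) ^+ 2)%:E).
  apply/measurable_EFinP; apply: measurable_funX; apply: measurable_funD => //.
  under eq_fun do rewrite vdotE.
  apply: measurable_sum => i; apply: measurable_funM => //.
  exact: (measurableT_comp (@measurable_mxcoord _ _ _ _ i 0) (@measurable_tuple_col R q)).
elim: p b c => [|p IH] b c.
  rewrite ge0_integral_iid0//.
    by rewrite !vdotE !big_ord0 !add0r.
  by move=> t; rewrite lee_fin sqr_ge0.
rewrite ge0_integral_iidS//; last by move=> t; rewrite lee_fin sqr_ge0.
pose b' : 'cV[R]_p := \col_i b (lift ord0 i) 0.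
pose F (xu : R * p.-tuple (measurableTypeR R)) : \bar R :=
  ((b ord0 0 * xu.1 + (vdot b' (tuple_col xu.2) + c)) ^+ 2)%:E.
have FE x u : ((vdot b (tuple_col (cons_pair (x, u))) + c) ^+ 2)%:E = F (x, u).
  rewrite /F/= !vdotE big_ord_recl/= !mxE addrA; congr ((_ + _ + _) ^+ 2)%:E.
  by apply: eq_bigr => i _; rewrite !mxE tnthS.
under eq_integral do under eq_integral do rewrite FE.
have mF : measurable_fun setT F.
  apply/measurable_EFinP; apply: measurable_funX; apply: measurable_funD.
    by apply: measurable_funM => //; exact: measurable_fst.
  apply: measurable_funD => //; under eq_fun do rewrite vdotE.
  apply: measurable_sum => i; apply: measurable_funM => //.
  apply: (@measurableT_comp _ _ _ _ _ _ (fun u => tuple_col u i 0) _ snd) => //.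
  exact: (measurableT_comp (@measurable_mxcoord _ _ _ _ i 0) (@measurable_tuple_col R p)).
have F0 xu : (0 <= F xu)%E by rewrite lee_fin sqr_ge0.
rewrite [leRHS](@fubini_tonelli _ _ _ _ _ (@normal_prob R 0 1) (iid (@normal_prob R 0 1) p) F)//.
rewrite vdotE big_ord_recl/= -expr2 -addrA EFinD.
apply: (@le_trans _ _ ((b ord0 0 ^+ 2)%:E +
  \int[iid (@normal_prob R 0 1) p]_u ((vdot b' (tuple_col u) + c) ^+ 2)%:E)%E).
  rewrite leeD2l//; apply: le_trans (IH b' c); rewrite lee_fin lerD2r vdotE.
  by rewrite le_eqVlt; apply/orP; left; apply/eqP; apply: eq_bigr => i _; rewrite !mxE.
have -> : (b ord0 0 ^+ 2)%:E =
    (\int[iid (@normal_prob R 0 1) p]_u (cst (b ord0 0 ^+ 2)%:E u))%E.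
  by rewrite prob_integral_cst.
rewrite -ge0_integralD//; try first [by move=> x _; rewrite lee_fin sqr_ge0 | exact: mq].
apply: ge0_le_integral => //.
- by move=> u _; rewrite -EFinD lee_fin addr_ge0 ?sqr_ge0.
- by apply: emeasurable_funD => //; exact: mq.
- exact: measurable_fun_fubini_tonelli_G.
- by move=> u _; rewrite -EFinD; exact: integral_normal_affine_sqr_ge.
Qed.

(** * Gaussian vectors and convolution *)

Section psd_root.
Context (R : realType).

Lemma vdotC p (u v : 'cV[R]_p) : vdot u v = vdot v u.
Proof. by rewrite !vdotE; apply: eq_bigr => i _; rewrite mulrC. Qed.

Lemma vdot_mul p q (A : 'M[R]_(p, q)) u v : vdot u (A *m v) = vdot (A^T *m u) v.
Proof. by rewrite /vdot trmx_mul trmxK mulmxA. Qed.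

Lemma vdotDr p (u v w : 'cV[R]_p) : vdot u (v + w) = vdot u v + vdot u w.
Proof. by rewrite /vdot mulmxDr mxE. Qed.

Lemma vdotZr p (u v : 'cV[R]_p) a : vdot u (a *: v) = a * vdot u v.
Proof. by rewrite /vdot -scalemxAr mxE. Qed.

Lemma vdotBr p (u v w : 'cV[R]_p) : vdot u (v - w) = vdot u v - vdot u w.
Proof. by rewrite vdotDr -scaleN1r vdotZr mulN1r. Qed.

Let quad_block p (a : R) (c : 'cV[R]_p) (D : 'M[R]_p) (t : R) (w : 'cV[R]_p) :
  vdot (col_mx t%:M w : 'cV[R]_(1 + p)) (block_mx a%:M c^T c D *m col_mx t%:M w) =
  a * t ^+ 2 + 2 * t * vdot c w + vdot w (D *m w).
Proof.
rewrite mul_block_col {1}/vdot tr_col_mx mul_row_col mxE -!/(vdot _ _).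
have wc : vdot w (c *m t%:M) = t * vdot c w by rewrite mul_mx_scalar vdotZr vdotC.
rewrite (vdotDr w) wc vdotE big_ord1 !mxE -/(vdot c w) eqxx mulr1n.
rewrite big_ord1 !mxE eqxx !mulr1n.
have -> : \sum_j c^T ord0 j * w j 0 = vdot c w by rewrite /vdot mxE.
by ring.
Qed.

(** Cholesky factorization, by induction on the Schur complement of the first diagonal entry a. For
    a = 0 the first column vanishes, and the convention 0^-1 = 0 lets the same formulas cover this
    case. *)
Lemma psd_root p (S : 'M[R]_p) : positive_semidefinite S ->
  exists A : 'M[R]_p, A *m A^T = S.
Proof.
elim: p S => [|p IH] S [symS psdS].
  by exists 0; rewrite [RHS]flatmx0 [LHS]flatmx0.
pose S' : 'M[R]_(1 + p) := S.
pose a := S' 0 0; pose c := dlsubmx S'; pose D := drsubmx S'.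
have SE : S' = block_mx a%:M c^T c D.
  have ul : ulsubmx S' = a%:M.
    by apply/matrixP => i j; rewrite !ord1 !mxE eqxx mulr1n; congr (S' _ _); apply/val_inj.
  by rewrite -[LHS]submxK ul -/c -/D; congr block_mx; rewrite /c trmx_dlsub symS.
have q t w : 0 <= a * t ^+ 2 + 2 * t * vdot c w + vdot w (D *m w).
  by rewrite -quad_block -SE; exact: psdS.
have symD : D^T = D by rewrite /D trmx_drsub symS.
have a0 : 0 <= a.
  have := q 1 0; rewrite mulmx0 /vdot !mulmx0 mxE !mulr0 !addr0.
  by rewrite expr1n mulr1.
have ca w : a = 0 -> vdot c w = 0.
  move=> a_eq0; apply: contrapT => /eqP cw.
  (* For a = 0 the form is affine in t; this t gives it the value -1. *)
  have := q (- (vdot w (D *m w) + 1) / (2 * vdot c w)) w.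
  rewrite a_eq0 mul0r add0r.
  have -> : 2 * (- (vdot w (D *m w) + 1) / (2 * vdot c w)) * vdot c w = - (vdot w (D *m w) + 1).
    by field.
  by rewrite leNgt => /negP; apply; lra.
have [|A' A'E] := IH (D - a^-1 *: (c *m c^T)).
  split; first by rewrite linearB/= symD linearZ/= trmx_mul trmxK.
  (* For a > 0 this t minimizes the form, and the minimum is the quadratic form of the Schur
     complement at w. *)
  move=> w; have := q (- (a^-1 * vdot c w)) w.
  have -> : vdot w ((D - a^-1 *: (c *m c^T)) *m w) = vdot w (D *m w) - a^-1 * vdot c w ^+ 2.
    rewrite mulmxBl vdotBr -scalemxAl vdotZr -mulmxA (vdot_mul c).
    by rewrite [vdot (_ *m _) _]vdotE big_ord1 expr2.
  have [a_eq0|a_neq0] := eqVneq a 0.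
    by rewrite a_eq0 invr0 !mul0r subr0 oppr0 !(mulr0, mul0r) !add0r.
  rewrite (_ : a * _ + _ = - (a^-1 * vdot c w ^+ 2)); last by field.
  by rewrite addrC.
pose A : 'M[R]_(1 + p) := block_mx (Num.sqrt a)%:M 0 ((Num.sqrt a)^-1 *: c) A'.
suff AS : A *m A^T = S' by exists A.
rewrite SE /A (tr_block_mx (Num.sqrt a)%:M) mulmx_block.
rewrite tr_scalar_mx trmx0 !mul0mx !mulmx0 !addr0 -scalar_mxM -expr2 sqr_sqrtr//.
rewrite linearZ/= mul_mx_scalar mul_scalar_mx scalerA -scalemxAl -scalemxAr scalerA A'E.
have cE : (Num.sqrt a * (Num.sqrt a)^-1) *: c = c.
  have [a_eq0|a_neq0] := eqVneq a 0; last first.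
    by rewrite divff ?scale1r// sqrtr_eq0 -ltNge lt_neqAle eq_sym a_neq0.
  have -> : c = 0 :> 'cV_p; last by rewrite scaler0.
  apply/matrixP => i j; rewrite (ord1 j) [RHS]mxE.
  have := ca (delta_mx i 0) a_eq0; rewrite vdotE (bigD1 i)//= big1 => [|k ki]; last first.
    by rewrite [delta_mx _ _ _ _]mxE (negbTE ki) mulr0.
  by rewrite [delta_mx _ _ _ _]mxE !eqxx mulr1 addr0.
rewrite cE scalerA -invfM -expr2 sqr_sqrtr// [X in block_mx _ _ _ X]addrC subrK; congr block_mx.
by rewrite -linearZ/= cE.
Qed.

Lemma psd_unit_inv_root p (S : 'M[R]_p) : positive_semidefinite S -> S \in unitmx ->
  exists B : 'M[R]_p, B *m B^T = invmx S.
Proof.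
move=> /psd_root[A AS] uS.
have uA : A \in unitmx by move: uS; rewrite -AS unitmx_mul => /andP[].
have uAT : A^T \in unitmx by rewrite unitmx_tr.
exists (invmx A)^T; rewrite trmxK trmx_inv.
have E : invmx A^T *m invmx A *m S = 1%:M.
  by rewrite -AS mulmxA mulmxKV// mulVmx.
by rewrite -[LHS]mulmx1 -(mulmxV uS) mulmxA E mul1mx.
Qed.

(** In the coordinates h = B v the quadratic form of S becomes the squared norm of v, so that a
    standard normal v fits the quadratic term of the likelihood. *)
Lemma inv_root_whitening p (S B : 'M[R]_p) : S \in unitmx -> B *m B^T = invmx S ->
  B^T *m S *m B = 1%:M.
Proof. by move=> uS BS; apply: mulmx1C; rewrite mulmxA BS mulVmx. Qed.

End psd_root.

Lemma measurable_vdot (R : realType) p (u : 'cV[R]_p) : measurable_fun setT (vdot u).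
Proof.
rewrite (_ : vdot u = fun v => \sum_i u i 0 * v i 0); last first.
  by apply/funext => v; rewrite vdotE.
apply: measurable_sum => i; apply: measurable_funM => //.
exact: measurable_mxcoord.
Qed.

Lemma measurable_addmx (R : realType) p (m : 'cV[R]_p) : measurable_fun setT (fun x : 'cV[R]_p => x + m).
Proof.
apply: measurable_mxP => i j; under eq_fun do rewrite mxE.
by apply: measurable_funD => //; exact: measurable_mxcoord.
Qed.

Lemma ge0_integral_convolution (R : realType) p (mu nu : probability 'cV[R]_p R)
    (f : 'cV[R]_p -> \bar R) :
  measurable_fun setT f -> (forall x, 0 <= f x)%E ->
  (\int[convolution mu nu]_x f x = \int[nu]_y \int[mu]_x f (x + y)%R)%E.
Proof.
move=> mf f0; rewrite ge0_integral_distribution// fubini_tonelli2//.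
  by apply: (measurableT_comp mf); exact: measurable_add_pair.
by move=> xy; exact: f0.
Qed.

Section covariance_bound.
Context (R : realType) (p : nat) (S : 'M[R]_p) (M : probability 'cV[R]_p R).
Hypothesis rootS : exists B : 'M[R]_p, B *m B^T = S.
Local Notation L := (convolution (gaussian 0 S) M).

(** For each fixed value y of the [M] component, the Gaussian component alone contributes at least
    u.Su, whatever the centre. The centre c is left free so that the mean of u.x can be taken. *)
Let second_moment_ge (u : 'cV[R]_p) (c : R) :
  ((vdot u (S *m u))%:E <= \int[L]_x ((vdot u x - c) ^+ 2)%:E)%E.
Proof.
have mq a : measurable_fun setT (fun x => ((vdot u x + a) ^+ 2)%:E).
  by apply/measurable_EFinP; apply: measurable_funX; apply: measurable_funD => //; exact: measurable_vdot.
rewrite ge0_integral_convolution//; last by move=> x; rewrite lee_fin sqr_ge0.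
(* The root chosen inside [gaussian]; [rootS] ensures that it is a genuine root and not the default
   0. *)
set B := xget 0 [set A : 'M[R]_p | A *m A^T = S].
have BS : B *m B^T = S by exact: (@xgetPex _ 0 [set A : 'M[R]_p | A *m A^T = S]).
have -> : (vdot u (S *m u))%:E = (\int[M]_y (cst (vdot u (S *m u))%:E y))%E.
  by rewrite prob_integral_cst.
have uSu : vdot (B^T *m u) (B^T *m u) = vdot u (S *m u).
  by rewrite -BS -mulmxA (vdot_mul B).
apply: ge0_le_integral => //.
- by move=> y _; rewrite lee_fin -uSu vdotE; apply: sumr_ge0 => i _; rewrite -expr2 sqr_ge0.
- apply: (@measurable_fun_fubini_tonelli_G _ _ _ _ R (gaussian 0 S)
    (fun xy : 'cV[R]_p * 'cV[R]_p => ((vdot u (xy.1 + xy.2) - c) ^+ 2)%:E)).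
    by apply: (measurableT_comp (mq (- c))); exact: measurable_add_pair.
  by move=> xy; rewrite lee_fin sqr_ge0.
move=> y _ /=; rewrite ge0_integral_gaussian//; last 2 first.
- by apply: (measurableT_comp (mq (- c))); exact: measurable_addmx.
- by move=> x; rewrite lee_fin sqr_ge0.
rewrite -/B; apply: (@le_trans _ _ (\int[iid (@normal_prob R 0 1) p]_z
    ((vdot (B^T *m u) (tuple_col z) + (vdot u y - c)) ^+ 2)%:E)%E).
  apply: le_trans (integral_gaussian_affine_sqr_ge _ _).
  by rewrite lee_fin uSu lerDl sqr_ge0.
under eq_integral do rewrite -(vdot_mul B) addrA -vdotDr -[B *m _]add0r.
exact: lexx.
Qed.

Let mcoord i : measurable_fun setT (fun x : 'cV[R]_p => x i 0).
Proof. exact: measurable_mxcoord. Qed.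

(** The quadratic form of the covariance matrix at u is the variance of u.x, bounded below by
    [second_moment_ge]. Finite second moments make the products of centred coordinates integrable,
    which justifies expanding the square. *)
Lemma loewner_le_covariance_convolution :
  finite_second_moments L -> loewner_le S (covariance_mx L).
Proof.
move=> fsm.
have symS : S^T = S by case: rootS => B <-; rewrite trmx_mul trmxK.
split.
  rewrite linearB/= symS; congr (_ - _); apply/matrixP => i j.
  by rewrite !mxE covarianceC.
move=> u; rewrite mulmxBl vdotBr subr_ge0.
pose m i := fine ('E_L[fun x : 'cV[R]_p => x i ord0])%E.
pose Yc i (x : 'cV[R]_p) := x i 0 - m i.
have mY i : measurable_fun setT (Yc i) by apply: measurable_funB.
have iY2 i : L.-integrable setT (fun x => (Yc i x ^+ 2)%:E).
  apply: (@le_integrable _ _ _ _ _ measurableT _ (fun x : 'cV[R]_p => (2 * (x i 0) ^+ 2 + 2 * m i ^+ 2)%:E)) => //.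
  - by apply/measurable_EFinP; exact: measurable_funX.
  - move=> x _; have h1 := sqr_ge0 (x i 0); have h2 := sqr_ge0 (m i).
    have h3 := sqr_ge0 (x i 0 + m i); rewrite lee_fin ger0_norm ?sqr_ge0// ger0_norm; last by lra.
    by rewrite /Yc; move: h3; rewrite sqrrD sqrrB; lra.
  - under eq_fun do rewrite EFinD EFinM.
    apply: integrableD => //; last exact: finite_measure_integrable_cst.
    by apply: integrableZl => //; exact: fsm.
have iYY i j : L.-integrable setT (fun x => (Yc i x * Yc j x)%:E).
  apply: (@le_integrable _ _ _ _ _ measurableT _ (fun x : 'cV[R]_p => (Yc i x ^+ 2 + Yc j x ^+ 2)%:E)) => //.
  - by apply/measurable_EFinP; exact: measurable_funM.
  - move=> x _; rewrite lee_fin [leRHS]ger0_norm ?addr_ge0 ?sqr_ge0// ler_norml.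
    have h1 := sqr_ge0 (Yc i x + Yc j x); rewrite sqrrD in h1.
    have h2 := sqr_ge0 (Yc i x - Yc j x); rewrite sqrrB in h2.
    have h3 := sqr_ge0 (Yc i x); have h4 := sqr_ge0 (Yc j x).
    by apply/andP; split; lra.
  - by under eq_fun do rewrite EFinD; exact: integrableD.
have covE i j : (covariance_mx L i j)%:E = (\int[L]_x (Yc i x * Yc j x)%:E)%E.
  have e : covariance L (fun x => x i 0) (fun x => x j 0) = (\int[L]_x (Yc i x * Yc j x)%:E)%E.
    by rewrite covariance.unlock /Yc /m !expectation.unlock.
  by rewrite mxE e fineK//; exact: integrable_fin_num.
rewrite -lee_fin.
suff -> : (vdot u (covariance_mx L *m u))%:E =
    (\int[L]_x ((vdot u x - \sum_i u i 0 * m i) ^+ 2)%:E)%E by exact: second_moment_ge.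
transitivity (\sum_i \sum_j (u i 0 * u j 0)%:E * (covariance_mx L i j)%:E)%E.
  rewrite vdotE -sumEFin; apply: eq_bigr => i _; rewrite [(_ *m _) _ _]mxE mulr_sumr -sumEFin.
  by apply: eq_bigr => j _; rewrite -EFinM; congr EFin; ring.
pose h (x : 'cV[R]_p) : \bar R := (\sum_i \sum_j (u i ord0 * u j ord0)%:E * (Yc i x * Yc j x)%:E)%E.
transitivity (\int[L]_x h x)%E.
  rewrite /h.
  rewrite integral_sum//; last first.
    by move=> i; apply: integrable_sum => // j _; exact: integrableZl.
  apply: eq_bigr => i _; rewrite integral_sum//; last by move=> j; exact: integrableZl.
  by apply: eq_bigr => j _; rewrite integralZl// covE.
apply: eq_integral => x _.
have -> : vdot u x - \sum_i u i 0 * m i = \sum_i u i 0 * Yc i x.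
  by rewrite vdotE -sumrB; apply: eq_bigr => i _; rewrite mulrBr.
rewrite expr2 mulr_suml -sumEFin; apply: eq_bigr => i _; rewrite mulr_sumr -sumEFin.
by apply: eq_bigr => j _; rewrite -EFinM; congr EFin; ring.
Qed.

End covariance_bound.

(** * Joint limits and change of measure *)

Section continuity.
Context (R : realType).

Lemma continuous_coord m n i j : continuous (fun x : 'M[R]_(m, n) => x i j).
Proof. exact: coord_continuous. Qed.

Lemma continuous_vdot p (u : 'cV[R]_p) : continuous (vdot u).
Proof.
rewrite (_ : vdot u = fun v => \sum_i u i 0 * v i 0); last first.
  by apply/funext => v; rewrite vdotE.
apply: (@continuous_big R 'I_p +%R 0 xpredT add_continuous 'cV[R]_p).
move=> i _ v; have vF : Filter (nbhs v) by exact: nbhs_filter.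
apply: cvgM; first exact: cvg_cst.
exact: continuous_coord.
Qed.

Lemma continuous_usubmx p q (h : 'cV[R]_p) : continuous (fun x : 'cV[R]_(p + q) => usubmx x - h).
Proof.
apply: continuous_mx => i j x; rewrite /continuous_at.
have xF : Filter (nbhs x) by exact: nbhs_filter.
under eq_fun do rewrite !mxE.
rewrite !mxE; apply: cvgB; last exact: cvg_cst.
exact: continuous_coord.
Qed.

Lemma continuous_dsubmx p q : continuous (fun x : 'cV[R]_(p + q) => dsubmx x).
Proof.
apply: continuous_mx => i j x; rewrite /continuous_at.
under eq_fun do rewrite !mxE.
rewrite !mxE; exact: continuous_coord.
Qed.

End continuity.

(** * Tightness from convergence in distribution *)

Section tightness.
Context (R : realType).

Lemma lipschitz_norm_coord m n i j : lipschitz_fun (fun x : 'M[R]_(m, n) => `|x i j|).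
Proof.
have [K HK] := lipschitz_coord R i j; exists K => x y.
exact: (le_trans (ler_dist_dist _ _)).
Qed.

Lemma measurable_tail p (i : 'I_p) (C : R) : measurable [set x : 'cV[R]_p | C < `|x i 0|].
Proof.
have := lipschitz_measurable (@lipschitz_norm_coord p 1 i 0).
move=> /(_ measurableT `]C, +oo[%classic (measurable_itv _)); rewrite setTI.
by congr measurable; apply/seteqP; split => x /=; rewrite in_itv/= andbT.
Qed.

Lemma prob_tail p (L : probability 'cV[R]_p R) (i : 'I_p) (e : R) : 0 < e ->
  exists C : R, (L [set x | C < `|x i ord0|]%R <= e%:E)%E.
Proof.
move=> e0; pose F (k : nat) : set 'cV[R]_p := [set x | k%:R < `|x i 0|].
have : L (F k) @[k --> \oo] --> L (\bigcap_k F k).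
  apply: nonincreasing_cvg_mu => //.
  - by rewrite (le_lt_trans (probability_le1 _ _)) ?ltry//; exact: measurable_tail.
  - by move=> k; exact: measurable_tail.
  - by apply: bigcap_measurable => // k _; exact: measurable_tail.
  - move=> k l kl; apply/subsetPset => x; rewrite /F/=; apply: le_lt_trans.
    by rewrite ler_nat.
have -> : \bigcap_k F k = set0.
  apply/seteqP; split => x // Fx.
  have := Fx (Num.bound (`|x i 0|)) I; rewrite /F/= => h.
  by have := archi_boundP (normr_ge0 (x i 0)) => /(lt_trans h); rewrite ltxx.
rewrite measure0 => /fine_cvgP[_ /cvgrPdist_le/(_ _ e0)].
move=> [k _ /(_ k (leqnn _))] /=; rewrite sub0r normrN => h.
exists k%:R; rewrite -lee_fin in h.
apply: le_trans h; rewrite ger0_norm ?fine_ge0// fineK// fin_num_measure//.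
exact: measurable_tail.
Qed.

(** A Lipschitz function squeezed between the indicators of the tails beyond C + 1 and beyond C; the
    form [1 * _ + - C] is that of [lipschitz_clip]. *)
Definition tail_ramp p (i : 'I_p) (C : R) (x : 'cV[R]_p) := Num.min 1 (Num.max 0 (1 * `|x i 0| + - C)).

Lemma tail_ramp_lipschitz p i C : lipschitz_fun (@tail_ramp p i C).
Proof. exact: (lipschitz_clip 1 (- C) (lipschitz_norm_coord i 0)). Qed.

Lemma clip01 (a : R) : 0 <= Num.min 1 (Num.max 0 a) <= 1.
Proof. by rewrite le_min ler01 le_max lexx/= ge_min lexx. Qed.

Lemma tail_ramp_le p (L : probability 'cV[R]_p R) i C :
  (\int[L]_x (tail_ramp i C x)%:E <= L [set x | C < `|x i 0|]%R)%E.
Proof.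
rewrite -[X in L X]setIT -integral_indic//; last exact: measurable_tail.
apply: ge0_le_integral => //.
- by move=> x _; rewrite lee_fin; case/andP: (clip01 (1 * `|x i 0| + - C)).
- apply/measurable_EFinP; apply: lipschitz_measurable; exact: tail_ramp_lipschitz.
- by apply/measurable_EFinP; apply: measurable_indic; exact: measurable_tail.
move=> x _; rewrite lee_fin indicE /tail_ramp mul1r.
have [xC|xC] := ltP C `|x i 0|; first by rewrite mem_set// ge_min lexx.
rewrite memNset/=; last by apply/negP; rewrite -leNgt.
by rewrite max_l ?subr_le0// min_r.
Qed.

Lemma tail_le_ramp d (T : measurableType d) p (P : probability T R) (X : {mfun T >-> 'cV[R]_p}) i C :
  (P (X @^-1` [set x | C + 1 < `|x i 0|]%R) <= \int[P]_w (tail_ramp i C (X w))%:E)%E.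
Proof.
have mT : measurable (X @^-1` [set x | C + 1 < `|x i 0|]%R).
  by rewrite -[X in measurable X]setTI; apply: measurable_funPT => //; exact: measurable_tail.
rewrite -[X in P X]setIT -integral_indic//.
apply: ge0_le_integral => //.
- by apply/measurable_EFinP; exact: measurable_indic.
- apply/measurable_EFinP; apply: measurableT_comp => //.
  by apply: lipschitz_measurable; exact: tail_ramp_lipschitz.
move=> w _; rewrite lee_fin indicE /tail_ramp mul1r.
have [xC|xC] := boolP (w \in _).
  move: xC; rewrite inE/= -ltrBrDl => /ltW xC.
  by rewrite max_r ?min_l// (le_trans ler01).
by case/andP: (clip01 (`|X w i 0| - C)).
Qed.

End tightness.

Section joint_limit.
Context (R : realType) (p : nat) d (Om : nat -> measurableType d).
Context (P : forall n, probability (Om n) R).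

Lemma cvg_in_distribution_fine (X : forall n, Om n -> 'cV[R]_p) (L : probability 'cV[R]_p R) :
  cvg_in_distribution P X L ->
  forall f : 'cV[R]_p -> R, continuous f -> (forall x, 0 <= f x <= 1) ->
  fine (\int[P n]_w (f (X n w))%:E)%E @[n --> \oo] --> fine (\int[L]_x (f x)%:E)%E.
Proof.
move=> cX f cf f01; have := cX f cf.
have fb : exists C : R, forall x, `|f x| <= C.
  by exists 1 => x; rewrite ger0_norm; case/andP: (f01 x).
move=> /(_ fb); rewrite expectation.unlock.
have mf := continuous_measurable_mx cf.
rewrite -[X in _ --> X]fineK ?(prob_integral_fin_num _ mf f01)//.
by move=> /fine_cvgP[].
Qed.

(** The tail of [X n] beyond C + 1 is at most the mean of the ramp, which tends to its mean under L,
    itself at most the L-tail beyond C. Taking e / 2 for L leaves room for a strict inequality. *)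
Lemma tight_of_cvg (X : forall n, {mfun Om n >-> 'cV[R]_p}) (L : probability 'cV[R]_p R) :
  cvg_in_distribution P (fun n => X n) L ->
  forall i (e : R), 0 < e -> exists C : R,
    \forall n \near \oo, (P n (X n @^-1` [set x | C < `|x i ord0|]%R) <= e%:E)%E.
Proof.
move=> cX i e e0; have e2 : 0 < e / 2 by rewrite divr_gt0.
have [C LC] := prob_tail L i e2; exists (C + 1).
have lf := @tail_ramp_lipschitz R p i C.
have f01 x : 0 <= tail_ramp i C x <= 1 by exact: clip01.
have mf := lipschitz_measurable lf.
have cf : continuous (tail_ramp i C) by have [K] := lf; exact: lipschitz_mx_continuous.
have := cvg_in_distribution_fine cX cf f01.
have fL : fine (\int[L]_x (tail_ramp i C x)%:E)%E < e.
  apply: (@le_lt_trans _ _ (e / 2)); last by rewrite ltr_pdivrMr// ltr_pMr// ltr1n.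
  by rewrite -lee_fin fineK ?(prob_integral_fin_num _ mf f01)// (le_trans (tail_ramp_le L i C)).
move=> /cvgr_lt/(_ _ fL); apply: filterS => n /ltW h.
apply: (le_trans (tail_le_ramp _ _ i C)).
have mfX : measurable_fun setT (fun w => tail_ramp i C (X n w)) by exact: measurableT_comp.
have fX01 w : 0 <= tail_ramp i C (X n w) <= 1 by exact: clip01.
by rewrite -[leLHS]fineK ?(prob_integral_fin_num _ mfX fX01).
Qed.

Variables (S D : forall n, {mfun Om n >-> 'cV[R]_p}).

Definition joint n (w : Om n) : 'cV[R]_(p + p) := col_mx (S n w) (D n w).

Lemma measurable_joint n : measurable_fun setT (@joint n).
Proof.
apply: measurable_mxP => i j.
case: (split_ordP i) => k ->.
  rewrite (_ : (fun _ => _) = fun w => S n w k j); last by apply/funext => w; rewrite /joint col_mxEu.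
  exact: (measurableT_comp (@measurable_mxcoord _ _ _ _ k j)).
rewrite (_ : (fun _ => _) = fun w => D n w k j); last by apply/funext => w; rewrite /joint col_mxEd.
exact: (measurableT_comp (@measurable_mxcoord _ _ _ _ k j)).
Qed.

HB.instance Definition _ n := isMeasurableFun.Build _ _ _ _ (@joint n) (@measurable_joint n).

(** Tightness is a condition on single coordinates, so that of the two marginals gives that of the
    pair; stacking the pair into one vector makes [prohorov] applicable. *)
Lemma joint_limit (L G : probability 'cV[R]_p R) :
  cvg_in_distribution P (fun n => S n) L -> cvg_in_distribution P (fun n => D n) G ->
  exists J : probability 'cV[R]_(p + p) R,
  forall f : 'cV[R]_(p + p) -> R, continuous f -> (forall x, 0 <= f x <= 1) ->
  fine (\int[P n]_w (f (joint w))%:E)%E @[n --> U] --> fine (\int[J]_x (f x)%:E)%E.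
Proof.
move=> cS cD.
have [|J HJ] := @prohorov R (p + p) (fun n => distribution (P n) (@joint n)).
  move=> i e e0; case: (split_ordP i) => k ->.
    have [C HC] := tight_of_cvg cS k e0; exists C; apply: filterS HC => n.
    rewrite /distribution /pushforward/=; congr (P n _ <= _)%E.
    by apply/seteqP; split => w /=; rewrite /joint col_mxEu.
  have [C HC] := tight_of_cvg cD k e0; exists C; apply: filterS HC => n.
  rewrite /distribution /pushforward/=; congr (P n _ <= _)%E.
  by apply/seteqP; split => w /=; rewrite /joint col_mxEd.
exists J => f cf f01; have := HJ f cf f01.
have mf := continuous_measurable_mx cf.
have E n : (\int[distribution (P n) (@joint n)]_x (f x)%:E = \int[P n]_w (f (joint w))%:E)%E.
  rewrite ge0_integral_distribution//; first exact/measurable_EFinP.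
  by move=> x; rewrite lee_fin; case/andP: (f01 x).
by under eq_fun do rewrite E.
Qed.

End joint_limit.

(** Trades the logarithm for bounds on the ratio itself, from which both the measurability of the
    exceptional set and the lower bound on [Lr] follow. At l = 0 and at infinity both sides are
    false. *)
Lemma abse_lne_lt (R : realType) (l : \bar R) (a eps : R) : (0 <= l)%E ->
  (`|lne l - a%:E| < eps%:E)%E = ((expR (a - eps))%:E < l < (expR (a + eps))%:E)%E.
Proof.
case: l => [r| |]//= r0; last by rewrite ltNge leey andbF.
rewrite !lte_fin; have [rn|rp] := leP r 0 => /=.
  by rewrite ltNge leey (ltNge (expR _) r) (le_trans rn) ?expR_ge0.
by rewrite lte_fin ltr_distl -[_ - _ < _]ltr_expR -[ln r < _]ltr_expR lnK.
Qed.

Lemma measurable_usubmxB (R : realType) p q (h : 'cV[R]_p) :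
  measurable_fun setT (fun x : 'cV[R]_(p + q) => usubmx x - h).
Proof.
apply: measurable_mxP => i j; under eq_fun do rewrite !mxE.
by apply: measurable_funB => //; exact: measurable_mxcoord.
Qed.

(** * Le Cam's third lemma as a one-sided bound *)

Section lecam.
Context (R : realType) (p : nat) d (Om : nat -> measurableType d).
Context (P Q : forall n, probability (Om n) R) (S D : forall n, {mfun Om n >-> 'cV[R]_p}).
Context (L : probability 'cV[R]_p R) (J : probability 'cV[R]_(p + p) R).
Context (h : 'cV[R]_p) (c : R) (Lr : forall n, Om n -> \bar R).
Hypothesis cJ : forall f : 'cV[R]_(p + p) -> R, continuous f -> (forall x, 0 <= f x <= 1) ->
  fine (\int[P n]_w (f (joint S D w))%:E)%E @[n --> U] --> fine (\int[J]_x (f x)%:E)%E.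
Hypothesis cQ : cvg_in_distribution Q (fun n w => S n w - h) L.
Hypothesis lr : forall n, likelihood_ratio (Q n) (P n) (@Lr n).
Hypothesis lan : forall eps : R, 0 < eps ->
  P n [set w | (eps%:E <= `|lne (@Lr n w) - (vdot h (D n w) - c)%:E|)%E] @[n --> \oo] --> 0%E.

Let bad eps n : set (Om n) := [set w | (eps%:E <= `|lne (@Lr n w) - (vdot h (D n w) - c)%:E|)%E].

Let mLr n : measurable_fun setT (@Lr n).
Proof. by have [] := lr n. Qed.

Let mbad eps n : measurable (@bad eps n).
Proof.
have [_ Lr0 _] := lr n.
have ma e : measurable_fun setT (fun w => (expR (vdot h (D n w) - c + e))%:E).
  apply/measurable_EFinP; apply: measurableT_comp => //; apply: measurable_funD => //.
  apply: measurable_funB => //.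
  exact: (measurableT_comp (measurable_vdot h)).
have -> : @bad eps n = ~` ([set w | (expR (vdot h (D n w) - c - eps))%:E < Lr w] `&`
    [set w | Lr w < (expR (vdot h (D n w) - c + eps))%:E])%E.
  apply/seteqP; split => w; rewrite /bad/=.
    by move=> hw [h1 h2]; have := @abse_lne_lt R (Lr w) (vdot h (D n w) - c) eps (Lr0 w);
      rewrite h1 h2 ltNge hw.
  move=> hw; rewrite leNgt abse_lne_lt//; apply/negP => /andP[h1 h2]; exact: hw.
apply: measurableC; apply: measurableI.
  by rewrite -[X in measurable X]setTI; apply: measurable_lte.
by rewrite -[X in measurable X]setTI; apply: measurable_lte.
Qed.

(** The limit likelihood ratio, truncated at K: the convergence to J is available for bounded
    continuous functions only. *)
Let tilt (K : R) (x : 'cV[R]_(p + p)) : R := Num.min (expR (vdot h (dsubmx x) - c)) K.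

Let continuous_tilt K : continuous (tilt K).
Proof.
have ce : continuous (fun x : 'cV[R]_(p + p) => expR (vdot h (dsubmx x) - c)).
  move=> x; apply: (@continuous_comp _ _ _ (fun x : 'cV[R]_(p + p) => vdot h (dsubmx x) - c) expR).
    have xF : Filter (nbhs x) by exact: nbhs_filter.
    apply: cvgB; last exact: cvg_cst.
    exact: (continuous_comp (@continuous_dsubmx R p p x) (@continuous_vdot R p h _)).
  exact: continuous_expR.
move=> x; have xF : Filter (nbhs x) by exact: nbhs_filter.
rewrite /continuous_at /tilt; under eq_fun do rewrite minr_absE.
rewrite minr_absE; apply: cvgM; last exact: cvg_cst.
apply: cvgB; first by apply: cvgD; [exact: ce|exact: cvg_cst].
by apply: cvg_norm; apply: cvgB; [exact: ce|exact: cvg_cst].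
Qed.

(** Off the exceptional set, [Lr] exceeds e^-eps times the limit ratio; on it, the truncation level
    K pays for the left side. *)
Let lecam_pointwise (K eps : R) n w (y : R) : 0 <= y <= 1 -> 0 < K -> 0 < eps ->
  (((expR (- eps) * (y * tilt K (joint S D w)))%:E <=
   y%:E * Lr w + (K * \1_(@bad eps n) w)%:E)%E).
Proof.
move=> /andP[y0 y1] K0 eps0; have [_ Lr0 _] := lr n.
have e1 : expR (- eps) <= 1 by rewrite -expR0 ler_expR oppr_le0 ltW.
have t0 : 0 <= tilt K (joint S D w) by rewrite le_min expR_ge0 ltW.
have [wb|wb] := pselect (@bad eps n w).
  rewrite indicE mem_set// mulr1.
  apply: (@le_trans _ _ K%:E); last by rewrite leeDr// mule_ge0.
  rewrite lee_fin (@le_trans _ _ (tilt K (joint S D w)))//; last by rewrite ge_min lexx orbT.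
  by rewrite mulrA ler_piMl// mulr_ile1 ?expR_ge0.
rewrite indicE memNset// mulr0 adde0.
move: wb => /negP; rewrite -ltNge abse_lne_lt// => /andP[/ltW h1 _].
rewrite /tilt /joint col_mxKd; set a := vdot h _ - c in h1 *.
apply: (@le_trans _ _ (y%:E * (expR (a - eps))%:E)%E); last by rewrite lee_wpmul2l.
rewrite -EFinM lee_fin mulrCA; apply: ler_wpM2l => //; rewrite (addrC a) (expRD (- eps)).
apply: ler_wpM2l; first exact: expR_ge0.
by rewrite ge_min lexx.
Qed.

(** With K and eps fixed, the exceptional set costs K times a probability that tends to 0, and every
    other term converges along the ultrafilter. *)
Let lecam_bound (f : 'cV[R]_p -> R) (K eps : R) : continuous f ->
  (forall x, 0 <= f x <= 1) -> 0 < K -> 0 < eps ->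
  ((expR (- eps))%:E * \int[J]_x (f (usubmx x - h) * tilt K x)%:E <= \int[L]_x (f x)%:E)%E.
Proof.
move=> cf f01 K0 eps0; have Kn0 : K != 0 by rewrite gt_eqF.
have mf := continuous_measurable_mx cf.
have t0 x : 0 <= tilt K x <= K by rewrite le_min expR_ge0 (ltW K0) ge_min lexx orbT.
have ct := @continuous_tilt K.
(* Division by K brings the function into [0, 1], as [cJ] requires. *)
pose g x := K^-1 * (f (usubmx x - h) * tilt K x).
have cg : continuous g.
  move=> x; have xF : Filter (nbhs x) by exact: nbhs_filter.
  apply: cvgM; first exact: cvg_cst.
  by apply: cvgM; [exact: (continuous_comp (@continuous_usubmx R p p h x) (cf _))|exact: ct].
have g01 x : 0 <= g x <= 1.
  have /andP[f0 f1] := f01 (usubmx x - h); have /andP[h0 h1] := t0 x.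
  rewrite /g !mulr_ge0 ?invr_ge0 ?(ltW K0)//= ler_pdivrMl// mulr1.
  by rewrite (le_trans _ h1)// ler_piMl.
have mg := continuous_measurable_mx cg.
have cgJ := cJ cg g01.
have cfL := cvg_in_distribution_fine cQ cf f01.
pose b n := fine (P n (@bad eps n)).
have cb : b n @[n --> \oo] --> 0.
  by have := lan eps0 => /fine_cvgP[].
have mSh n : measurable_fun setT (fun w : Om n => f (S n w - h)).
  by apply: (measurableT_comp mf); exact: (measurableT_comp (@measurable_addmx R p (- h))).
have mgj n : measurable_fun setT (fun w : Om n => g (joint S D w)).
  exact: (measurableT_comp mg).
have main n : expR (- eps) * K * fine (\int[P n]_w (g (joint S D w))%:E)%E <=
    fine (\int[Q n]_w (f (S n w - h))%:E)%E + K * b n.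
  have [_ Lr0 [N [mN PN QE]]] := lr n.
  have fS01 (w : Om n) : 0 <= f (S n w - h) <= 1 by exact: f01.
  have gj01 (w : Om n) : 0 <= g (joint S D w) <= 1 by exact: g01.
  rewrite -lee_fin EFinD !EFinM !fineK ?(prob_integral_fin_num _ (mSh n) fS01)
    ?(prob_integral_fin_num _ (mgj n) gj01) ?fin_num_measure//; last exact: mbad.
  rewrite -EFinM -ge0_integralZl_EFin ?mulr_ge0 ?expR_ge0 ?(ltW K0)//; last 2 first.
  - by move=> w _; rewrite lee_fin; case/andP: (gj01 w).
  - exact/measurable_EFinP.
  apply: (@le_trans _ _ (\int[P n]_w ((f (S n w - h))%:E * Lr w + (K * \1_(@bad eps n) w)%:E))%E).
    apply: ge0_le_integral => //.
    - move=> w _; apply: mule_ge0; rewrite lee_fin; last by case/andP: (gj01 w).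
      by rewrite mulr_ge0 ?expR_ge0 ?(ltW K0).
    - by apply: emeasurable_funM => //; exact/measurable_EFinP.
    - apply: emeasurable_funD; first by apply: emeasurable_funM => //; exact/measurable_EFinP.
      by apply/measurable_EFinP; apply: measurable_funM => //; exact: measurable_indic.
    move=> w _; have := @lecam_pointwise K eps n w (f (S n w - h)) (f01 _) K0 eps0.
    rewrite -EFinM /g -mulrA (mulrA K) divff// mul1r.
    by rewrite [X in usubmx X]/joint col_mxKu.
  rewrite ge0_integralD//; last 4 first.
  - by move=> w _; rewrite mule_ge0// lee_fin; case/andP: (fS01 w).
  - by apply: emeasurable_funM => //; exact/measurable_EFinP.
  - by move=> w _; rewrite lee_fin mulr_ge0// ltW.
  - by apply/measurable_EFinP; apply: measurable_funM => //; exact: measurable_indic.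
  apply: leeD.
    (* Dropping the singular mass on [N] leaves the integral of [Lr] over A at most Q n A. *)
    apply: (@ge0_le_integral_density _ _ _ (P n) (Q n) (@Lr n)) => //.
    - by move=> A mA; rewrite [leRHS](QE A mA) leeDl.
    - exact/measurable_EFinP.
    - by move=> w; rewrite lee_fin; case/andP: (fS01 w).
  under eq_integral do rewrite EFinM.
  rewrite ge0_integralZl_EFin ?(ltW K0)//; last first.
    by apply/measurable_EFinP; exact: measurable_indic.
  by rewrite integral_indic ?setIT//; exact: mbad.
have lim1 : expR (- eps) * K * fine (\int[P n]_w (g (joint S D w))%:E)%E @[n --> U] -->
    expR (- eps) * K * fine (\int[J]_x (g x)%:E)%E.
  by apply: cvgM; [exact: cvg_cst|exact: cgJ].
have lim2 : fine (\int[Q n]_w (f (S n w - h))%:E)%E + K * b n @[n --> U] -->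
    fine (\int[L]_x (f x)%:E)%E.
  rewrite -[X in _ --> X]addr0 -[X in _ + X](mulr0 K).
  apply: cvgD.
    by move=> A /cfL; exact: free_ultra_eventually.
  apply: cvgM; first exact: cvg_cst.
  by move=> A /cb; exact: free_ultra_eventually.
have H : expR (- eps) * K * fine (\int[J]_x (g x)%:E)%E <= fine (\int[L]_x (f x)%:E)%E.
  by apply: (ler_cvg_to lim1 lim2); exact: filterE.
move: H; rewrite -lee_fin EFinM !fineK ?(prob_integral_fin_num _ mg g01) ?(prob_integral_fin_num _ mf f01)//.
move=> H; apply: le_trans H; rewrite EFinM -muleA; apply: lee_wpmul2l; first by rewrite lee_fin expR_ge0.
rewrite -ge0_integralZl_EFin ?(ltW K0)//; last 2 first.
- by move=> x _; rewrite lee_fin; case/andP: (g01 x).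
- exact/measurable_EFinP.
under [leRHS]eq_integral do rewrite -EFinM /g mulrA divff// mul1r.
exact: lexx.
Qed.

(* One inequality suffices: both sides are probabilities, so applying it to
   1 - f turns it into an equality. *)
Lemma lecam (f : 'cV[R]_p -> R) : continuous f -> (forall x, 0 <= f x <= 1) ->
  (\int[J]_x (f (usubmx x - h) * expR (vdot h (dsubmx x) - c))%:E <= \int[L]_x (f x)%:E)%E.
Proof.
move=> cf f01.
have mf := continuous_measurable_mx cf.
have f0 x : 0 <= f (usubmx x - h) by case/andP: (f01 (usubmx x - h)).
have mg K : measurable_fun setT (fun x : 'cV[R]_(p + p) => f (usubmx x - h) * tilt K x).
  apply: measurable_funM; last exact: continuous_measurable_mx (@continuous_tilt K).
  apply: (measurableT_comp mf); exact: (measurable_usubmxB h).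
have bK (K : R) : 0 < K ->
    (\int[J]_x (f (usubmx x - h) * tilt K x)%:E <= \int[L]_x (f x)%:E)%E.
  move=> K0; have g0K x : 0 <= f (usubmx x - h) * tilt K x <= K.
    have /andP[_ f1] := f01 (usubmx x - h).
    have t0 : 0 <= tilt K x by rewrite le_min expR_ge0 ltW.
    rewrite mulr_ge0//= (le_trans (ler_piMl t0 f1))// ge_min lexx orbT//.
  have := fun eps => @lecam_bound f K eps cf f01 K0.
  have := prob_integral_fin_num L mf f01; have := prob_integral_fin_num J (mg K) g0K.
  have : (0 <= \int[L]_x (f x)%:E)%E.
    by apply: integral_ge0 => x _; rewrite lee_fin; case/andP: (f01 x).
  case: (\int[L]_x _)%E => [b| |]//; case: (\int[J]_x _)%E => [a| |]//; rewrite !lee_fin => b0 _ _ H.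
  rewrite leNgt; apply/negP => ba; have a0 : 0 < a by exact: le_lt_trans ba.
  (* If a > b, this eps gives e^-eps a >= (1 - eps) a = (a + b) / 2 > b, a contradiction. *)
  have e0 : 0 < (a - b) / (2 * a) by rewrite divr_gt0 ?subr_gt0// mulr_gt0.
  have := H _ e0; rewrite -EFinM lee_fin leNgt => /negP; apply.
  apply: (@lt_le_trans _ _ ((1 - (a - b) / (2 * a)) * a)); last first.
    by rewrite ler_wpM2r ?(ltW a0)// expR_ge1Dx.
  rewrite mulrBl mul1r (_ : (a - b) / (2 * a) * a = (a - b) / 2); first by lra.
  by field; exact: lt0r_neq0.
have cv : (\int[J]_x (f (usubmx x - h) * tilt n.+1%:R x)%:E)%E @[n --> \oo] -->
   (\int[J]_x (f (usubmx x - h) * expR (vdot h (dsubmx x) - c))%:E)%E.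
  have := @cvg_monotone_convergence _ _ _ J setT measurableT
    (fun n x => (f (usubmx x - h) * tilt n.+1%:R x)%:E).
  have -> : (\int[J]_x (limn (fun n => (f (usubmx x - h) * tilt n.+1%:R x)%:E)) =
      \int[J]_x (f (usubmx x - h) * expR (vdot h (dsubmx x) - c))%:E)%E.
    apply: eq_integral => x _; apply/cvg_lim => //; apply: cvg_near_cst.
    near=> n; congr (_ * _)%:E; rewrite /tilt min_l//.
    apply: (@le_trans _ _ n%:R); last by rewrite ler_nat.
    near: n; exact: nbhs_infty_ger.
  apply.
  - by move=> n; exact/measurable_EFinP.
  - move=> n x _; have t0 : 0 <= tilt n.+1%:R x by rewrite le_min expR_ge0/= ler0n.
    by rewrite lee_fin mulr_ge0.
  - move=> x _ n k nk; rewrite lee_fin ler_wpM2l// /tilt le_min ge_min lexx/=.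
    by rewrite ge_min ler_nat ltnS nk orbT.
rewrite -(cvg_lim _ cv)//; apply: lime_le; first by apply/cvg_ex; eexists; exact: cv.
by apply: nearW => n; exact: bK.
Unshelve. all: by end_near. Qed.

End lecam.

Section measurable_linear.
Context (R : realType) d (T : measurableType d).

Lemma measurable_addmx2 m n (f g : T -> 'M[R]_(m, n)) : measurable_fun setT f ->
  measurable_fun setT g -> measurable_fun setT (fun x => f x + g x).
Proof.
move=> mf mg; apply: measurable_mxP => i j; under eq_fun do rewrite mxE.
by apply: measurable_funD; apply: (measurableT_comp (@measurable_mxcoord _ _ _ _ i j)).
Qed.

Lemma measurable_scalemx m n (a : R) (f : T -> 'M[R]_(m, n)) : measurable_fun setT f ->
  measurable_fun setT (fun x => a *: f x).
Proof.
move=> mf; apply: measurable_mxP => i j; under eq_fun do rewrite mxE.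
by apply: measurable_funM => //; apply: (measurableT_comp (@measurable_mxcoord _ _ _ _ i j)).
Qed.

Lemma measurable_mulmx m n q (B : 'M[R]_(m, n)) (f : T -> 'M[R]_(n, q)) : measurable_fun setT f ->
  measurable_fun setT (fun x => B *m f x).
Proof.
move=> mf; apply: measurable_mxP => i j; under eq_fun do rewrite mxE.
apply: measurable_sum => k; apply: measurable_funM => //.
by apply: (measurableT_comp (@measurable_mxcoord _ _ _ _ k j)).
Qed.

Lemma measurable_vdot2 p (f g : T -> 'cV[R]_p) : measurable_fun setT f ->
  measurable_fun setT g -> measurable_fun setT (fun x => vdot (f x) (g x)).
Proof.
move=> mf mg; under eq_fun do rewrite vdotE.
by apply: measurable_sum => k; apply: measurable_funM;
  apply: (measurableT_comp (@measurable_mxcoord _ _ _ _ k 0)).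
Qed.

End measurable_linear.

Lemma measurable_usubmx (R : realType) p q : measurable_fun setT (fun x : 'cV[R]_(p + q) => usubmx x).
Proof.
by apply: measurable_mxP => i j; under eq_fun do rewrite !mxE; exact: measurable_mxcoord.
Qed.

Lemma measurable_dsubmx (R : realType) p q : measurable_fun setT (fun x : 'cV[R]_(p + q) => dsubmx x).
Proof.
by apply: measurable_mxP => i j; under eq_fun do rewrite !mxE; exact: measurable_mxcoord.
Qed.

(** The limit likelihood ratio integrates to one: this is what later turns the one-sided bounds into
    equalities. A root A of S reduces it to the standard case at A^T h. *)
Lemma integral_gaussian_mgf (R : realType) p (S : 'M[R]_p) (h : 'cV[R]_p) :
  positive_semidefinite S ->
  (\int[gaussian 0 S]_x (expR (vdot h x - 2^-1 * vdot h (S *m h)))%:E = 1)%E.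
Proof.
move=> /psd_root[A0 A0S]; rewrite ge0_integral_gaussian; last 2 first.
- apply/measurable_EFinP; apply: measurableT_comp => //; apply: measurable_funB => //.
  exact: measurable_vdot.
- by move=> x; rewrite lee_fin expR_ge0.
set A := xget 0 _.
have AS : A *m A^T = S by rewrite /A; apply: (@xgetPex _ 0 [set A : 'M[R]_p | A *m A^T = S]); exists A0.
rewrite -[RHS](integral_gaussian_expR (A^T *m h)); apply: eq_integral => z _.
by rewrite add0r -AS -mulmxA !(vdot_mul A).
Qed.

(** * Averaging over shifts *)

Section posterior_mixture.
Context (R : realType) (p : nat) (FI : 'M[R]_p).
Hypotheses (psdFI : positive_semidefinite FI) (unitFI : FI \in unitmx).
Context (L : probability 'cV[R]_p R) (J : probability 'cV[R]_(p + p) R).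
Hypothesis HJ : forall (h : 'cV[R]_p) (f : 'cV[R]_p -> R), lipschitz_fun f ->
  (forall x, 0 <= f x <= 1) ->
  (\int[J]_x (f (usubmx x - h) * expR (vdot h (dsubmx x) - 2^-1 * vdot h (FI *m h)))%:E
   <= \int[L]_x (f x)%:E)%E.
Hypothesis mgfJ : forall h : 'cV[R]_p,
  (\int[J]_x (expR (vdot h (dsubmx x) - 2^-1 * vdot h (FI *m h)))%:E = 1)%E.
Local Notation Np := (iid (@normal_prob R 0 1) p).

Let B : 'M[R]_p := xget 0 [set A : 'M[R]_p | A *m A^T = invmx FI].

Let BFI : B *m B^T = invmx FI.
Proof.
have [B0 B0E] := psd_unit_inv_root psdFI unitFI.
by apply: (@xgetPex _ 0 [set A : 'M[R]_p | A *m A^T = invmx FI]); exists B0.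
Qed.

Context (s : R).
Hypotheses (s0 : 0 < s) (s1 : s < 1).

(** Solves s = tau / sqrt(1 + tau^2) for tau; r = 1 / sqrt(1 + tau^2) is the posterior standard
    deviation of each coordinate of v. *)
Let r := Num.sqrt (1 - s ^+ 2).
Let tau := s / r.

Let r0 : 0 < r.
Proof. by rewrite sqrtr_gt0 subr_gt0 expr_lt1 ?(ltW s0). Qed.

Let rtau : r ^+ 2 * (1 + tau ^+ 2) = 1.
Proof.
rewrite mulrDr mulr1 -exprMn /tau mulrCA divff ?gt_eqF// mulr1 sqr_sqrtr ?subrK//.
by rewrite subr_ge0 expr_le1 ?(ltW s0)// ltW.
Qed.

Let taur : tau * r = s.
Proof. by rewrite /tau divfK// gt_eqF. Qed.

(** The likelihood ratio averaged over the prior on v, as a function of Delta: the normalizing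
    factor of the posterior. *)
Let C (x : 'cV[R]_(p + p)) : R :=
  r ^+ p * expR (2^-1 * (tau * r) ^+ 2 * vdot (B^T *m dsubmx x) (B^T *m dsubmx x)).

(** S minus the posterior mean of h. At s = 1 this would be S - I^-1 Delta, the residual of the
    efficient limit. *)
Let y (x : 'cV[R]_(p + p)) : 'cV[R]_p := usubmx x - s ^+ 2 *: (B *m (B^T *m dsubmx x)).

Let my : measurable_fun setT y.
Proof.
rewrite /y; under eq_fun do rewrite -scaleNr.
apply: measurable_addmx2; first exact: measurable_usubmx.
by apply: measurable_scalemx; do 2 apply: measurable_mulmx; exact: measurable_dsubmx.
Qed.

Let mC : measurable_fun setT C.
Proof.
apply: measurable_funM => //; apply: measurableT_comp => //; apply: measurable_funM => //.
by apply: measurable_vdot2; apply: measurable_mulmx; exact: measurable_dsubmx.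
Qed.

Let C0 x : 0 <= C x.
Proof. by rewrite mulr_ge0 ?expR_ge0 ?exprn_ge0 ?(ltW r0). Qed.

(* Averages the shift h = - tau B v over a standard normal v. *)
Let averaged (f : 'cV[R]_p -> R) : measurable_fun setT f -> (forall x, 0 <= f x) ->
  (\int[Np]_v \int[J]_x (f (usubmx x - - tau *: (B *m tuple_col v)) *
      expR (vdot (- tau *: (B *m tuple_col v)) (dsubmx x) -
        2^-1 * vdot (- tau *: (B *m tuple_col v)) (FI *m (- tau *: (B *m tuple_col v)))))%:E =
   \int[J]_x ((C x)%:E * \int[gaussian 0 (invmx FI)]_g (f (y x + s *: g))%:E))%E.
Proof.
move=> mf f0.
pose F (vx : p.-tuple (measurableTypeR R) * 'cV[R]_(p + p)) : \bar R :=
  (f (usubmx vx.2 + tau *: (B *m tuple_col vx.1)) *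
   expR (- tau * vdot (tuple_col vx.1) (B^T *m dsubmx vx.2)
      - 2^-1 * tau ^+ 2 * vdot (tuple_col vx.1) (tuple_col vx.1)))%:E.
have mF : measurable_fun setT F.
  apply/measurable_EFinP; apply: measurable_funM.
    apply: (measurableT_comp mf); apply: measurable_addmx2.
      exact: (measurableT_comp (@measurable_usubmx R p p) measurable_snd).
    apply: measurable_scalemx; apply: measurable_mulmx.
    exact: (measurableT_comp (@measurable_tuple_col R p) measurable_fst).
  apply: measurableT_comp => //; apply: measurable_funB; apply: measurable_funM => //;
    apply: measurable_vdot2;
    try exact: (measurableT_comp (@measurable_tuple_col R p) measurable_fst).
  apply: measurable_mulmx.
  exact: (measurableT_comp (@measurable_dsubmx R p p) measurable_snd).
have F0 vx : (0 <= F vx)%E by rewrite lee_fin mulr_ge0 ?expR_ge0.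
transitivity (\int[Np]_v \int[J]_x F (v, x))%E.
  apply: eq_integral => v _; apply: eq_integral => x _; rewrite /F/=; congr EFin.
  rewrite scaleNr opprK -scaleNr; congr (_ * expR _).
  set u := tuple_col v; have e1 : vdot (B *m u) (dsubmx x) = vdot u (B^T *m dsubmx x).
    by rewrite vdotC vdot_mul vdotC.
  have e2 : vdot (B *m u) (FI *m (B *m u)) = vdot u u.
    by rewrite vdotC vdot_mul mulmxA mulmxA (inv_root_whitening unitFI BFI) mul1mx.
  by rewrite -scalemxAr vdotZr !(vdotC (- tau *: _)) !vdotZr (vdotC _ (B *m u)) e1
    (vdotC (FI *m _)) e2; ring.
(* After the exchange, x is fixed and the integral over v is a posterior mean: its centre moves S to
   [y x], and its spread leaves tau r B w = s B w. *)
rewrite fubini_tonelli//; apply: eq_integral => x _.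
rewrite ge0_integral_gaussian; last 2 first.
- apply/measurable_EFinP; apply: (measurableT_comp mf).
  by apply: measurable_addmx2 => //; exact: measurable_scalemx.
- by move=> g; rewrite lee_fin.
have := @ge0_integral_gaussian_posterior R p tau r (B^T *m dsubmx x)
  (fun u => (f (usubmx x + tau *: (B *m u)))%:E) r0 rtau.
rewrite /F/=; under eq_integral do rewrite -EFinM.
move=> ->; last 2 first.
- apply/measurable_EFinP; apply: (measurableT_comp mf).
  by apply: measurable_addmx2 => //; apply: measurable_scalemx; exact: measurable_mulmx.
- by move=> u; rewrite lee_fin.
congr (_ * _)%E; apply: eq_integral => w _; congr (f _)%:E.
have e : tau * (tau * r ^+ 2) = s ^+ 2 by rewrite -taur; ring.
by rewrite add0r mulmxBr -!scalemxAr scalerBr !scalerA taur e /y -!addrA (addrC (- _)).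
Qed.

(** [HJ] holds at every shift with a bound independent of the shift, so averaging over a probability
    preserves it. *)
Let averaged_le (f : 'cV[R]_p -> R) : lipschitz_fun f -> (forall x, 0 <= f x <= 1) ->
  (\int[J]_x ((C x)%:E * \int[gaussian 0 (invmx FI)]_g (f (y x + s *: g))%:E) <= \int[L]_x (f x)%:E)%E.
Proof.
move=> lf f01; have mf := lipschitz_measurable lf.
have f0 x : 0 <= f x by case/andP: (f01 x).
rewrite -averaged//.
have -> : (\int[L]_x (f x)%:E = \int[Np]_v (cst (\int[L]_x (f x)%:E) v))%E.
  by rewrite prob_integral_cst.
apply: ge0_le_integral => //.
- by move=> v _; apply: integral_ge0 => x _; rewrite lee_fin mulr_ge0 ?expR_ge0.
- apply: (@measurable_fun_fubini_tonelli_F _ _ _ _ R J (fun vx : p.-tuple (measurableTypeR R) * 'cV[R]_(p + p) =>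
     (f (usubmx vx.2 - - tau *: (B *m tuple_col vx.1)) *
      expR (vdot (- tau *: (B *m tuple_col vx.1)) (dsubmx vx.2) -
        2^-1 * vdot (- tau *: (B *m tuple_col vx.1)) (FI *m (- tau *: (B *m tuple_col vx.1)))))%:E)); last first.
    by move=> vx; rewrite lee_fin mulr_ge0 ?expR_ge0.
  have mh : measurable_fun setT (fun vx : p.-tuple (measurableTypeR R) * 'cV[R]_(p + p) =>
      - tau *: (B *m tuple_col vx.1)).
    apply: measurable_scalemx; apply: measurable_mulmx.
    exact: (measurableT_comp (@measurable_tuple_col R p) measurable_fst).
  apply/measurable_EFinP; apply: measurable_funM.
    apply: (measurableT_comp mf); under eq_fun do rewrite -scaleNr.
    apply: measurable_addmx2; first exact: (measurableT_comp (@measurable_usubmx R p p) measurable_snd).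
    apply: measurable_scalemx; apply: measurable_mulmx.
    exact: (measurableT_comp (@measurable_tuple_col R p) measurable_fst).
  apply: measurableT_comp => //; apply: measurable_funB.
    apply: measurable_vdot2 => //.
    exact: (measurableT_comp (@measurable_dsubmx R p p) measurable_snd).
  apply: measurable_funM => //; apply: measurable_vdot2 => //; exact: measurable_mulmx.
- by move=> v _; exact: HJ.
Qed.

(** M is the law of [y] under J reweighted by the density C. *)
Lemma posterior_mixture : exists M : probability 'cV[R]_p R,
  forall f : 'cV[R]_p -> R, lipschitz_fun f -> (forall x, 0 <= f x <= 1) ->
  (\int[M]_y \int[gaussian 0 (invmx FI)]_g (f (y + s *: g))%:E = \int[L]_x (f x)%:E)%E.
Proof.
have mCe : measurable_fun setT (fun x => (C x)%:E) by exact/measurable_EFinP.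
have C0e x : (0 <= (C x)%:E)%E by rewrite lee_fin.
have [nu nuE] := density_measure J mCe C0e.
(* The averaged identity at f = 1: for each v the inner integral is one by [mgfJ]. *)
have nu1 : nu setT = 1%E.
  rewrite nuE; have := @averaged (fun=> 1) (measurable_cst _) (fun=> ler01).
  have -> : (\int[J]_x ((C x)%:E * \int[gaussian 0 (invmx FI)]_g 1%:E) = \int[J]_x (C x)%:E)%E.
    apply: eq_integral => x _; by rewrite prob_integral_cst mule1.
  move=> <-.
  have -> : (1 = \int[Np]_v (cst 1 v) :> \bar R)%E.
    by rewrite prob_integral_cst.
  apply: eq_integral => v _; rewrite -[RHS](mgfJ (- tau *: (B *m tuple_col v))).
  by apply: eq_integral => x _; rewrite mul1r.
(* The mass being one already, [mnormalize] only packages [nu] as a probability; J is its fallback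
   value. *)
pose Pnu : probability 'cV[R]_(p + p) R := mnormalize nu J.
have PnuE A : Pnu A = (\int[J]_(x in A) (C x)%:E)%E.
  by rewrite /Pnu /= /mnormalize nu1 onee_eq0/= invr1 mule1 nuE.
pose y' : {mfun 'cV[R]_(p + p) >-> 'cV[R]_p} :=
  HB.pack y (isMeasurableFun.Build _ _ _ _ y my).
pose M : probability 'cV[R]_p R := distribution Pnu y'.
have mG (f : 'cV[R]_p -> R) : measurable_fun setT f ->
    measurable_fun setT (fun yg : 'cV[R]_p * 'cV[R]_p => (f (yg.1 + s *: yg.2))%:E).
  move=> mf; apply/measurable_EFinP; apply: (measurableT_comp mf).
  apply: measurable_addmx2; first exact: measurable_fst.
  by apply: measurable_scalemx; exact: measurable_snd.
pose Phi (f : 'cV[R]_p -> R) (z : 'cV[R]_p) := (\int[gaussian 0 (invmx FI)]_g (f (z + s *: g))%:E)%E.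
have mPhi (f : 'cV[R]_p -> R) : measurable_fun setT f -> (forall x, 0 <= f x) -> measurable_fun setT (Phi f).
  move=> mf f0; apply: (@measurable_fun_fubini_tonelli_F _ _ _ _ R (gaussian 0 (invmx FI))
    (fun yg : 'cV[R]_p * 'cV[R]_p => (f (yg.1 + s *: yg.2))%:E)); first exact: mG.
  by move=> yg; rewrite lee_fin.
have Phi0 (f : 'cV[R]_p -> R) z : (forall x, 0 <= f x) -> (0 <= Phi f z)%E.
  by move=> f0; apply: integral_ge0 => g _; rewrite lee_fin.
have ME (f : 'cV[R]_p -> R) : measurable_fun setT f -> (forall x, 0 <= f x) ->
    (\int[M]_z Phi f z = \int[J]_x ((C x)%:E * Phi f (y x)))%E.
  move=> mf f0; rewrite ge0_integral_distribution//=; [|exact: mPhi|by move=> z; exact: Phi0].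
  rewrite (ge0_integral_density mCe C0e (fun A _ => PnuE A)).
  - by apply: eq_integral => x _; rewrite muleC.
  - by apply: (measurableT_comp (mPhi _ mf f0)).
  - by move=> x; exact: Phi0.
have Mle (f : 'cV[R]_p -> R) : lipschitz_fun f -> (forall x, 0 <= f x <= 1) ->
    (\int[M]_z Phi f z <= \int[L]_x (f x)%:E)%E.
  move=> lf f01; rewrite ME; first exact: averaged_le.
    exact: lipschitz_measurable.
  by move=> x; case/andP: (f01 x).
exists M => f lf f01.
(* The bounds for f and 1 - f add up to 1 on both sides, so each is an equality. *)
have lf' : lipschitz_fun (fun x => 1 - f x).
  have [K Kf] := lf; exists K => a b.
  by rewrite (_ : 1 - f a - (1 - f b) = - (f a - f b)) ?normrN//; ring.
have f01' x : 0 <= 1 - f x <= 1.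
  by case/andP: (f01 x) => h1 h2; rewrite subr_ge0 h2 gerBl.
have mf := lipschitz_measurable lf; have mf' := lipschitz_measurable lf'.
have f0 x : 0 <= f x by case/andP: (f01 x).
have f0' x : 0 <= 1 - f x by case/andP: (f01' x).
have one (Q : probability 'cV[R]_p R) : (\int[Q]_x 1%:E = 1)%E.
  by rewrite prob_integral_cst.
have LE : (\int[L]_x (f x)%:E + \int[L]_x (1 - f x)%:E = 1)%E.
  rewrite -ge0_integralD//; try first [by move=> x _; rewrite lee_fin | exact/measurable_EFinP].
  by rewrite -(one L); apply: eq_integral => x _; rewrite -EFinD addrC subrK.
have mS (k : 'cV[R]_p -> R) (z : 'cV[R]_p) : measurable_fun setT k ->
    measurable_fun setT (fun g : 'cV[R]_p => (k (z + s *: g))%:E).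
  move=> mk; apply/measurable_EFinP; apply: (measurableT_comp mk).
  by apply: measurable_addmx2 => //; exact: measurable_scalemx.
have MLE : (\int[M]_z Phi f z + \int[M]_z Phi (fun x => 1 - f x)%R z = 1)%E.
  rewrite -ge0_integralD//; try first [by move=> x _; exact: Phi0 | exact: mPhi].
  rewrite -(one M); apply: eq_integral => z _; rewrite /Phi -ge0_integralD//;
    try first [by move=> x _; rewrite lee_fin | exact: mS | exact: (mS (fun x => 1 - f x)%R)].
  by rewrite -[RHS](one (gaussian 0 (invmx FI))); apply: eq_integral => g _; rewrite -EFinD addrC subrK.
have h1 := Mle _ lf f01; have h2 := Mle _ lf' f01'.
apply/eqP; rewrite eq_le h1/=.
move: h1 h2 MLE; rewrite -LE.
have := prob_integral_fin_num L mf f01; have := prob_integral_fin_num L mf' f01'.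
case: (\int[L]_x (1 - f x)%:E)%E => [b'| |]//; case: (\int[L]_x (f x)%:E)%E => [b| |]// _ _.
case: (\int[M]_z Phi f z)%E => [a| |]//; case: (\int[M]_z Phi (fun x => 1 - f x)%R z)%E => [a'| |]//.
by rewrite !lee_fin -!EFinD => h1 h2 [h3]; lra.
Qed.

End posterior_mixture.

Lemma prob_integral_dist d (T : measurableType d) (R : realType) (Q : probability T R)
    (a b e : T -> R) (C : R) :
  measurable_fun setT a -> measurable_fun setT b -> measurable_fun setT e ->
  (forall x, 0 <= a x <= 1) -> (forall x, 0 <= b x <= 1) -> (forall x, 0 <= e x <= C) ->
  (forall x, `|a x - b x| <= e x) ->
  `|fine (\int[Q]_x (a x)%:E)%E - fine (\int[Q]_x (b x)%:E)%E| <= fine (\int[Q]_x (e x)%:E)%E.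
Proof.
move=> ma mb me a01 b01 e01 abe.
have e0 x : 0 <= e x by case/andP: (e01 x).
have half (a' b' : T -> R) : measurable_fun setT a' -> measurable_fun setT b' ->
    (forall x, 0 <= a' x <= 1) -> (forall x, 0 <= b' x <= 1) ->
    (forall x, a' x <= b' x + e x) ->
    fine (\int[Q]_x (a' x)%:E)%E <= fine (\int[Q]_x (b' x)%:E)%E + fine (\int[Q]_x (e x)%:E)%E.
  move=> ma' mb' a'01 b'01 h.
  have b'0 x : 0 <= b' x by case/andP: (b'01 x).
  have a'0 x : 0 <= a' x by case/andP: (a'01 x).
  rewrite -lee_fin EFinD !fineK ?(prob_integral_fin_num _ ma' a'01)
    ?(prob_integral_fin_num _ mb' b'01) ?(prob_integral_fin_num _ me e01)//.
  rewrite -ge0_integralD//; try first [by move=> x _; rewrite lee_fin | exact/measurable_EFinP].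
  apply: ge0_le_integral => //.
  - by move=> x _; rewrite lee_fin.
  - exact/measurable_EFinP.
  - by apply: emeasurable_funD; exact/measurable_EFinP.
  - by move=> x _; rewrite -EFinD lee_fin.
rewrite ler_distl lerBlDr; apply/andP; split; apply: half => // x;
  by have := abe x; rewrite ler_distl lerBlDr => /andP[].
Qed.

(** * The limit of the mixtures as s tends to 1 *)

Section mixture_limit.
Context (R : realType) (p : nat) (L G : probability 'cV[R]_p R).

Let measurable_shift (f : 'cV[R]_p -> R) (s : R) (y : 'cV[R]_p) : measurable_fun setT f ->
  measurable_fun setT (fun g : 'cV[R]_p => f (y + s *: g)).
Proof.
move=> mf; apply: (measurableT_comp mf); apply: measurable_addmx2 => //.
exact: measurable_scalemx.
Qed.

Let mean (f : 'cV[R]_p -> R) (s : R) (y : 'cV[R]_p) : R :=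
  fine (\int[G]_g (f (y + s *: g))%:E)%E.

Let meanE (f : 'cV[R]_p -> R) s y : measurable_fun setT f -> (forall x, 0 <= f x <= 1) ->
  (mean f s y)%:E = (\int[G]_g (f (y + s *: g))%:E)%E.
Proof.
move=> mf f01; rewrite /mean fineK//.
by apply: (prob_integral_fin_num G (C := 1)) => //; exact: measurable_shift.
Qed.

Let mean01 (f : 'cV[R]_p -> R) s y : measurable_fun setT f -> (forall x, 0 <= f x <= 1) ->
  0 <= mean f s y <= 1.
Proof.
move=> mf f01; rewrite -!lee_fin meanE//; apply: prob_integral_bound => //.
exact: measurable_shift.
Qed.

Let lipschitz_mean (f : 'cV[R]_p -> R) s : lipschitz_fun f -> (forall x, 0 <= f x <= 1) ->
  lipschitz_fun (mean f s).
Proof.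
move=> lf f01; have mf := lipschitz_measurable lf; have [K Kf] := lf; exists K => x y.
have K0 : 0 <= K * `|x - y| by rewrite (le_trans _ (Kf x y)).
have -> : K * `|x - y| = fine (\int[G]_g (cst (K * `|x - y|)%:E g))%E.
  by rewrite prob_integral_cst.
apply: (prob_integral_dist G (C := K * `|x - y|)) => // [||_|g].
- exact: measurable_shift.
- exact: measurable_shift.
- by rewrite K0/=.
- by rewrite (le_trans (Kf _ _))// opprD addrACA subrr addr0.
Qed.

(** Bounds the change of f between y + s g and y + g for 1 - s = [2^-1 * harmonic n], uniformly in
    y. The cut at 1 provides a dominating constant, and [+ 0] fits [lipschitz_clip]. *)
Let modulus (K : R) (n : nat) (g : 'cV[R]_p) : R :=
  Num.min 1 (Num.max 0 (K * (2^-1 * harmonic n) * `|g| + 0)).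

Let lipschitz_modulus K n : lipschitz_fun (modulus K n).
Proof.
apply: lipschitz_clip; exists 1 => x y; rewrite mul1r.
exact: ler_dist_dist.
Qed.

Let modulus_cvg (K : R) : fine (\int[G]_g (modulus K n g)%:E)%E @[n --> \oo] --> (0 : R).
Proof.
have mm n : measurable_fun setT (fun g => (modulus K n g)%:E).
  by apply/measurable_EFinP; apply: lipschitz_measurable; exact: lipschitz_modulus.
have d0 n : (0 : R) <= 2^-1 * harmonic n by rewrite mulr_ge0 ?invr_ge0 ?harmonic_ge0.
have iG : G.-integrable setT (cst 1%E : 'cV[R]_p -> \bar R) by exact: finite_measure_integrable_cst.
have c0 : {ae G, forall x : 'cV[R]_p, setT x ->
    (modulus K n x)%:E @[n --> \oo] --> (cst 0%E : 'cV[R]_p -> \bar R) x}.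
  apply: aeW => g _; apply: cvg_EFin; first exact: nearW.
  apply: (@squeeze_cvgr _ _ _ _ (cst 0) (fun n => `|K| * (2^-1 * harmonic n) * `|g|)).
  - apply: nearW => n /=; case/andP: (clip01 (K * (2^-1 * harmonic n) * `|g| + 0)) => h _.
    rewrite h/= /modulus addr0 ge_min ge_max; apply/orP; right; apply/andP; split.
      by rewrite !mulr_ge0.
    by rewrite !ler_wpM2r// ?d0// ler_norm.
  - exact: cvg_cst.
  - have : `|K| * (2^-1 * harmonic n) * `|g| @[n --> \oo] --> `|K| * (2^-1 * 0) * `|g|.
      apply: cvgM; last exact: cvg_cst.
      do 2 (apply: cvgM; first exact: cvg_cst).
      exact: cvg_harmonic.
    by rewrite !mulr0 mul0r.
have b1 : {ae G, forall x : 'cV[R]_p, forall n, setT x ->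
    (`|(modulus K n x)%:E| <= (cst 1%E : 'cV[R]_p -> \bar R) x)%E}.
  apply: aeW => g n _; rewrite lee_fin.
  by case/andP: (clip01 (K * (2^-1 * harmonic n) * `|g| + 0)) => h1 h2; rewrite ger0_norm.
have [_ _] := dominated_convergence measurableT mm (measurable_cst _) c0 iG b1.
by rewrite integral0 => /fine_cvgP[].
Qed.

Let mean_modulus (f : 'cV[R]_p -> R) (K : R) n y : (forall x y, `|f x - f y| <= K * `|x - y|) ->
  (forall x, 0 <= f x <= 1) ->
  `|mean f (1 - 2^-1 * harmonic n) y - mean f 1 y| <= fine (\int[G]_g (modulus K n g)%:E)%E.
Proof.
move=> Kf f01; have mf : measurable_fun setT f by apply: lipschitz_measurable; exists K.
apply: (prob_integral_dist G (C := 1)) => // [||||g].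
- exact: measurable_shift.
- exact: measurable_shift.
- by apply: lipschitz_measurable; exact: lipschitz_modulus.
- by move=> g; exact: clip01.
rewrite /modulus le_min; apply/andP; split.
  have /andP[h1 h2] := f01 (y + (1 - 2^-1 * harmonic n) *: g).
  have /andP[h3 h4] := f01 (y + 1 *: g).
  by rewrite ler_norml; apply/andP; split; lra.
rewrite addr0 le_max; apply/orP; right; rewrite (le_trans (Kf _ _))//.
rewrite opprD addrACA subrr add0r -scalerBl addrAC subrr add0r scaleNr normrN normrZ.
by rewrite ger0_norm ?mulrA// mulr_ge0 ?invr_ge0 ?harmonic_ge0.
Qed.

Hypothesis mixture : forall s : R, 0 < s < 1 -> exists M : probability 'cV[R]_p R,
  forall f : 'cV[R]_p -> R, lipschitz_fun f -> (forall x, 0 <= f x <= 1) ->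
  (\int[M]_y \int[G]_g (f (y + s *: g))%:E = \int[L]_x (f x)%:E)%E.

(** If |y_i| > C + 1 + r and |g_i| <= r, then |y_i + s g_i| > C + 1. Such g have probability at
    least 1/2, so the tail of M is at most twice that of L, uniformly in s. *)
Let mixture_tail (s C r e : R) (M : probability 'cV[R]_p R) i : 0 < s < 1 ->
  (forall f : 'cV[R]_p -> R, lipschitz_fun f -> (forall x, 0 <= f x <= 1) ->
   (\int[M]_y \int[G]_g (f (y + s *: g))%:E = \int[L]_x (f x)%:E)%E) ->
  (L [set x | C < `|x i 0|]%R <= (2^-1 * e)%:E)%E -> (G [set x | r < `|x i 0|]%R <= (2^-1)%:E)%E ->
  (M [set x | C + 1 + r < `|x i 0|]%R <= e%:E)%E.
Proof.
move=> /andP[s0 s1] HM LC Gr.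
have lf := @tail_ramp_lipschitz R p i C.
have f01 x : 0 <= tail_ramp i C x <= 1 by exact: clip01.
have mf := lipschitz_measurable lf.
have mtG := measurable_tail i r.
have mtM := @measurable_tail R p i (C + 1 + r).
have := le_trans (tail_ramp_le L i C) LC.
rewrite -HM// => h.
have half : ((2^-1)%:E * M [set x | C + 1 + r < `|x i 0|]%R <= (2^-1 * e)%:E)%E.
  apply: le_trans h.
  rewrite -[X in M X]setIT -integral_indic// -ge0_integralZl_EFin//; last first.
    by apply/measurable_EFinP; exact: measurable_indic.
  apply: ge0_le_integral => //.
  - by apply: emeasurable_funM => //; apply/measurable_EFinP; exact: measurable_indic.
  - apply: (@measurable_fun_fubini_tonelli_F _ _ _ _ R G
      (fun yg : 'cV[R]_p * 'cV[R]_p => (tail_ramp i C (yg.1 + s *: yg.2))%:E)); last first.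
      by move=> yg; rewrite lee_fin; case/andP: (f01 (yg.1 + s *: yg.2)).
    apply/measurable_EFinP; apply: (measurableT_comp mf).
    apply: measurable_addmx2; first exact: measurable_fst.
    by apply: measurable_scalemx; exact: measurable_snd.
  move=> y _; rewrite indicE.
  have [yM|yM] := boolP (y \in _); last first.
    rewrite mule0; apply: integral_ge0 => g _; rewrite lee_fin.
    by case/andP: (f01 (y + s *: g)).
  rewrite mule1; move: yM; rewrite inE/= => yM.
  apply: (@le_trans _ _ (G (~` [set x | r < `|x i 0|]))).
    rewrite probability_setC// (_ : (2^-1)%:E = (1 - (2^-1)%:E)%E); last first.
      by rewrite -EFinB; congr EFin; lra.
    exact: leeB.
  rewrite -[X in G X]setIT -integral_indic//; last exact: measurableC.
  apply: ge0_le_integral => //.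
  - by apply/measurable_EFinP; apply: measurable_indic; exact: measurableC.
  - by apply/measurable_EFinP; exact: measurable_shift.
  move=> g _; rewrite lee_fin indicE.
  have [gr|gr] := boolP (g \in _); last by case/andP: (f01 (y + s *: g)).
  move: gr; rewrite inE/= => /negP; rewrite -leNgt => gr.
  have key : C + 1 < `|(y + s *: g) i 0|.
    rewrite !mxE; have := ler_normB (y i 0 + s * g i 0) (s * g i 0); rewrite addrK normrM (gtr0_norm s0).
    have : s * `|g i 0| <= r by rewrite (le_trans _ gr)// ler_piMl// ltW.
    by lra.
  rewrite /tail_ramp mul1r max_r; first by rewrite min_l//; lra.
  by lra.
move: half; rewrite EFinM lee_pmul2l//.
Qed.

Lemma mixture_limit : exists M : probability 'cV[R]_p R,
  forall f : 'cV[R]_p -> R, lipschitz_fun f -> (forall x, 0 <= f x <= 1) ->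
  (\int[M]_y \int[G]_g (f (y + g))%:E = \int[L]_x (f x)%:E)%E.
Proof.
(* The factor 1/2 keeps s positive at n = 0, where [harmonic n] is 1. *)
pose s n : R := 1 - 2^-1 * harmonic n.
have s01 n : 0 < s n < 1.
  have h0 : (0 : R) < harmonic n by exact: harmonic_gt0.
  have h1 : harmonic n <= (1 : R) by rewrite /= invf_le1// ler1n.
  by rewrite /s; apply/andP; split; lra.
have [Ms HMs] := choice (fun n => mixture (s01 n)).
have [|M HM] := @prohorov R p Ms.
  move=> i e e0; have e2 : 0 < 2^-1 * e by rewrite mulr_gt0.
  have [C LC] := prob_tail L i e2; have [|r Gr] := @prob_tail R p G i 2^-1; first by rewrite invr_gt0.
  by exists (C + 1 + r); apply: nearW => n; exact: (mixture_tail (s01 n) (HMs n)).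
exists M => f lf f01.
have mf := lipschitz_measurable lf.
have lphi s' := lipschitz_mean s' lf f01; have phi01 s' y := mean01 s' y mf f01.
have mphi s' := lipschitz_measurable (lphi s').
have cphi : continuous (mean f 1) by have [K] := lphi 1; exact: lipschitz_mx_continuous.
have [K Kf] := lf.
(* Law and test function both vary with n in the identity for [s n]. The uniform modulus replaces
   the test function by [mean f 1], which is fixed, so that the convergence of the laws applies. *)
have cL : fine (\int[Ms n]_y (mean f 1 y)%:E)%E @[n --> U] --> fine (\int[L]_x (f x)%:E)%E.
  apply/cvgrPdist_le => e e0; apply: free_ultra_eventually.
  have := modulus_cvg K => /cvgrPdist_le/(_ _ e0); apply: filterS => n /=.
  rewrite sub0r normrN => /(le_trans (ler_norm _)); apply: le_trans.
  rewrite -(HMs n f lf f01); under [X in fine X - _]eq_integral do rewrite -meanE//.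
  set c := fine (\int[G]_g _)%E.
  have c0 : 0 <= c by apply: le_trans (mean_modulus n 0 Kf f01).
  have -> : c = fine (\int[Ms n]_y (cst c%:E y))%E.
    by rewrite prob_integral_cst.
  apply: (prob_integral_dist (Ms n) (C := c)) => //; first by rewrite c0/=.
  by move=> y; exact: mean_modulus.
have E : fine (\int[L]_x (f x)%:E)%E = fine (\int[M]_y (mean f 1 y)%:E)%E.
  exact: (cvg_unique (@Rhausdorff R) cL (HM _ cphi (phi01 1))).
rewrite -[RHS]fineK ?(prob_integral_fin_num L mf f01)// E.
rewrite fineK ?(prob_integral_fin_num M (mphi 1) (phi01 1))//.
by apply: eq_integral => y _; rewrite meanE//; apply: eq_integral => g _; rewrite scale1r.
Qed.

End mixture_limit.

(** * The convolution theorem *)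

Section convolution_theorem.
Context (R : realType) (p : nat) d (Y : measurableType d).
Context (Q : 'cV[R]_p -> probability Y R) (Theta : set 'cV[R]_p).
Context (theta0 : 'cV[R]_p) (FI : 'M[R]_p).
Context (est : forall n, {mfun n.-tuple Y >-> 'cV[R]_p}).
Hypotheses (lanQ : LAN theta0 Theta Q FI) (unitFI : FI \in unitmx).
Hypothesis regQ : regular_estimator theta0 Q est.

Let psdFI : positive_semidefinite FI. Proof. by case: lanQ. Qed.

Let rescaled n (y : n.-tuple Y) : 'cV[R]_p := Num.sqrt n%:R *: (est n y - theta0).

Let measurable_rescaled n : measurable_fun setT (@rescaled n).
Proof.
by apply: measurable_scalemx; apply: (measurableT_comp (@measurable_addmx R p (- theta0))).
Qed.

HB.instance Definition _ n :=
  isMeasurableFun.Build _ _ _ _ (@rescaled n) (@measurable_rescaled n).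

Let S n : {mfun n.-tuple Y >-> 'cV[R]_p} := @rescaled n.

(** Recentring at the local parameter subtracts h from S_n; n = 0 has to be excluded because its
    scaling factor is 0. *)
Let limit_shift (h : 'cV[R]_p) (L : probability 'cV[R]_p R) :
  cvg_in_distribution (fun n => iid (Q (local_param theta0 h n)) n)
    (fun n y => Num.sqrt n%:R *: (est n y - local_param theta0 h n)) L ->
  cvg_in_distribution (fun n => iid (Q (local_param theta0 h n)) n)
    (fun n y => S n y - h) L.
Proof.
move=> reg f cf bf; apply: cvg_trans (reg f cf bf); apply: near_eq_cvg.
exists 1%N => // n /= n1; rewrite expectation.unlock; apply: eq_integral => y _.
rewrite /= /S /rescaled /local_param opprD addrA scalerBr scalerA divff ?scale1r//.
by rewrite gt_eqF// sqrtr_gt0 ltr0n.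
Qed.

(** J is known through bounded continuous functions only. These identify its second marginal, which
    then gives the integral of any nonnegative measurable function, such as the exponentials of
    [mgfJ]. *)
Let distribution_dsubmx (J : probability 'cV[R]_(p + p) R)
    (Delta : forall n, {mfun n.-tuple Y >-> 'cV[R]_p}) :
  cvg_in_distribution (fun n => iid (Q theta0) n) (fun n => Delta n) (gaussian 0 FI) ->
  (forall f : 'cV[R]_(p + p) -> R, continuous f -> (forall x, 0 <= f x <= 1) ->
    fine (\int[iid (Q theta0) n]_w (f (joint S Delta w))%:E)%E @[n --> free_ultra] -->
      fine (\int[J]_x (f x)%:E)%E) ->
  forall f : 'cV[R]_p -> \bar R, measurable_fun setT f -> (forall x, 0 <= f x)%E ->
  (\int[J]_x f (dsubmx x) = \int[gaussian 0 FI]_x f x)%E.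
Proof.
move=> cD cJ f mf f0.
pose ds : {mfun 'cV[R]_(p + p) >-> 'cV[R]_p} :=
  HB.pack (fun x : 'cV[R]_(p + p) => dsubmx x) (isMeasurableFun.Build _ _ _ _ _ (@measurable_dsubmx R p p)).
pose M : probability 'cV[R]_p R := distribution J ds.
have ME (g : 'cV[R]_p -> \bar R) : measurable_fun setT g -> (forall x, 0 <= g x)%E ->
  (\int[M]_x g x = \int[J]_x g (dsubmx x))%E.
  by move=> mg g0; rewrite ge0_integral_distribution.
rewrite -ME//; apply: eq_measure_integral => A mA _.
apply: lipschitz_measure_eq => //  g lg g01.
have mg := lipschitz_measurable lg.
have cg : continuous g by have [K] := lg; exact: lipschitz_mx_continuous.
have cgd : continuous (fun x : 'cV[R]_(p + p) => g (dsubmx x)).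
  by move=> x; apply: (continuous_comp (@continuous_dsubmx R p p x) (cg _)).
have E : (fun n => fine (\int[iid (Q theta0) n]_w (g (dsubmx (joint S Delta w)))%:E)%E) =
    (fun n => fine (\int[iid (Q theta0) n]_w (g (Delta n w))%:E)%E).
  by apply/funext => n; congr fine; apply: eq_integral => w _; rewrite /joint col_mxKd.
have h1 := cJ _ cgd (fun x => g01 _); rewrite E in h1.
have h2 : fine (\int[iid (Q theta0) n]_w (g (Delta n w))%:E)%E @[n --> free_ultra] -->
    fine (\int[gaussian 0 FI]_x (g x)%:E)%E.
  by move=> B /(cvg_in_distribution_fine cD cg g01); exact: free_ultra_eventually.
have h3 : fine (\int[M]_x (g x)%:E)%E = fine (\int[gaussian 0 FI]_x (g x)%:E)%E.
  rewrite ME; last by move=> x; rewrite lee_fin; case/andP: (g01 x).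
    exact: (cvg_unique (@Rhausdorff R) h1 h2).
  exact/measurable_EFinP.
by rewrite -[LHS]fineK ?(prob_integral_fin_num M mg g01)// h3 fineK ?(prob_integral_fin_num _ mg g01).
Qed.

Theorem convolution_theorem : exists M : probability 'cV[R]_p R,
  let L := convolution (gaussian 0 (invmx FI)) M in
  cvg_in_distribution (fun n => iid (Q theta0) n)
    (fun n y => Num.sqrt n%:R *: (est n y - theta0)) L /\
  (finite_second_moments L -> loewner_le (invmx FI) (covariance_mx L)).
Proof.
have [L reg] := regQ.
have cS : cvg_in_distribution (fun n => iid (Q theta0) n) (fun n => S n) L.
  (* At h = 0 regularity says that L is the limit law under theta0. *)
  have := reg 0; have -> : local_param theta0 0 = fun=> theta0; last by [].
  by apply/funext => n; rewrite /local_param scaler0 addr0.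
have [_ [Delta [cD lan]]] := lanQ.
have [J HJ] := joint_limit cS cD.
have [M1 HM1] : exists M : probability 'cV[R]_p R,
    forall f : 'cV[R]_p -> R, lipschitz_fun f -> (forall x, 0 <= f x <= 1) ->
    (\int[M]_y \int[gaussian 0 (invmx FI)]_g (f (y + g))%:E = \int[L]_x (f x)%:E)%E.
  apply: mixture_limit => s /andP[s0 s1]; apply: (@posterior_mixture R p FI psdFI unitFI L J) => //.
    move=> h f lf f01; have [_ [Lr [lr lanh]]] := lan h.
    apply: (lecam HJ (limit_shift (reg h)) lr lanh) => //.
    by have [K] := lf; exact: lipschitz_mx_continuous.
  move=> h; rewrite -[RHS](integral_gaussian_mgf h psdFI).
  rewrite -(distribution_dsubmx cD HJ (f := fun x => (expR (vdot h x - 2^-1 * vdot h (FI *m h)))%:E))//.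
  apply/measurable_EFinP; apply: measurableT_comp => //; apply: measurable_funB => //.
  exact: measurable_vdot.
exists M1; set L' := convolution _ _; split; last first.
  by apply: loewner_le_covariance_convolution; exact: psd_unit_inv_root.
(* L and the convolution agree on Lipschitz functions, hence as laws; convergence to L, which holds
   along the whole sequence, is then the claim. *)
have LE A : measurable A -> L A = L' A.
  apply: lipschitz_measure_eq => f lf f01; have mf := lipschitz_measurable lf.
  rewrite -HM1// ge0_integral_convolution; last 2 first.
  - exact/measurable_EFinP.
  - by move=> x; rewrite lee_fin; case/andP: (f01 x).
  by apply: eq_integral => y _; apply: eq_integral => g _; rewrite addrC.
move=> f cf bf; have := cS f cf bf.
have -> : ('E_L[f] = 'E_L'[f])%E; last by [].
by rewrite expectation.unlock; apply: eq_measure_integral => A mA _; exact: LE.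
Qed.

End convolution_theorem.

Theorem theorem5p3 (R : realType) (p : nat) (Theta : set 'cV[R]_p)
    (P : 'cV[R]_p -> probability R R)
    (T : 'cV[R]_p -> tempered R) (phi : schwartz R)
    (d : measure_display) (Y : measurableType d)
    (TX : {mfun R >-> tempered R})
    (Obs : {mfun tempered R >-> Y})
    (theta0 : 'cV[R]_p) (FI : 'M[R]_p)
    (est : forall n, {mfun n.-tuple Y >-> 'cV[R]_p}) :
  let PO theta := observation_law (P theta) TX Obs in
  distributional_model Theta P T phi ->
  Theta theta0 ->
  LAN theta0 Theta PO FI ->
  FI \in unitmx ->
  regular_estimator theta0 PO est ->
  exists M : probability 'cV[R]_p R,
    let L := convolution (gaussian 0 (invmx FI)) M in
    cvg_in_distribution (fun n => iid (PO theta0) n)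
      (fun n y => Num.sqrt n%:R *: (est n y - theta0)) L /\
    (finite_second_moments L -> loewner_le (invmx FI) (covariance_mx L)).
Proof.
by move=> PO _ _ lanPO unitFI regPO; exact: (convolution_theorem lanPO unitFI regPO).
Qed.
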